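(* Let $V=\mathbb C^N$ be the vector representation of $U_q(gl(N))$ (with $q=e^{\varepsilon}$ not a root of unity), respectively of $U(gl(N))$, and let $J(\lambda)=J_{V,V}(\lambda)$ be the fusion matrix and $R(\lambda)=R_{V,V}(\lambda)=J^{-1}(\lambda)\mathcal R^{21}J^{21}(\lambda)$ the exchange matrix on $V\otimes V$. I. For $U_q(gl(N))$, with $\lambda=(q^{\lambda_1},\dots,q^{\lambda_N})\in T=(\mathbb C^* )^N$, $$J(\lambda)=\sum_{a,b}E_{aa}\otimes E_{bb}+\sum_{a<b}\frac{q^{-1}-q}{q^{2(\lambda_a-\lambda_b+b-a)}-1}\,E_{ba}\otimes E_{ab},$$ $$R(\lambda)=q\sum_{a}E_{aa}\otimes E_{aa}+\sum_{a\ne b}\frac{q^{-1}-q}{q^{2(\lambda_b-\lambda_a+a-b)}-1}\,E_{ba}\otimes E_{ab}+\sum_{a<b}E_{aa}\otimes E_{bb}$$ $$+\sum_{a>b}\frac{(q^{2(\lambda_b-\lambda_a+a-b)}-q^{-2})(q^{2(\lambda_b-\lambda_a+a-b)}-q^{2})}{(q^{2(\lambda_b-\lambda_a+a-b)}-1)^2}\,E_{aa}\otimes E_{bb}.$$ II. For $U(gl(N))$, with $\lambda=(\lambda_1,\dots,\lambda_N)\in T=\mathbb C^N$, $$J(\lambda)=\sum_{a,b}E_{aa}\otimes E_{bb}+\sum_{a<b}\frac{1}{\lambda_b-\lambda_a+a-b}\,E_{ba}\otimes E_{ab},$$ $$R(\lambda)=\sum_{a}E_{aa}\otimes E_{aa}+\sum_{a\ne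 b}\frac{1}{\lambda_a-\lambda_b+b-a}\,E_{ba}\otimes E_{ab}+\sum_{a<b}E_{aa}\otimes E_{bb}$$ $$+\sum_{a>b}\frac{(\lambda_b-\lambda_a+a-b-1)(\lambda_b-\lambda_a+a-b+1)}{(\lambda_b-\lambda_a+a-b)^2}\,E_{aa}\otimes E_{bb}.$$
   Context: $V$ has standard basis $v_1,\dots,v_N$, with $f_iv_j=\delta_{i,j}v_{i+1}$, $e_iv_j=\delta_{i+1,j}v_i$, and $E_{ij}v_k=\delta_{jk}v_i$. $U_q(gl(N))$ has generators $e_i,f_i$ ($1\le i\le N-1$), $k_i^{\pm1}$ ($1\le i\le N$), $k_iv_j=q^{\delta_{ij}}v_j$, $K_i=k_ik_{i+1}^{-1}$, with coproduct $\Delta(e_i)=e_i\otimes K_i+1\otimes e_i$, $\Delta(f_i)=f_i\otimes1+K_i^{-1}\otimes f_i$, $\Delta(k_i)=k_i\otimes k_i$ (conventions of Chari-Pressley). For $U(gl(N))$ the usual coproduct is used. $\mathcal R$ is the universal R-matrix, acting on $V\otimes V$ as $\mathcal R=q\sum_aE_{aa}\otimes E_{aa}+\sum_{a\neq b}E_{aa}\otimes E_{bb}+\sum_{a<b}(q-q^{-1})E_{ab}\otimes E_{ba}$; for $U(gl(N))$, $\mathcal R=1$. For $\lambda\in T$, $M_\lambda$ is the Verma module with highest weight vector $v_\lambda$ killed by all $e_i$ and with $k_iv_\lambda=q^{\lambda_i}v_\lambda$ (for $U(gl(N))$: $E_{ii}v_\lambda=\lambda_iv_\lambda$). For a finite dimensional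 weight module $V$, $v\in V$ of weight $\lambda_v$ and generic $\lambda$, $\Phi^v_\lambda:M_\lambda\to M_{\lambda-\lambda_v}\otimes V$ is the unique intertwining operator such that $\Phi^v_\lambda v_\lambda=v_{\lambda-\lambda_v}\otimes v+\sum(\text{lower weight vectors of }M_{\lambda-\lambda_v})\otimes\cdots$. The fusion matrix $J_{W,V}(\lambda):W\otimes V\to W\otimes V$ is defined by $J_{W,V}(\lambda)(w\otimes v)=u$, where $(\Phi^w_{\lambda-\lambda_v}\otimes1)\Phi^v_\lambda=\Phi^u_\lambda$ for weight vectors $w,v$. $J^{21}=PJP$ with $P$ the permutation of factors. *)

(* Defs.v *)
From HB Require Import structures.
From mathcomp Require Import all_boot all_order all_algebra.
From mathcomp Require Import complex mxtens ring_quotient.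
From mathcomp Require Import boolp classical_sets reals sequences exp trigo.
From mathcomp Require Import monalg.

Set Implicit Arguments.
Unset Strict Implicit.
Unset Printing Implicit Defensive.

Import GRing.Theory.
Local Open Scope ring_scope.
Local Open Scope quotient_scope.

(* The monomials {fmonom G} are the words on G, so this is the free
   (noncommutative) algebra. *)
Notation free_alg K G := {malg K[{fmonom G}]}.

Section Words.
Variables (K : fieldType) (G : choiceType).
Definition word (w : seq G) : free_alg K G := mkmalgU (FMonom w) 1.
Definition letter (g : G) : free_alg K G := word [:: g].
End Words.
Arguments word K {G} w.
Arguments letter K {G} g.

(* The left module A / A.S, for A an algebra and S a set of elements of A. *)
Section LeftIdealQuotient.
Variables (K : fieldType) (A : lalgType K) (S : A -> Prop).

Definition left_ideal_closed (P : A -> Prop) : Prop :=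
  [/\ P 0, forall x y, P x -> P y -> P (x + y) & forall a x, P x -> P (a * x)].

Definition left_ideal : {pred A} := fun x =>
  `[< forall P, left_ideal_closed P -> (forall s, S s -> P s) -> P x >].

Fact left_idealM a x : x \in left_ideal -> a * x \in left_ideal.
Proof.
move=> /asboolP hx; apply/asboolP => P hP hS.
by case: (hP) => _ _ hM; apply: hM; exact: hx.
Qed.

Fact left_ideal_zmod : zmod_closed left_ideal.
Proof.
split=> [|x y /asboolP hx /asboolP hy]; apply/asboolP => P hP hS.
  by case: hP.
case: (hP) => _ hD hM; apply: hD; first exact: hx.
by rewrite -mulN1r; apply: hM; exact: hy.
Qed.
HB.instance Definition _ := GRing.isZmodClosed.Build A left_ideal
  left_ideal_zmod.

Definition lquot := Quotient.quot left_ideal.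
HB.instance Definition _ := Choice.on lquot.
HB.instance Definition _ : EqQuotient A (Quotient.equiv left_ideal) lquot :=
  EqQuotient.on lquot.
HB.instance Definition _ := GRing.Zmodule.on lquot.

Definition lquot_act (a : A) (x : lquot) : lquot := \pi_lquot (a * repr x).

Fact lquot_actE a x : lquot_act a (\pi_lquot x) = \pi_lquot (a * x).
Proof.
apply/eqP; rewrite /lquot_act -Quotient.idealrBE -mulrBr left_idealM //.
by rewrite Quotient.idealrBE reprK.
Qed.

Fact lquot_addE x y : \pi_lquot x + \pi_lquot y = \pi_lquot (x + y).
Proof. by rewrite Quotient.pi_add. Qed.

Definition lquot_scale (c : K) (x : lquot) : lquot := \pi_lquot (c *: repr x).

Fact lquot_scaleE c x : lquot_scale c (\pi_lquot x) = \pi_lquot (c *: x).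
Proof.
have := lquot_actE c%:A x.
by rewrite /lquot_act -!scalerAl !mul1r.
Qed.

Fact lquot_scaleA a b x :
  lquot_scale a (lquot_scale b x) = lquot_scale (a * b) x.
Proof. by rewrite -[x]reprK (lquot_scaleE b) !lquot_scaleE scalerA. Qed.

Fact lquot_scale1 : left_id 1 lquot_scale.
Proof. by move=> x; rewrite -[x]reprK lquot_scaleE scale1r. Qed.

Fact lquot_scaleDr : right_distributive lquot_scale +%R.
Proof.
move=> a x y; rewrite -[x]reprK -[y]reprK lquot_addE !lquot_scaleE scalerDr.
by rewrite lquot_addE.
Qed.

Fact lquot_scaleDl x : {morph lquot_scale^~ x : a b / a + b}.
Proof.
by move=> a b; rewrite -[x]reprK !lquot_scaleE scalerDl lquot_addE.
Qed.

HB.instance Definition _ := GRing.Zmodule_isLmodule.Build K lquot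
  lquot_scaleA lquot_scale1 lquot_scaleDr lquot_scaleDl.
End LeftIdealQuotient.

(* U_q(gl(n.+1)) or U(gl(n.+1)) by generators and relations, with the part of
   the structure that enters the definition of Verma modules, intertwiners and
   fusion matrices.  [rel r] imposes r = 0; [cop g] lists the
   pairs (w1, w2) of words such that Delta(g) is the sum of the w1 (x) w2; a
   vector has weight mu : 'I_n.+1 -> K when each [cartan i] acts on it by
   [chi (mu i)]. *)
Record hopf_pres (K : fieldType) (n : nat) := HopfPres {
  gen : choiceType;
  rel : free_alg K gen -> Prop;
  cop : gen -> seq (seq gen * seq gen);
  raise : 'I_n -> gen;
  cartan : 'I_n.+1 -> gen;
  chi : K -> K
}.

Section Fusion.
Variables (K : fieldType) (n : nat) (U : hopf_pres K n).
Local Notation G := (gen U).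
Local Notation F := (free_alg K G).
Local Notation weight := ('I_n.+1 -> K).
Implicit Types lam mu nu : weight.

Definition lo (i : 'I_n) : 'I_n.+1 := widen_ord (leqnSn n) i.
Definition up (i : 'I_n) : 'I_n.+1 := lift ord0 i.

(* Left multiples of the [verma_rel_alg] span the two-sided ideal generated by
   the relations of U, so the quotient is U / U.(e_i, cartan_i - chi lam_i). *)
Inductive verma_rel lam : F -> Prop :=
| verma_rel_alg r b of rel r : verma_rel lam (r * b)
| verma_rel_raise i : verma_rel lam (letter K (raise U i))
| verma_rel_cartan i :
    verma_rel lam (letter K (cartan U i) - (chi U (lam i))%:A).

Definition verma lam := lquot (verma_rel lam).
Definition hw lam : verma lam := \pi_(verma lam) 1.
Definition vact lam : F -> verma lam -> verma lam :=
  @lquot_act K F (verma_rel lam).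

Definition verma_weight lam mu (x : verma lam) : Prop :=
  forall i, vact (letter K (cartan U i)) x = chi U (mu i) *: x.

Definition simple_root (i : 'I_n) : weight :=
  fun j => (j == lo i)%:R - (j == up i)%:R.

Definition lower lam (x : verma lam) : Prop :=
  exists2 s : seq (verma lam), x = \sum_(y <- s) y &
    forall y, y \in s -> exists2 m : 'I_n -> nat, (exists i, m i != 0%N) &
      verma_weight (fun j => lam j - \sum_i simple_root i j *+ m i) y.

(* Finite dimensional modules are given on K^m (column vectors) by the
   matrices of the generators. *)
Definition rep m := G -> 'M[K]_m.

Definition rep_word m (rho : rep m) (w : seq G) : 'M[K]_m :=
  foldr (fun g A => rho g *m A) 1%:M w.

Definition rep_tens m p (W : rep m) (V : rep p) : rep (m * p) := fun g =>
  \sum_(c <- cop g) rep_word W c.1 *t rep_word V c.2.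

Definition weight_vector m (V : rep m) mu (v : 'cV[K]_m) : Prop :=
  v != 0 /\ forall i, V (cartan U i) *m v = chi U (mu i) *: v.

(* M (x) K^m is {ffun 'I_m -> M}: x stands for the sum of the x_j (x) v_j. *)
Definition op_tens (M : lmodType K) m (f : M -> M) (B : 'M[K]_m)
    (x : {ffun 'I_m -> M}) : {ffun 'I_m -> M} :=
  [ffun i => \sum_j B i j *: f (x j)].

Definition verma_tens_act nu m (V : rep m) (g : G)
    (x : {ffun 'I_m -> verma nu}) : {ffun 'I_m -> verma nu} :=
  \sum_(c <- cop g) op_tens (vact (word K c.1)) (rep_word V c.2) x.

(* Phi = Phi^v_lam : M_lam -> M_nu (x) V, where nu = lam - (weight of v). *)
Definition is_Phi lam nu m (V : rep m) (v : 'cV[K]_m)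
    (Phi : verma lam -> {ffun 'I_m -> verma nu}) : Prop :=
  [/\ linear Phi,
      forall g x, Phi (vact (letter K g) x) = verma_tens_act V g (Phi x)
    & forall i, lower (Phi (hw lam) i - v i 0 *: hw nu)].

(* (Phi2 (x) 1) Phi1, with (M (x) W) (x) V identified with M (x) (W (x) V) *)
Definition Phi_comp lam nu1 nu2 m p
    (Phi2 : verma nu1 -> {ffun 'I_m -> verma nu2})
    (Phi1 : verma lam -> {ffun 'I_p -> verma nu1}) :
    verma lam -> {ffun 'I_(m * p) -> verma nu2} := fun x =>
  [ffun k => Phi2 (Phi1 x (mxtens_unindex k).2) (mxtens_unindex k).1].

Definition is_fusion_matrix m p (W : rep m) (V : rep p) lam
    (J : 'M[K]_(m * p)) : Prop :=
  forall nu1 nu2 (w : 'cV[K]_m) (v : 'cV[K]_p) Phi1 Phi2,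
    weight_vector V (fun i => lam i - nu1 i) v ->
    weight_vector W (fun i => nu1 i - nu2 i) w ->
    @is_Phi lam nu1 p V v Phi1 -> @is_Phi nu1 nu2 m W w Phi2 ->
    is_Phi (rep_tens W V) (J *m (w *t v) : 'cV_(m * p)) (Phi_comp Phi2 Phi1).

(* Junk value 0 at those lam where no matrix has the defining property. *)
Definition fusion_matrix m p (W : rep m) (V : rep p) lam : 'M[K]_(m * p) :=
  xget 0 [set J | is_fusion_matrix W V lam J]%classic.

Definition flip_mx m : 'M[K]_(m * m) :=
  \matrix_(i, j) (((mxtens_unindex i).1 == (mxtens_unindex j).2) &&
                  ((mxtens_unindex i).2 == (mxtens_unindex j).1))%:R.

Definition mx21 m (A : 'M[K]_(m * m)) : 'M[K]_(m * m) :=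
  flip_mx m *m A *m flip_mx m.

(* Rm is the action of the universal R-matrix on V (x) V. *)
Definition exchange_matrix m (V : rep m) (Rm : 'M[K]_(m * m)) lam :=
  invmx (fusion_matrix V V lam) *m mx21 Rm *m mx21 (fusion_matrix V V lam).

End Fusion.

Definition EE (K : fieldType) (m : nat) (a b c d : 'I_m) : 'M[K]_(m * m) :=
  delta_mx a b *t delta_mx c d.
Arguments EE {K m} a b c d.

Section ComplexExp.
Variable R : realType.
Local Open Scope complex_scope.
Definition cexp (z : R[i]) : R[i] :=
  let: x +i* y := z in (expR x * cos y) +i* (expR x * sin y).
End ComplexExp.

Inductive qgen (n : nat) :=
  Qe of 'I_n | Qf of 'I_n | Qk of 'I_n.+1 | Qkinv of 'I_n.+1.
HB.instance Definition _ n := gen_eqMixin (qgen n).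
HB.instance Definition _ n := gen_choiceMixin (qgen n).
Arguments Qk {n} _.
Arguments Qkinv {n} _.

Section QuantumGl.
Variables (K : fieldType) (n : nat) (q : K).
Local Notation e i := (letter K (Qe i)).
Local Notation f i := (letter K (Qf i)).
Local Notation k i := (letter K (Qk i)).
Local Notation kV i := (letter K (Qkinv i)).

Definition root_pairing (i : 'I_n.+1) (j : 'I_n) : int :=
  (i == lo j)%:Z - (i == up j)%:Z.

Inductive Uq_rel : free_alg K (qgen n) -> Prop :=
| Uq_kk i j : Uq_rel (k i * k j - k j * k i)
| Uq_kkV i : Uq_rel (k i * kV i - 1)
| Uq_kVk i : Uq_rel (kV i * k i - 1)
| Uq_ke i j : Uq_rel (k i * e j - q ^ root_pairing i j *: (e j * k i))
| Uq_kf i j : Uq_rel (k i * f j - q ^ (- root_pairing i j) *: (f j * k i))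
| Uq_ef i : Uq_rel (e i * f i - f i * e i
    - (q - q^-1)^-1 *: (k (lo i) * kV (up i) - kV (lo i) * k (up i)))
| Uq_ef_neq i j of i != j : Uq_rel (e i * f j - f j * e i)
| Uq_ee (i j : 'I_n) of (i.+1 < j)%N : Uq_rel (e i * e j - e j * e i)
| Uq_ff (i j : 'I_n) of (i.+1 < j)%N : Uq_rel (f i * f j - f j * f i)
| Uq_serre_e (i j : 'I_n) of (i.+1 == j) || (j.+1 == i) :
    Uq_rel (e i * e i * e j - (q + q^-1) *: (e i * e j * e i) + e j * e i * e i)
| Uq_serre_f (i j : 'I_n) of (i.+1 == j) || (j.+1 == i) :
    Uq_rel (f i * f i * f j - (q + q^-1) *: (f i * f j * f i) + f j * f i * f i).

(* K_i = k_i k_{i+1}^-1 is spelled out as the word [:: Qk (lo i); Qkinv (up i)]. *)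
Definition Uq_cop (g : qgen n) : seq (seq (qgen n) * seq (qgen n)) :=
  match g with
  | Qe i => [:: ([:: Qe i], [:: Qk (lo i); Qkinv (up i)]); ([::], [:: Qe i])]
  | Qf i => [:: ([:: Qf i], [::]); ([:: Qkinv (lo i); Qk (up i)], [:: Qf i])]
  | Qk i => [:: ([:: Qk i], [:: Qk i])]
  | Qkinv i => [:: ([:: Qkinv i], [:: Qkinv i])]
  end.

Definition Uq_vector (g : qgen n) : 'M[K]_n.+1 :=
  match g with
  | Qe i => delta_mx (lo i) (up i)
  | Qf i => delta_mx (up i) (lo i)
  | Qk i => diag_mx (\row_j q ^+ (i == j))
  | Qkinv i => diag_mx (\row_j q ^- (i == j))
  end.

Definition Uq_Rmatrix : 'M[K]_(n.+1 * n.+1) :=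
  q *: \sum_(a < n.+1) EE a a a a
  + \sum_(a < n.+1) \sum_(b < n.+1 | b != a) EE a a b b
  + \sum_(a < n.+1) \sum_(b < n.+1 | (a < b)%N) (q - q^-1) *: EE a b b a.

End QuantumGl.

(* Weights are recorded by their exponents lam, q ^ lam_i being
   exp (eps * lam_i). *)
Definition Uq (R : realType) (n : nat) (eps : R[i]) : hopf_pres R[i] n :=
  {| gen := qgen n; rel := @Uq_rel _ n (cexp eps); cop := @Uq_cop n;
     raise := @Qe n; cartan := @Qk n; chi := fun x => cexp (eps * x) |}.

Section ClassicalGl.
Variables (K : fieldType) (n : nat).
Local Notation I := 'I_n.+1.
Local Notation E i j := (letter K (i, j)).

Inductive Ugl_rel : free_alg K (I * I)%type -> Prop :=
| Ugl_bracket (i j k l : I) : Ugl_rel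
    (E i j * E k l - E k l * E i j - (j == k)%:R *: E i l + (l == i)%:R *: E k j).

Definition Ugl : hopf_pres K n :=
  {| gen := (I * I)%type; rel := Ugl_rel;
     cop := fun g => [:: ([:: g], [::]); ([::], [:: g])];
     raise := fun i => (lo i, up i); cartan := fun i => (i, i);
     chi := id |}.

Definition Ugl_vector (g : I * I) : 'M[K]_n.+1 := delta_mx g.1 g.2.

End ClassicalGl.

(* The usual genericity conditions on lam (for q not a root of unity), under which all M_nu with nu in
   lam + Z^(n.+1) are irreducible. *)
Definition generic_q (R : realType) (n : nat) (eps : R[i])
    (lam : 'I_n.+1 -> R[i]) : Prop :=
  forall a b, a != b -> forall m : int,
    cexp (eps * (2%:R * (lam a - lam b + m%:~R))) != 1.

Definition generic (R : realType) (n : nat) (lam : 'I_n.+1 -> R[i]) : Prop :=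
  forall a b, a != b -> forall m : int, lam a - lam b != m%:~R.

(* Main.v *)
(* An intertwiner M_lam -> M_nu (x) V is the same as a singular vector
   sum_b u_b (x) v_b with u_j = v_nu, where v_j has weight lam - nu.  The u_b
   are built by a chain of deformed commutators of f_(j-1), ..., f_b applied to
   v_nu, whose coefficients (quotients of (q-)numbers [nu_a - nu_j + m]) are
   chosen such that e_b sends u_b to a multiple of u_(b+1) and the other e_i
   kill u_b.
   Let phi be the functional on M_nu that is 1 on v_nu and vanishes on the
   images of the f_i.  The columns of J(lam) are the values
   phi (Phi2 (u_b)_a).  The functionals psi_a := phi (Phi2 (-)_a) satisfy
   psi_(i+1) o f_i = c * psi_i and psi_a o f_i = 0 for a != i+1, hence form a
   dual chain, made of the e_i acting on functionals by the same commutator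
   formula; on u_b it vanishes except at the entries of the identity and, for each
   k < j, at one entry sending v_k (x) v_j to v_j (x) v_k.  R(lam) is then a
   product of matrices with blocks of size at most 2.
   That phi exists amounts to v_nu != 0.  For U_q(gl_N), the quotient of the
   module spanned by all the words in the f_i by its submodule generated by the
   Serre relations does not kill v_nu; for U(gl_N), a module with such a
   functional is obtained by parabolic induction on N. *)
Require Import Defs.
From HB Require Import structures.
From mathcomp Require Import all_boot all_order all_algebra.
From mathcomp Require Import complex mxtens ring_quotient.
From mathcomp Require Import boolp classical_sets functions reals exp trigo.
From mathcomp Require Import finmap monalg ring zify.

Set Implicit Arguments.
Unset Strict Implicit.
Unset Printing Implicit Defensive.

Import GRing.Theory Num.Theory.
Local Open Scope ring_scope.
Local Open Scope quotient_scope.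

(** * Linear combinations and free algebras *)

(** [fusion_matrix] selects a matrix by its defining property, so two facts are needed. The explicit
    matrix must have the property for every pair of intertwiners; hence the evaluation of phi (Phi2
    (u_b)_a) uses only that u is singular with the prescribed leading term, never a formula for u.
    And the property must determine the matrix, which would fail if there were no intertwiners at
    all: this is the purpose of the explicit singular vectors. Leading terms modulo lower weight
    vectors become scalar equations under phi, so neither a basis of a Verma module nor its weight
    multiplicities are ever computed. A nonzero weight vector determines its weight only through
    [chi], and in the quantum case [chi] is periodic; one step from lam to nu is therefore recorded
    through [chi], and genericity is put in a form that such a step preserves. The coefficients of
    both chains rest on [x+1][y+1] - [x][y] = [x+y+1], which holds for numbers and for q-numbers;
    with it one argument, over an abstract record, covers both algebras. *)

Section LinearFunctions.
Variables (K : fieldType) (X Y Z : lmodType K).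

Lemma linear_add (f : X -> Y) : linear f -> {morph f : x y / x + y}.
Proof. by move=> hf x y; rewrite -[x]scale1r hf !scale1r. Qed.

Lemma linear_zero (f : X -> Y) : linear f -> f 0 = 0.
Proof. by move=> hf; apply: (addrI (f 0)); rewrite -linear_add // !addr0. Qed.

Lemma linear_scale (f : X -> Y) a : linear f -> {morph f : x / a *: x}.
Proof. by move=> hf x; rewrite -[a *: x]addr0 hf linear_zero // addr0. Qed.

Lemma linear_sub (f : X -> Y) : linear f -> {morph f : x y / x - y}.
Proof.
by move=> hf x y; rewrite -scaleN1r linear_add // linear_scale // scaleN1r.
Qed.

Lemma linear_opp (f : X -> Y) : linear f -> {morph f : x / - x}.
Proof. by move=> hf x; rewrite -scaleN1r linear_scale // scaleN1r. Qed.

Lemma lin_sum (f : X -> Y) : linear f ->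
  forall I (r : seq I) (P : pred I) (F : I -> X),
    f (\sum_(i <- r | P i) F i) = \sum_(i <- r | P i) f (F i).
Proof.
by move=> hf I r P F; apply: big_morph; [exact: linear_add|exact: linear_zero].
Qed.

Lemma linear_comp (f : Y -> Z) (g : X -> Y) : linear f -> linear g ->
  linear (fun x => f (g x)).
Proof. by move=> hf hg a x y; rewrite hg hf. Qed.

End LinearFunctions.

Section LinearCombinations.
Variables (K : fieldType) (M : lmodType K).

Inductive lexp :=
  | LVar of nat | LZero | LAdd of lexp & lexp | LOpp of lexp
  | LScale of K & lexp.

Fixpoint leval (env : seq M) (e : lexp) : M :=
  match e with
  | LVar i => env`_i
  | LZero => 0
  | LAdd e1 e2 => leval env e1 + leval env e2
  | LOpp e1 => - leval env e1
  | LScale c e1 => c *: leval env e1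
  end.

Fixpoint lcoef (i : nat) (e : lexp) : K :=
  match e with
  | LVar j => if i == j then 1 else 0
  | LZero => 0
  | LAdd e1 e2 => lcoef i e1 + lcoef i e2
  | LOpp e1 => - lcoef i e1
  | LScale c e1 => c * lcoef i e1
  end.

(** A nested conjunction rather than a bounded quantifier: after [simpl] it splits into one scalar
    goal per atom, within reach of [ring] or [field]. *)
Fixpoint leqcoef (m : nat) (e1 e2 : lexp) : Prop :=
  if m is i.+1 then lcoef i e1 = lcoef i e2 /\ leqcoef i e1 e2 else True.

Lemma leval_sum env e :
  leval env e = \sum_(i < size env) lcoef i e *: env`_i.
Proof.
elim: e => /= [j||e1 -> e2 ->|e1 ->|c e1 ->].
- have [lj|gj] := ltnP j (size env); last first.
    rewrite nth_default // big1 // => i _.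
    by rewrite ltn_eqF ?scale0r // (leq_trans _ gj).
  rewrite (bigD1 (Ordinal lj)) //= eqxx scale1r big1 ?addr0 // => i hi.
  by rewrite ifN ?scale0r.
- by rewrite big1 // => i _; rewrite scale0r.
- by rewrite -big_split; apply: eq_bigr => i _; rewrite scalerDl.
- by rewrite -sumrN; apply: eq_bigr => i _; rewrite scaleNr.
- by rewrite scaler_sumr; apply: eq_bigr => i _; rewrite scalerA.
Qed.

Lemma leqcoefP env e1 e2 :
  leqcoef (size env) e1 e2 -> leval env e1 = leval env e2.
Proof.
move=> h; rewrite !leval_sum; apply: eq_bigr => -[i hi] _ /=; congr (_ *: _).
elim: (size env) h hi => //= m IH [h1 h2]; rewrite ltnS leq_eqVlt.
by case/orP => [/eqP -> //|]; apply: IH.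
Qed.

End LinearCombinations.

Ltac lmem x l :=
  match l with
  | nil => constr:(false)
  | cons x _ => constr:(true)
  | cons _ ?l' => lmem x l'
  end.
Ltac latoms t l :=
  match t with
  | ?a + ?b => let l1 := latoms a l in latoms b l1
  | - ?a => latoms a l
  | _ *: ?a => latoms a l
  | 0 => l
  | _ => match lmem t l with
         | true => l
         | false => constr:(t :: l)
         end
  end.
Ltac lindex x l :=
  match l with
  | cons x _ => constr:(0%N)
  | cons _ ?l' => let i := lindex x l' in constr:(S i)
  end.
Ltac lreify K t l :=
  match t with
  | ?a + ?b => let u := lreify K a l in let v := lreify K b l in
               constr:(LAdd u v)
  | - ?a => let u := lreify K a l in constr:(LOpp u)
  | ?c *: ?a => let u := lreify K a l in constr:(LScale c u)
  | 0 => constr:(@LZero K)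
  | _ => let i := lindex t l in constr:(@LVar K i)
  end.
(* Reduces an equality of linear combinations in a K-module to the equality of
   the coefficients of each atom. *)
Ltac lmod K M :=
  match goal with
  | |- ?x = ?y =>
    let l0 := latoms x (@nil M) in
    let l := latoms y l0 in
    let e1 := lreify K x l in let e2 := lreify K y l in
    apply: (@leqcoefP K M l e1 e2); simpl;
    repeat split
  end.

Section WordAction.
Variables (K : fieldType) (G : Type) (A : lalgType K) (X : lmodType K).
Variables (w : seq G -> A) (act : A -> X -> X).
Hypothesis wM : forall s t, w (s ++ t) = w s * w t.
Hypothesis wZ : forall c s t, w s * (c *: w t) = c *: (w s * w t).
Hypothesis w_ind : forall P : A -> Prop, P 0 ->
  (forall a b, P a -> P b -> P (a + b)) -> (forall c s, P (c *: w s)) ->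
  forall a, P a.

(** An [lalgType] moves scalars out of the left factor only. For the right factor, linearity in each
    argument reduces the claim to two words, where it is [wZ]. *)
Lemma word_scaleA (c : K) (a b : A) : a * (c *: b) = c *: (a * b).
Proof.
elim/w_ind: a => [|a a' IH IH'|d s].
- by rewrite !mul0r scaler0.
- by rewrite !mulrDl IH IH' scalerDr.
elim/w_ind: b => [|b b' IH IH'|d' t].
- by rewrite scaler0 mulr0 scaler0.
- by rewrite scalerDr !mulrDr IH IH' scalerDr.
by rewrite scalerA -!scalerAl !wZ !scalerA mulrCA mulrA.
Qed.

Hypothesis actL : forall a, linear (act a).
Hypothesis act_linear : forall x, linear (act ^~ x).
Hypothesis actW : forall s t x, act (w (s ++ t)) x = act (w s) (act (w t) x).

Lemma word_actM (a b : A) x : act (a * b) x = act a (act b x).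
Proof.
pose actD a b x := linear_add (act_linear x) a b.
pose actZ c a x := linear_scale c (act_linear x) a.
pose act0 x := linear_zero (act_linear x).
elim/w_ind: a => [|a a' IH IH'|c s].
- by rewrite mul0r !act0.
- by rewrite mulrDl !actD IH IH'.
rewrite -scalerAl !actZ; congr (_ *: _).
elim/w_ind: b => [|b b' IH IH'|c' t].
- by rewrite mulr0 !act0 (linear_zero (actL _)).
- by rewrite mulrDr !actD IH IH' (linear_add (actL _)).
by rewrite wZ -wM !actZ (linear_scale _ (actL _)) actW.
Qed.

End WordAction.

Section FreeAction.
Variables (K : fieldType) (G : choiceType).
Local Notation F := (free_alg K G).

Lemma word0 : word K [::] = 1 :> F.
Proof. by rewrite /word -[FMonom _]/(FMonom [::]) -fmoneE. Qed.

Lemma wordM (s t : seq G) : word K (s ++ t) = word K s * word K t :> F.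
Proof.
rewrite /word; rewrite malgM_def fgmulUU mulr1; congr mkmalgU; exact/esym/(fmmulE (FMonom s) (FMonom t)).
Qed.

Lemma word_cons g (s : seq G) : word K (g :: s) = letter K g * word K s :> F.
Proof. by rewrite -wordM. Qed.

Lemma wordZ c (w : seq G) : c *: word K w = << c *g FMonom w >> :> F.
Proof. by apply/malgP => k; rewrite mcoeffZ !mcoeffU mulrnAr mulr1. Qed.

Lemma word_scaleAr c (s t : seq G) :
  word K s * (c *: word K t) = c *: (word K s * word K t) :> F.
Proof.
rewrite -wordM !wordZ /word malgM_def fgmulUU mul1r; congr mkmalgU.
exact: (fmmulE (FMonom s) (FMonom t)).
Qed.

Lemma free_ind (P : F -> Prop) : P 0 -> (forall a b, P a -> P b -> P (a + b)) ->
  (forall c w, P (c *: word K w)) -> forall a, P a.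
Proof.
move=> P0 PD PW a; rewrite [a]monalgE; apply: big_ind => [//|//|m _].
by rewrite -[m]fmK -wordZ; apply: PW.
Qed.

Variables (X : lmodType K) (op : G -> X -> X).
Hypothesis opL : forall g, linear (op g).

Definition wact (w : seq G) (x : X) : X := foldr op x w.

Definition free_act (a : F) (x : X) : X :=
  \sum_(m <- msupp a) a@_m *: wact (m : seq G) x.

Lemma wactL w : linear (wact w).
Proof. by elim: w => // g w IH a x y; rewrite /wact /= [foldr _ _ _]IH opL. Qed.

(** Lets elements with different supports be summed over a common one, as additivity of the action
    requires. *)
Lemma free_actEw (d : {fset {fmonom G}}) a x : (msupp a `<=` d)%fset ->
  free_act a x = \sum_(m <- d) a@_m *: wact (m : seq G) x.
Proof.
move=> le; rewrite [LHS](big_fset_incl _ le) => //= m _ /mcoeff_outdom ->.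
by rewrite scale0r.
Qed.

Lemma free_actL a : linear (free_act a).
Proof.
move=> c x y; rewrite /free_act scaler_sumr -big_split; apply: eq_bigr => m _ /=.
by rewrite wactL scalerDr !scalerA mulrC.
Qed.

Lemma free_actDZ c a b x : free_act (c *: a + b) x = c *: free_act a x + free_act b x.
Proof.
pose d := (msupp (c *: a + b) `|` (msupp a `|` msupp b))%fset.
rewrite !(@free_actEw d) ?fsubsetUl //; first last.
- by rewrite fsubsetU // fsubsetUl orbT.
- by rewrite fsubsetU // fsubsetUr orbT.
rewrite scaler_sumr -big_split; apply: eq_bigr => m _ /=.
by rewrite mcoeffD mcoeffZ scalerDl scalerA.
Qed.

Lemma free_act_linear x : linear (free_act ^~ x).
Proof. by move=> c a b; rewrite free_actDZ. Qed.

Lemma free_act_word w x : free_act (word K w) x = wact w x.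
Proof.
rewrite (free_actEw _ msuppU_le) big_seq_fset1 mcoeffUU scale1r //.
Qed.

Lemma free_act_letter g x : free_act (letter K g) x = op g x.
Proof. by rewrite free_act_word. Qed.

Lemma free_act1 x : free_act 1 x = x.
Proof. by rewrite -word0 free_act_word. Qed.

Lemma free_act0 x : free_act 0 x = 0.
Proof. by rewrite (linear_zero (free_act_linear x)). Qed.

Lemma free_actD a b x : free_act (a + b) x = free_act a x + free_act b x.
Proof. by rewrite (linear_add (free_act_linear x)). Qed.

Lemma free_actB a b x : free_act (a - b) x = free_act a x - free_act b x.
Proof. by rewrite (linear_sub (free_act_linear x)). Qed.

Lemma free_actZ c a x : free_act (c *: a) x = c *: free_act a x.
Proof. by rewrite (linear_scale c (free_act_linear x)). Qed.

Lemma free_actM a b x : free_act (a * b) x = free_act a (free_act b x).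
Proof.
move: a b x; apply: (@word_actM K G F X (word K)) => //.
- exact: wordM.
- exact: word_scaleAr.
- exact: free_ind.
- exact: free_actL.
- exact: free_act_linear.
- by move=> s t x; rewrite !free_act_word /wact foldr_cat.
Qed.

Lemma free_act_letterM g a x :
  free_act (letter K g * a) x = op g (free_act a x).
Proof. exact: etrans (free_actM _ _ _) (free_act_letter _ _). Qed.

End FreeAction.

(** * Verma modules *)

Lemma free_scaleAr (K : fieldType) (G : choiceType) c (a b : free_alg K G) :
  a * (c *: b) = c *: (a * b).
Proof.
move: c a b; apply: (@word_scaleA K G _ (word K)).
- exact: word_scaleAr.
- exact: free_ind.
Qed.

Section LeftIdealQuotientTheory.
Variables (K : fieldType) (A : lalgType K) (S : A -> Prop).
Hypothesis scaleAr : forall (c : K) (a b : A), a * (c *: b) = c *: (a * b).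
Implicit Types (a b : A) (c : K) (x y : lquot S).

Lemma lquot_pi x : x = \pi_(lquot S) (repr x).
Proof. by rewrite reprK. Qed.

Lemma lquot_pi_scale c a :
  c *: (\pi_(lquot S) a : lquot S) = \pi_(lquot S) (c *: a).
Proof. exact: lquot_scaleE. Qed.

Lemma lquot_actL a : linear (lquot_act (S := S) a).
Proof.
move=> c x y; rewrite [x]lquot_pi [y]lquot_pi lquot_pi_scale lquot_addE.
by rewrite !lquot_actE lquot_pi_scale lquot_addE -scaleAr -mulrDr.
Qed.

Lemma lquot_act_linear x : linear (fun a => lquot_act a x).
Proof.
move=> c a b; rewrite [x]lquot_pi !lquot_actE mulrDl -scalerAl.
by rewrite -lquot_addE -lquot_pi_scale.
Qed.

Lemma lquot_actM a b x : lquot_act (a * b) x = lquot_act a (lquot_act b x).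
Proof. by rewrite [x]lquot_pi !lquot_actE mulrA. Qed.

Lemma lquot_act1 x : lquot_act 1 x = x.
Proof. by rewrite [x]lquot_pi lquot_actE mul1r. Qed.

Lemma lquot_pi_eq0 a : S a -> (\pi_(lquot S) a : lquot S) = 0.
Proof.
move=> Sa; rewrite -(scale0r (\pi_(lquot S) 0 : lquot S)) lquot_pi_scale scale0r.
apply/eqP; rewrite -Quotient.idealrBE subr0.
by apply/asboolP => P _; apply.
Qed.

Lemma lquot_act_pi1 a : lquot_act a (\pi_(lquot S) 1) = \pi_(lquot S) a.
Proof. by rewrite lquot_actE mulr1. Qed.

Lemma lquot_ind (X : lmodType K) (f : A -> X) :
  linear f -> (forall a, a \in left_ideal S -> f a = 0) ->
  exists2 g : lquot S -> X, linear g & forall a, g (\pi_(lquot S) a) = f a.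
Proof.
move=> fL fI; pose g x := f (repr x).
have gE a : g (\pi_(lquot S) a) = f a.
  apply/eqP; rewrite -subr_eq0 /g -(linear_sub fL) fI //.
  by rewrite Quotient.idealrBE reprK.
exists g => // c x y; rewrite [x]lquot_pi [y]lquot_pi lquot_pi_scale lquot_addE.
by rewrite !gE fL.
Qed.

Lemma lquot_ind_act (X : Type) (f : A -> X) (g : lquot S -> X) a h :
  (forall b, g (\pi_(lquot S) b) = f b) -> (forall b, f (a * b) = h (f b)) ->
  forall x, g (lquot_act a x) = h (g x).
Proof. by move=> gE fE x; rewrite [x]lquot_pi lquot_actE !gE fE. Qed.

End LeftIdealQuotientTheory.

Section Verma.
Variables (K : fieldType) (n : nat) (U : hopf_pres K n).
Local Notation G := (gen U).
Local Notation F := (free_alg K G).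
Local Notation weight := ('I_n.+1 -> K).
Implicit Types lam mu nu : weight.

Lemma vactL lam (a : F) : linear (vact (lam := lam) a).
Proof. exact: (lquot_actL (@free_scaleAr K G)). Qed.

Lemma vact_linear lam (x : verma U lam) : linear (fun a : F => vact a x).
Proof. exact: lquot_act_linear. Qed.

Lemma vactM lam (a b : F) (x : verma U lam) :
  vact (a * b) x = vact a (vact b x).
Proof. exact: lquot_actM. Qed.

Lemma vact1 lam (x : verma U lam) : vact 1 x = x.
Proof. exact: lquot_act1. Qed.

Lemma vact_hw lam (a : F) : vact a (hw U lam) = \pi_(verma U lam) a.
Proof. exact: lquot_act_pi1. Qed.

Lemma vact_repr lam (x : verma U lam) : x = vact (repr x) (hw U lam).
Proof. by rewrite vact_hw reprK. Qed.

Lemma vact_eq0 lam (a : F) : verma_rel lam a -> vact a (hw U lam) = 0.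
Proof. by move=> ha; rewrite vact_hw; apply: lquot_pi_eq0. Qed.

Definition vactD lam x a b := linear_add (@vact_linear lam x) a b.
Definition vactB lam x a b := linear_sub (@vact_linear lam x) a b.
Definition vactZ lam x c a := linear_scale c (@vact_linear lam x) a.

Lemma vact_word lam w (x : verma U lam) :
  vact (word K w) x = wact (fun g => vact (letter K g)) w x.
Proof.
elim: w => [|g w IH]; first by rewrite word0 vact1.
by rewrite word_cons vactM IH.
Qed.

Lemma vact_rel lam r (x : verma U lam) : Defs.rel r -> vact r x = 0.
Proof.
move=> hr; rewrite [x]vact_repr -vactM; apply: vact_eq0.
exact: verma_rel_alg.
Qed.

Lemma vact_raise_hw lam i : vact (letter K (raise U i)) (hw U lam) = 0.
Proof. by apply: vact_eq0; apply: verma_rel_raise. Qed.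

Lemma vact_cartan_hw lam i :
  vact (letter K (cartan U i)) (hw U lam) = chi U (lam i) *: hw U lam.
Proof.
apply/eqP; rewrite -subr_eq0 -{2}[hw U lam]vact1 -vactZ -vactB; apply/eqP.
by apply: vact_eq0; apply: verma_rel_cartan.
Qed.

Lemma verma_ind lam (P : verma U lam -> Prop) :
  P 0 -> (forall x y, P x -> P y -> P (x + y)) ->
  (forall c x, P x -> P (c *: x)) ->
  P (hw U lam) -> (forall g x, P x -> P (vact (letter K g) x)) ->
  forall x, P x.
Proof.
move=> P0 PD PZ Phw Pg x; rewrite [x]vact_repr; move: (repr x) => {x}.
elim/free_ind => [|a b ha hb|c w].
- by rewrite (linear_zero (vact_linear _)).
- by rewrite vactD; apply: PD.
rewrite vactZ vact_word; apply: PZ; elim: w => //= g w IH; exact: Pg.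
Qed.

Section Universal.
Variables (X Z : lmodType K) (op : G -> X -> X) (J : X -> Prop) (xi : X -> Z).
Hypothesis opL : forall g, linear (op g).
Hypothesis J0 : J 0.
Hypothesis JD : forall x y, J x -> J y -> J (x + y).
Hypothesis JZ : forall c x, J x -> J (c *: x).
Hypothesis Jop : forall g x, J x -> J (op g x).
Hypothesis xiL : linear xi.
Hypothesis xiJ : forall x, J x -> xi x = 0.
Hypothesis Jrel : forall r x, Defs.rel (h := U) r -> J (free_act op r x).
Variables (lam : weight) (u : X).
Hypothesis Jraise : forall i, J (op (raise U i) u).
Hypothesis Jcartan : forall i, J (op (cartan U i) u - chi U (lam i) *: u).

Lemma free_act_sub a x : J x -> J (free_act op a x).
Proof.
move=> hx; elim/free_ind: a => [|a b ha hb|c w].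
- by rewrite free_act0.
- by rewrite free_actD; apply: JD.
by rewrite free_actZ free_act_word; apply: JZ; elim: w => //= g w; apply: Jop.
Qed.

Lemma free_act_left_ideal a : a \in left_ideal (verma_rel (U := U) lam) ->
  J (free_act op a u).
Proof.
move=> /asboolP /(_ (fun a => J (free_act op a u))); apply.
  split=> [|x y hx hy|b x hx]; first by rewrite free_act0.
    by rewrite free_actD; apply: JD.
  by rewrite free_actM //; apply: free_act_sub.
move=> _ [r b hr|i|i].
- by rewrite free_actM //; apply: Jrel.
- by rewrite free_act_letter.
by rewrite free_actB free_actZ free_act1 free_act_letter.
Qed.

(** The universal property with target X / [J], without forming the quotient: the relations and the
    highest weight conditions hold modulo the stable subspace [J], and [xi] is a linear map that
    factors through X / [J]. It serves modules X that satisfy only part of the relations. *)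
Lemma verma_univ_mod : exists2 Phi : verma U lam -> Z, linear Phi &
  forall a, Phi (\pi_(verma U lam) a) = xi (free_act op a u).
Proof.
have [||Phi PhiL PhiE] := @lquot_ind K F (verma_rel lam) Z (fun a => xi (free_act op a u)).
- by move=> c a b; rewrite free_actDZ xiL.
- by move=> a ha; apply/xiJ/free_act_left_ideal.
by exists Phi.
Qed.

End Universal.

Lemma verma_univ (X : lmodType K) (op : G -> X -> X) lam (u : X) :
  (forall g, linear (op g)) ->
  (forall r x, Defs.rel (h := U) r -> free_act op r x = 0) ->
  (forall i, op (raise U i) u = 0) ->
  (forall i, op (cartan U i) u = chi U (lam i) *: u) ->
  exists Phi : verma U lam -> X,
    [/\ linear Phi, Phi (hw U lam) = u &
        forall g x, Phi (vact (letter K g) x) = op g (Phi x)].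
Proof.
move=> opL hrel hraise hcartan.
have [//|x y -> ->|c x ->|g x ->|//|//|r x hr|i|i|Phi PhiL PhiE] :=
  @verma_univ_mod X X op (fun x => x = 0) id opL _ _ _ _ _ _ _ lam u.
- by rewrite addr0.
- by rewrite scaler0.
- exact: linear_zero.
- exact: hrel.
- exact: hraise.
- by rewrite hcartan subrr.
exists Phi; split => // [|g]; first exact: etrans (PhiE 1) (free_act1 op u).
apply: lquot_ind_act PhiE _ => b; exact: free_act_letterM.
Qed.

End Verma.

(** * Lowering chains *)

Section Chain.
Variables (K : fieldType) (M : lmodType K) (L : nat).
Variables (E F : nat -> M -> M) (H : nat -> nat -> M -> M) (D : M -> Prop).
Variables (a b : nat -> K).

(** One summand lowers the result, the other the argument, so the expansion is an iterated
    commutator with deformed coefficients. The relations below are required only on [D], because [M]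
    will also be a space of functions in which they hold for linear functionals only. *)
Fixpoint chain (t : nat) (x : M) : M :=
  if t is s.+1 then a s *: F s (chain s x) + b s *: chain s (F s x) else x.

Hypothesis EL : forall t, linear (E t).
Hypothesis FL : forall t, linear (F t).
Hypothesis HL : forall t m, linear (H t m).
Hypothesis DF : forall t x, D x -> D (F t x).
Hypothesis DD : forall x y, D x -> D y -> D (x + y).
Hypothesis DZ : forall c x, D x -> D (c *: x).

Lemma chainL t : linear (chain t).
Proof.
elim: t => // t IH c x y /=.
by rewrite IH FL IH !FL !scalerDr !scalerA ![c * _]mulrC addrACA.
Qed.

Lemma chain_stable t x : D x -> D (chain t x).
Proof. by elim: t x => //= t IH x hx; apply: DD; apply: DZ; auto. Qed.

Lemma chain_comm (O : M -> M) t x : linear O ->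
  (forall s y, (s < t)%N -> D y -> O (F s y) = F s (O y)) -> D x ->
  O (chain t x) = chain t (O x).
Proof.
move=> OL; elim: t x => //= t IH x hO hx.
have hIH y : D y -> O (chain t y) = chain t (O y).
  by move=> hy; apply: IH => // s z hs; apply: hO; apply: ltnW.
rewrite (linear_add OL) !(linear_scale _ OL) hO //; last exact: chain_stable.
by rewrite !hIH ?hO //; apply: DF.
Qed.

(* [H t m] plays the role of [h_t + m], hence its shifts. *)
Hypothesis EF_neq : forall s t x, (s < L)%N -> (t < L)%N -> s != t -> D x ->
  E s (F t x) = F t (E s x).
Hypothesis EF_eq : forall t x, (t < L)%N -> D x ->
  E t (F t x) = F t (E t x) + H t 0 x.
Hypothesis FF : forall s t x, (s.+1 < t)%N -> (t < L)%N -> D x ->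
  F s (F t x) = F t (F s x).
Hypothesis HF_far : forall s t m x, (s < L)%N -> (t < L)%N ->
  (s.+1 < t)%N || (t.+1 < s)%N -> D x -> H t m (F s x) = F s (H t m x).
Hypothesis HF_near : forall s t m x, (s < L)%N -> (t < L)%N ->
  (s.+1 == t) || (t.+1 == s) -> D x -> H t m (F s x) = F s (H t m.+1 x).

(** Each monomial of [chain t.+1] contains [F t], the only neighbour of [H t.+1] among its factors,
    exactly once; hence the shift by one. *)
Lemma HF_chain t m x : (t.+1 < L)%N -> D x ->
  H t.+1 m (chain t.+1 x) = chain t.+1 (H t.+1 m.+1 x).
Proof.
move=> ht hx /=; rewrite (linear_add (HL _ _)) !(linear_scale _ (HL _ _)).
have hc k y : D y -> H t.+1 k (chain t y) = chain t (H t.+1 k y).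
  apply: chain_comm => // s z hs hz; apply: HF_far => //; lia.
rewrite hc; last exact: DF.
by rewrite !HF_near ?eqxx ?orbT ?hc //; try lia; apply: chain_stable.
Qed.

Variable beta : nat -> nat -> K.

(* [u] stands for the highest weight vector, possibly lowered by operators of
   index at least [t]; [d] counts the lowerings by [F t]. *)
Definition chain_top t d (u : M) : Prop :=
  [/\ D u, forall s, (s < t)%N -> E s u = 0,
      forall s m, (s.+1 < t)%N -> H s m u = beta s m *: u &
      forall s m, s.+1 = t -> H s m u = beta s (m + d) *: u].

Lemma chain_top_pred t d u : chain_top t.+1 d u -> chain_top t 0 u.
Proof.
move=> [Du Eu Hu _]; split=> // [s hs|s m hs|s m hs].
- by apply: Eu; apply: ltnW.
- by apply: Hu; lia.
by rewrite addn0; apply: Hu; lia.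
Qed.

Lemma chain_top_lower t d u : (t < L)%N -> chain_top t.+1 d u ->
  chain_top t 1 (F t u).
Proof.
move=> ht [Du Eu Hu _]; split=> [|s hs|s m hs|s m hs].
- exact: DF.
- rewrite EF_neq ?Eu ?(linear_zero (FL _)) //; lia.
- by rewrite HF_far ?Hu ?(linear_scale _ (FL _)) //; lia.
by rewrite HF_near ?Hu ?(linear_scale _ (FL _)) ?addn1 //; lia.
Qed.

(** The scalar c in E t (chain t.+1 u) = c chain t u. In the summand with [F t] outermost, [H t]
    still has to cross [chain t], which contains the neighbour [F t.-1] once: this is the [d.+1].
    For t = 0 there is nothing to cross. *)
Definition chain_const t d :=
  if t is 0%N then (a 0%N + b 0%N) * beta 0 d
  else a t * beta t d.+1 + b t * beta t d.

Lemma E_chain_last t d u : (t < L)%N -> chain_top t.+1 d u ->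
  E t (chain t.+1 u) = chain_const t d *: chain t u.
Proof.
move=> ht [Du Eu _ Hu] /=.
have hE y : D y -> E t (chain t y) = chain t (E t y).
  apply: chain_comm => // s z hs hz; apply: EF_neq => //; lia.
rewrite (linear_add (EL _)) !(linear_scale _ (EL _)) hE; last exact: DF.
rewrite !EF_eq //; last exact: chain_stable.
rewrite hE // Eu // !Hu // (linear_zero (FL _)) (linear_zero (chainL _)).
rewrite (linear_zero (FL _)) !add0r (linear_scale _ (chainL _)) add0n.
case: t {hE Eu} Hu ht => [|t] Hu ht; first by rewrite Hu // !scalerA -scalerDl -mulrDl.
rewrite HF_chain // Hu // (linear_scale _ (chainL _)) !scalerA -scalerDl.
by rewrite add1n.
Qed.

Hypothesis ab : forall t, (t.+1 < L)%N ->
  a t.+1 * chain_const t 0 + b t.+1 * chain_const t 1 = 0.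

(** [E s] crosses the outermost lowering operator, and induction applies to u and to the lowered u.
    Two terms survive only if that operator is [F s.+1]; since it commutes with [chain s], they are
    multiples of one vector, and [ab] says that their coefficients add up to 0. *)
Lemma E_chain_lt t d u s : (t <= L)%N -> chain_top t d u -> (s.+1 < t)%N ->
  E s (chain t u) = 0.
Proof.
elim: t d u s => // t IH d u s ht hu hs.
have h0 := chain_top_pred hu; have h1 := chain_top_lower ht hu.
have Du : D u by case: hu.
rewrite /= (linear_add (EL _)) !(linear_scale _ (EL _)).
rewrite EF_neq //; [|lia|lia|exact: chain_stable].
have [est|nst] := eqVneq s.+1 t; last first.
  rewrite (IH _ _ _ _ h0) ?(IH _ _ _ _ h1); try lia.
  by rewrite (linear_zero (FL _)) !scaler0 addr0.
rewrite -{}est in ht h0 h1 IH *.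
rewrite (E_chain_last _ h0) ?(E_chain_last _ h1); try lia.
rewrite -(@chain_comm (F s.+1)) // => [|r y hr hy]; last by rewrite -FF //; lia.
by rewrite (linear_scale _ (FL _)) !scalerA -scalerDl ab ?scale0r.
Qed.

Lemma E_chain sigma v : D v -> (forall s, (s < L)%N -> E s v = 0) ->
  (forall s m, (s < L)%N -> H s m v = beta s m *: v) ->
  (forall s, (s < L)%N -> chain_const s 0 = sigma) ->
  forall s t, (s < L)%N -> (t <= L)%N ->
    E s (chain t v) = ((s.+1 == t)%:R * sigma) *: chain t.-1 v.
Proof.
move=> Dv Ev Hv hsig s t hs ht.
have top r : (r <= L)%N -> chain_top r 0 v.
  move=> hr; split=> // [q hq|q m hq|q m hq].
  - by apply: Ev; lia.
  - by apply: Hv; lia.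
  by rewrite addn0; apply: Hv; lia.
case: (ltngtP s.+1 t) => [lt|gt|<-] /=; rewrite ?mul0r ?scale0r ?mul1r.
- by apply: E_chain_lt lt => //; apply: top.
- rewrite (@chain_comm (E s)) // => [|r y hr hy]; last by apply: EF_neq => //; lia.
  by rewrite Ev // (linear_zero (chainL _)).
by rewrite (E_chain_last (d := 0)) ?hsig //; apply: top.
Qed.

End Chain.

Section ChainConstants.
Variables (K : fieldType) (sigma : K) (g : nat -> nat -> K).

(* With [g t m = [H_t + m]], these make [E t] map [chain t.+1 u] to
   [sigma *: chain t u]. *)
Definition coefa t := if t is s.+1 then sigma * g s 1 / g t 0 else 0.
Definition coefb t :=
  if t is s.+1 then - (sigma * g s 0 / g t 0) else sigma / g 0 0.

Variables (L : nat) (beta : nat -> nat -> K).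
Hypothesis g_neq0 : forall t, (t < L)%N -> g t 0 != 0.
Hypothesis beta0 : forall m, (0 < L)%N -> beta 0 m = g 0 m.
Hypothesis betaS : forall t m, (t.+1 < L)%N ->
  beta t.+1 m.+1 * g t 1 - beta t.+1 m * g t 0 = g t.+1 m.

(** [betaS] is an instance of [x+1][y+1] - [x][y] = [x+y+1] and merges the two summands of
    [chain_const] into one. *)
Lemma chain_constE t d : (t < L)%N ->
  chain_const coefa coefb beta t d = sigma * g t d / g t 0.
Proof.
case: t => [|t] ht /=; first by rewrite add0r beta0 // mulrAC.
by rewrite -(betaS d ht) mulrBr mulrBl; ring.
Qed.

Lemma coefab t : (t.+1 < L)%N ->
  coefa t.+1 * chain_const coefa coefb beta t 0 +
  coefb t.+1 * chain_const coefa coefb beta t 1 = 0.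
Proof.
move=> ht; rewrite !chain_constE //; try lia.
have h0 : g t 0 != 0 by apply: g_neq0; lia.
rewrite /=; field; rewrite ?h0 ?g_neq0 //.
Qed.

(** A telescoping product: the numerator of each factor is the denominator of the preceding one. The
    denominator that remains is that of an off-diagonal entry of J. *)
Lemma prod_coefb t : (t < L)%N ->
  \prod_(s < t.+1) coefb s = (-1) ^+ t * sigma ^+ t.+1 / g t 0.
Proof.
elim: t => [|t IH] ht; first by rewrite big_ord1 /= mul1r.
have h0 : g t 0 != 0 by apply: g_neq0; lia.
rewrite big_ord_recr /= IH; last lia.
rewrite !exprS; field; rewrite ?h0 ?g_neq0 //.
Qed.

End ChainConstants.

(** * Fusion matrices in type A *)

Section TypeA.
Variables (K : fieldType) (n : nat) (U : hopf_pres K n) (V : rep U n.+1).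
Local Notation G := (gen U).
Local Notation F := (free_alg K G).
Local Notation weight := ('I_n.+1 -> K).
Implicit Types lam mu nu : weight.

Definition eact nu (i : 'I_n) : verma U nu -> verma U nu :=
  vact (letter K (raise U i)).
Definition cact nu (i : 'I_n.+1) : verma U nu -> verma U nu :=
  vact (letter K (cartan U i)).

(* What the quantum and the classical cases have in common: [fgen i] is the
   generator f_i, [hop i m] stands for [h_i + m] (q-number or number),
   [br nu a b m] for [nu_a - nu_b + m], [kin i] for the factor K_i^-1 of the
   coproduct of f_i and [tau nu a b] for q^(nu_b - nu_a). *)
Record typeA := TypeA {
  fgen : 'I_n -> G;
  hop : 'I_n -> nat -> F;
  kin : 'I_n -> F;
  wv : bool -> K;
  kape : 'I_n -> 'I_n.+1 -> K;
  kap : K;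
  br : weight -> 'I_n.+1 -> 'I_n.+1 -> nat -> K;
  tau : weight -> 'I_n.+1 -> 'I_n.+1 -> K;
  fact nu i : verma U nu -> verma U nu := vact (letter K (fgen i));
  hact nu i m : verma U nu -> verma U nu := vact (hop i m);
  ef_comm nu i j (x : verma U nu) :
    eact i (fact j x) = fact j (eact i x) + (i == j)%:R *: hact i 0 x;
  ee_far nu (i j : 'I_n) (x : verma U nu) : (i.+1 < j)%N ->
    eact i (eact j x) = eact j (eact i x);
  ff_far nu (i j : 'I_n) (x : verma U nu) : (i.+1 < j)%N ->
    fact i (fact j x) = fact j (fact i x);
  hf_far nu (i j : 'I_n) m (x : verma U nu) : (i.+1 < j)%N || (j.+1 < i)%N ->
    hact i m (fact j x) = fact j (hact i m x);
  hf_near nu (i j : 'I_n) m (x : verma U nu) : (i.+1 == j) || (j.+1 == i) ->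
    hact i m (fact j x) = fact j (hact i m.+1 x);
  he_far nu (i j : 'I_n) m (x : verma U nu) : (i.+1 < j)%N || (j.+1 < i)%N ->
    hact i m (eact j x) = eact j (hact i m x);
  he_near nu (i j : 'I_n) m (x : verma U nu) : (i.+1 == j) || (j.+1 == i) ->
    hact i m.+1 (eact j x) = eact j (hact i m x);
  hop_hw nu i m : hact i m (hw U nu) = br nu (lo i) (up i) m *: hw U nu;
  hw_coord nu : exists phi : verma U nu -> K,
    [/\ linear (phi : verma U nu -> K^o), phi (hw U nu) = 1, forall i x, phi (fact i x) = 0,
        forall i x, phi (cact i x) = chi U (nu i) * phi x &
        (forall i m x, phi (hact i m x) = br nu (lo i) (up i) m * phi x) /\
        (forall i x, phi (vact (kin i) x) = tau nu (lo i) (up i) * phi x)];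
  fact_ind nu (P : verma U nu -> Prop) :
    P 0 -> (forall x y, P x -> P y -> P (x + y)) ->
    (forall c x, P x -> P (c *: x)) -> P (hw U nu) ->
    (forall i x, P x -> P (fact i x)) -> forall x, P x;
  fact_weight nu mu j (x : verma U nu) : verma_weight mu x ->
    verma_weight (fun i => mu i - simple_root K j i) (fact j x);
  chi_inj a k : (0 < k)%N -> chi U (a - k%:R) != chi U a;
  chi_bool (b : bool) : chi U b%:R = wv b;
  wv_neq : wv true != wv false;
  V_cartan i : V (cartan U i) = diag_mx (\row_j wv (i == j));
  kape_lo i : kape i (lo i) = kap;
  kape_neq0 i b : kape i b != 0;
  kap_neq0 : kap != 0;
  tens_e nu i (x : {ffun 'I_n.+1 -> verma U nu}) b :
    verma_tens_act V (raise U i) x b =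
    kape i b *: eact i (x b) + (b == lo i)%:R *: x (up i);
  tens_f nu i (x : {ffun 'I_n.+1 -> verma U nu}) b :
    verma_tens_act V (fgen i) x b =
    fact i (x b) + (b == up i)%:R *: vact (kin i) (x (lo i));
  tens_cartan nu i (x : {ffun 'I_n.+1 -> verma U nu}) b a :
    cact i (x b) = chi U (a - (i == b)%:R) *: x b ->
    verma_tens_act V (cartan U i) x b = chi U a *: x b;
  tens_rel nu r (x : {ffun 'I_n.+1 -> verma U nu}) : Defs.rel r ->
    free_act (verma_tens_act V (nu := nu)) r x = 0;
  comp_act lam nu1 nu2 Phi1 Phi2 :
    linear (Phi1 : verma U lam -> {ffun 'I_n.+1 -> verma U nu1}) ->
    linear (Phi2 : verma U nu1 -> {ffun 'I_n.+1 -> verma U nu2}) ->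
    (forall g x, Phi1 (vact (letter K g) x) = verma_tens_act V g (Phi1 x)) ->
    (forall g x, Phi2 (vact (letter K g) x) = verma_tens_act V g (Phi2 x)) ->
    forall g x, Phi_comp Phi2 Phi1 (vact (letter K g) x) =
      verma_tens_act (rep_tens V V) g (Phi_comp Phi2 Phi1 x);
  br_mul nu a b c m p :
    br nu a b m.+1 * br nu b c p.+1 - br nu a b m * br nu b c p =
    br nu a c (m + p).+1;
  tau_mul nu a b c : tau nu a b * tau nu b c = tau nu a c;
  tau_id nu a : tau nu a a = 1
}.

Arguments fact_ind T {nu} P : rename.

Variable T : typeA.
Local Notation f := (fact T).
Local Notation h := (hact T).

Lemma simple_root_lo (i : 'I_n) : simple_root K i (lo i) = 1.
Proof.
rewrite /simple_root eqxx /lo /up -val_eqE /= /bump /=.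
by rewrite add1n ltn_eqF ?subr0 //.
Qed.

Lemma eactL nu i : linear (@eact nu i). Proof. exact: vactL. Qed.
Lemma factL nu i : linear (f (nu := nu) i). Proof. exact: vactL. Qed.
Lemma hactL nu i m : linear (h (nu := nu) i m). Proof. exact: vactL. Qed.
Lemma cactL nu i : linear (@cact nu i). Proof. exact: vactL. Qed.

Section LowerPart.
Variables (nu : weight) (phi : verma U nu -> K).
Hypothesis phiL : linear (phi : verma U nu -> K^o).
Hypothesis phi_hw : phi (hw U nu) = 1.
Hypothesis phi_f : forall i x, phi (f i x) = 0.
Hypothesis phi_cartan : forall i x, phi (cact i x) = chi U (nu i) * phi x.

Lemma functional_scale c x : phi (c *: x) = c * phi x.
Proof. exact: (linear_scale c phiL x). Qed.

(** Take the least i with [m i] nonzero and the coordinate [lo i]: the root i contributes [m i], a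
    larger root nothing, and root i - 1 has multiplicity 0. *)
Lemma sum_simple_root_neq0 (m : 'I_n -> nat) : (exists i, m i != 0%N) ->
  exists i k, (0 < k)%N /\ \sum_j simple_root K j i *+ m j = k%:R.
Proof.
case=> i0 hi0; have [i mi imin] := @arg_minnP _ i0 (fun i => m i != 0%N) val hi0.
exists (lo i), (m i); split; first by rewrite lt0n.
rewrite (bigD1 i) //= simple_root_lo big1 ?addr0 // => j ji.
have [->|mj] := eqVneq (m j) 0%N; first by rewrite mulr0n.
have := imin _ mj => /= hij.
rewrite /simple_root -!val_eqE /= /bump /= add1n.
have ij : (i < j)%N by rewrite ltn_neqAle hij andbT -val_eqE eq_sym in ji *.
by rewrite !ltn_eqF ?subrr ?mul0rn // ltnW.
Qed.

(** A summand of weight nu - sum m_i alpha_i differs from nu by a positive integer k in some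
    coordinate. Since [phi] sees the weight nu there and chi (a - k) differs from chi a, it vanishes
    on that summand. *)
Lemma phi_lower x : lower x -> phi x = 0.
Proof.
case=> s -> hs; rewrite (lin_sum phiL) big_seq big1 // => y /hs [m hm hy].
have [i [k [k0 hk]]] := sum_simple_root_neq0 hm.
have := congr1 phi (hy i); rewrite hk functional_scale phi_cartan => /eqP.
rewrite -subr_eq0 -mulrBl mulf_eq0 => /orP [|/eqP //].
by rewrite subr_eq0 eq_sym (negbTE (chi_inj T _ k0)).
Qed.

Lemma lower0 : lower (0 : verma U nu).
Proof. by exists [::]; rewrite ?big_nil. Qed.

Lemma lowerD (x y : verma U nu) : lower x -> lower y -> lower (x + y).
Proof.
case=> s -> hs [t -> ht]; exists (s ++ t); first by rewrite big_cat.
by move=> z; rewrite mem_cat => /orP [/hs|/ht].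
Qed.

Lemma lowerZ c (x : verma U nu) : lower x -> lower (c *: x).
Proof.
case=> s -> hs; exists [seq c *: y | y <- s].
  by rewrite big_map scaler_sumr.
move=> z /mapP [y ys].
have [m hm hy] := hs y ys.
move=> ->.
exists m; first exact: hm.
move=> i; apply: etrans (linear_scale _ (vactL _) _) _.
by apply: etrans (congr1 _ (hy i)) _; rewrite !scalerA mulrC.
Qed.

Definition fword (w : seq 'I_n) : verma U nu := foldr (f (nu := nu)) (hw U nu) w.

Lemma fword_weight w :
  verma_weight (fun j => nu j - \sum_i simple_root K i j *+ count_mem i w)
    (fword w).
Proof.
elim: w => [|i w IH] j /=.
  by rewrite big1 ?subr0 ?vact_cartan_hw // => i _; rewrite mulr0n.
apply: etrans (fact_weight T i IH j) (congr1 (fun c => chi U c *: _) _).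
rewrite -addrA -opprD; congr (_ - _).
under [RHS]eq_bigr => i' _ do rewrite mulrnDr.
rewrite big_split /= addrC; congr (_ + _).
rewrite (bigD1 i) //= eqxx big1 ?addr0 // => i' hi'.
by rewrite eq_sym (negbTE hi').
Qed.

Lemma fword_lower i w : lower (fword (i :: w)).
Proof.
exists [:: fword (i :: w)]; first by rewrite big_seq1.
move=> y; rewrite inE => /eqP ->; exists (fun j => count_mem j (i :: w)).
  by exists i; rewrite /= eqxx.
exact: fword_weight.
Qed.

(** The words in the f_i applied to the highest weight vector span. The empty word gives that
    vector; every other one gives a vector of lower weight, on which [phi] is 0. *)
Lemma sub_phi_lower (x : verma U nu) : lower (x - phi x *: hw U nu).
Proof.
pose P (y : verma U nu) :=
  exists s : seq (K * seq 'I_n), y = \sum_(c <- s) c.1 *: fword c.2.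
have: P x.
  move: x; apply: (fact_ind T P); rewrite /P.
  - by exists [::]; rewrite big_nil.
  - by move=> x y [s ->] [t ->]; exists (s ++ t); rewrite big_cat.
  - move=> c x [s ->]; exists [seq (c * d.1, d.2) | d <- s].
    by rewrite big_map scaler_sumr; apply: eq_bigr => d _; rewrite scalerA.
  - by exists [:: (1, [::])]; rewrite big_seq1 scale1r.
  - move=> i x [s ->]; exists [seq (d.1, i :: d.2) | d <- s].
    rewrite big_map (lin_sum (factL i)); apply: eq_bigr => d _.
    by rewrite (linear_scale _ (factL i)).
case=> s ->; rewrite (lin_sum phiL) scaler_suml -sumrB.
elim/big_ind: _ => [||[c w] _] /=; [exact: lower0|exact: lowerD|].
rewrite functional_scale; case: w => [|i w].
  by rewrite /= phi_hw mulr1 subrr; exact: lower0.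
rewrite /= phi_f mulr0 scale0r subr0.
by apply: lowerZ; apply: fword_lower.
Qed.

(** The bridge between the definition of an intertwiner by its leading term and scalar computations:
    every leading coefficient below is found or checked through it. *)
Lemma lower_sub_hw (x : verma U nu) c : lower (x - c *: hw U nu) <-> phi x = c.
Proof.
split=> [hl|<-]; last exact: sub_phi_lower.
apply/eqP; rewrite -subr_eq0; apply/eqP.
have := phi_lower hl; by rewrite (linear_sub phiL) functional_scale phi_hw mulr1.
Qed.

End LowerPart.
End TypeA.

Section ExtendedIndex.
Variables (K : fieldType) (n : nat) (M : lmodType K).

(** Chains are indexed by natural numbers; outside the range of simple roots the operator is taken
    to be 0. *)
Definition extop (op : 'I_n -> M -> M) (i : nat) (x : M) : M :=
  if insub i is Some j then op j x else 0.

Lemma extopE op (i : 'I_n) x : extop op i x = op i x.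
Proof. by rewrite /extop valK. Qed.

Lemma extopL op i : (forall j, linear (op j)) -> linear (extop op i).
Proof.
move=> opL; rewrite /extop; case: insubP => [j _ _|_] c x y; first exact: opL.
by rewrite scaler0 addr0.
Qed.

End ExtendedIndex.

Lemma ord_ex n m : (m < n)%N -> exists i : 'I_n, m = i.
Proof. by move=> h; exists (Ordinal h). Qed.

Lemma inord_lo n (i : 'I_n) : inord i = lo i.
Proof. by apply/val_inj; rewrite /= inordK // ltnW // ltnS. Qed.

Lemma inord_up n (i : 'I_n) : inord i.+1 = up i.
Proof. by apply/val_inj; rewrite /= inordK // ltnS. Qed.

(** * Vectors obtained from the highest weight vector by a lowering chain *)

Section LoweringChain.
Variables (K : fieldType) (n : nat) (M : lmodType K).
Variables (e f : 'I_n -> M -> M) (h : 'I_n -> nat -> M -> M) (v : M).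
Variables (br : 'I_n.+1 -> 'I_n.+1 -> nat -> K) (sigma : K) (j : 'I_n.+1).
Hypothesis eL : forall i, linear (e i).
Hypothesis fL : forall i, linear (f i).
Hypothesis hL : forall i m, linear (h i m).
Hypothesis ef_comm : forall i k x,
  e i (f k x) = f k (e i x) + (i == k)%:R *: h i 0 x.
Hypothesis ff_far : forall (i k : 'I_n) x, (i.+1 < k)%N ->
  f i (f k x) = f k (f i x).
Hypothesis hf_far : forall (i k : 'I_n) m x, (i.+1 < k)%N || (k.+1 < i)%N ->
  h i m (f k x) = f k (h i m x).
Hypothesis hf_near : forall (i k : 'I_n) m x, (i.+1 == k) || (k.+1 == i) ->
  h i m (f k x) = f k (h i m.+1 x).
Hypothesis e_v : forall i, e i v = 0.
Hypothesis h_v : forall i m, h i m v = br (lo i) (up i) m *: v.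
Hypothesis br_mul : forall a b c m p,
  br a b m.+1 * br b c p.+1 - br a b m * br b c p = br a c (m + p).+1.
Hypothesis br_neq0 : forall (a : 'I_n.+1) m, (a < j)%N -> br a j m != 0.

(** Index t of the chain stands for the simple root i = j - 1 - t, so that the chain starts with
    f_(j-1) and descends. In these terms [beta t m] is [nu_i - nu_(i+1) + m] and [g t m] is
    [nu_i - nu_j + t + m]. *)
Let E t : M -> M := extop e (j.-1 - t).
Let F t : M -> M := extop f (j.-1 - t).
Let H t m : M -> M := extop (h^~ m) (j.-1 - t).
Let beta t m := br (inord (j.-1 - t)) (inord (j - t)) m.
Let g t m := br (inord (j.-1 - t)) j (t + m).

Let jn : (j <= n)%N. Proof. by rewrite -ltnS. Qed.

Let EL t : linear (E t).
Proof. exact: extopL. Qed.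
Let FL t : linear (F t).
Proof. exact: extopL. Qed.
Let HL t m : linear (H t m).
Proof. exact: extopL. Qed.

Let idx t : (t < j)%N -> exists i : 'I_n, (j.-1 - t)%N = i.
Proof. by move=> tj; apply: ord_ex; lia. Qed.

Definition lowered t : M := chain F (coefa sigma g) (coefb sigma g) t v.

Let g_neq0 t : (t < j)%N -> g t 0 != 0.
Proof. by move=> tj; apply: br_neq0; rewrite inordK; lia. Qed.

Let beta0 m : (0 < j)%N -> beta 0 m = g 0 m.
Proof. by move=> j0; rewrite /beta /g add0n !subn0 inord_val. Qed.

Let betaS t m : (t.+1 < j)%N ->
  beta t.+1 m.+1 * g t 1 - beta t.+1 m * g t 0 = g t.+1 m.
Proof.
move=> tj; rewrite /beta /g addn1 addn0.
have -> : (j.-1 - t)%N = (j - t.+1)%N by lia.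
by rewrite br_mul addnC.
Qed.

Let E_hw t : (t < j)%N -> E t v = 0.
Proof. by move=> /idx [i it]; rewrite /E it extopE. Qed.

Let H_hw t m : (t < j)%N -> H t m v = beta t m *: v.
Proof.
move=> tj; have [i it] := idx tj; rewrite /H /beta it extopE h_v.
have -> : (j - t)%N = i.+1 by lia.
by rewrite inord_lo inord_up.
Qed.

Let E_lowered s t : (s < j)%N -> (t <= j)%N ->
  E s (lowered t) = ((s.+1 == t)%:R * sigma) *: lowered t.-1.
Proof.
move=> sj tj; rewrite /lowered; apply: (@E_chain K M j E F H (fun=> True) _ _ EL FL HL _ _ _ _ _ _ _ _ beta) => //.
- move=> a b x aj bj ab _; have [i ia] := idx aj; have [k kb] := idx bj.
  rewrite /E /F ia kb !extopE ef_comm; case: eqP => [ik|_].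
    by rewrite ik -kb in ia; lia.
  by rewrite scale0r addr0.
- move=> a x aj _; have [i ia] := idx aj.
  by rewrite /E /F /H ia !extopE ef_comm eqxx scale1r.
- move=> a b x ab bj _; have [|i ia] := @idx a; first lia.
  have [k kb] := idx bj; rewrite /F ia kb !extopE [RHS]ff_far //; lia.
- move=> a b m x aj bj ab _; have [i ia] := idx aj; have [k kb] := idx bj.
  rewrite /H /F ia kb !extopE hf_far //; lia.
- move=> a b m x aj bj ab _; have [i ia] := idx aj; have [k kb] := idx bj.
  rewrite /H /F ia kb !extopE hf_near //; lia.
- by move=> a aj; apply: (coefab _ g_neq0 beta0 betaS).
- move=> a aj; rewrite (chain_constE _ beta0 betaS) // mulfK //.
  exact: g_neq0.
Qed.

(** For i < j this is [E_chain] read in the original indices. For i >= j, e_i commutes with every f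
    in the chain and kills [v]. *)
Lemma e_lowered (i : 'I_n) t : (t <= j)%N ->
  e i (lowered t) = ((((0 < t) && (i + t == j))%N)%:R * sigma) *: lowered t.-1.
Proof.
move=> tj; have [ij|ji] := ltnP i j.
  have <- : E (j.-1 - i) (lowered t) = e i (lowered t).
    rewrite /E; have -> : (j.-1 - (j.-1 - i))%N = i by lia.
    exact: extopE.
  rewrite E_lowered //; last lia.
  by congr ((_%:R * _) *: _); lia.
rewrite /lowered (@chain_comm K M F (fun=> True)) // => [|s x st _].
  rewrite e_v (linear_zero (chainL _ _ FL _)).
  have -> : ((0 < t) && (i + t == j))%N = false by lia.
  by rewrite mul0r scale0r.
have [|k ks] := @idx s; first lia.
rewrite /F ks !extopE ef_comm; case: eqP => [ik|_].
  by rewrite -ik in ks; lia.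
by rewrite scale0r addr0.
Qed.

(** For t > 0 every monomial of the chain has some f_i as its outermost factor. *)
Lemma lowered_functional (phi : M -> K^o) t : linear phi ->
  (forall i x, phi (f i x) = 0) -> (0 < t <= j)%N -> phi (lowered t) = 0.
Proof.
move=> phiL phif /andP [t0 tj].
have phiF s x : (s < j)%N -> phi (F s x) = 0.
  by move=> /idx [i is_]; rewrite /F is_ extopE.
rewrite /lowered; case: t t0 tj => //= t _.
elim: t v => [|t IH] x tj /=; rewrite (linear_add phiL) !(linear_scale _ phiL).
  by rewrite phiF // !scaler0 addr0.
rewrite phiF // scaler0 add0r; have := IH (F t.+1 x) (ltnW tj).
by rewrite /= => ->; rewrite scaler0.
Qed.

Lemma lowered_weight (wt : ('I_n.+1 -> K) -> M -> Prop) mu t :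
  (forall mu x y, wt mu x -> wt mu y -> wt mu (x + y)) ->
  (forall mu c x, wt mu x -> wt mu (c *: x)) ->
  (forall mu i x, wt mu x -> wt (fun a => mu a - simple_root K i a) (f i x)) ->
  wt mu v -> (t <= j)%N ->
  wt (fun a => mu a + (a == j)%:R - (a == inord (j - t))%:R) (lowered t).
Proof.
move=> wtD wtZ wtf; rewrite /lowered; elim: t mu v => [|t IH] mu x hx tj /=.
  rewrite subn0 inord_val; have -> // : (fun a => mu a + (a == j)%:R - (a == j)%:R) = mu.
  by apply/funext => a; rewrite addrK.
have [i it] := idx tj.
have -> : (fun a => mu a + (a == j)%:R - (a == inord (j - t.+1))%:R) =
   fun a => mu a + (a == j)%:R - (a == inord (j - t))%:R - simple_root K i a.
  apply/funext => a; rewrite /simple_root -inord_lo -inord_up.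
  have -> : (j - t)%N = i.+1 by lia.
  have -> : (j - t.+1)%N = i by lia.
  ring.
apply: wtD; apply: wtZ; rewrite /F it.
  have -> : extop f i = f i by apply/funext => z; exact: extopE.
  by apply: (wtf (fun a => _)); apply: IH => //; apply: ltnW.
have -> : extop f i = f i by apply/funext => z; exact: extopE.
have := IH (fun a => mu a - simple_root K i a) (f i x) (wtf _ _ _ hx) (ltnW tj).
rewrite -/F; set u := chain _ _ _ _ _; set m1 := fun a => _; set m2 := fun a => _.
have -> // : m1 = m2.
by apply/funext => a; rewrite /m1 /m2; ring.
Qed.

End LoweringChain.

(** * Operators on the tensor product of a module with a coordinate space *)

Section OpTens.
Variables (K : fieldType) (M : lmodType K) (m : nat).
Implicit Types (f g : M -> M) (B C : 'M[K]_m) (x y : {ffun 'I_m -> M}).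

Lemma op_tensE f B x i : op_tens f B x i = \sum_j B i j *: f (x j).
Proof. by rewrite ffunE. Qed.

Lemma op_tensL f B : linear f -> linear (op_tens f B).
Proof.
move=> fL c x y; apply/ffunP => i; rewrite !ffunE scaler_sumr -big_split.
apply: eq_bigr => j _ /=; rewrite !ffunE fL scalerDr !scalerA.
by rewrite [B i j * c]mulrC.
Qed.

Lemma op_tens_comp f g B C x : linear f ->
  op_tens f B (op_tens g C x) = op_tens (f \o g) (B *m C) x.
Proof.
move=> fL; apply/ffunP => i; rewrite !op_tensE.
under eq_bigr => j _ do rewrite op_tensE (lin_sum fL) scaler_sumr.
rewrite exchange_big; apply: eq_bigr => j _ /=.
rewrite mxE scaler_suml; apply: eq_bigr => k _.
by rewrite (linear_scale _ fL) scalerA.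
Qed.

Lemma op_tens_mulZ f B c x : op_tens f (c *: B) x = c *: op_tens f B x.
Proof.
apply/ffunP => i; rewrite !ffunE scaler_sumr.
by apply: eq_bigr => j _; rewrite mxE scalerA.
Qed.

Lemma op_tens_mulD f B C x :
  op_tens f (B + C) x = op_tens f B x + op_tens f C x.
Proof.
apply/ffunP => i; rewrite !ffunE -big_split.
by apply: eq_bigr => j _; rewrite mxE scalerDl.
Qed.

Lemma op_tens0 f x : op_tens f 0 x = 0.
Proof.
by apply/ffunP => i; rewrite !ffunE big1 // => j _; rewrite mxE scale0r.
Qed.

Lemma op_tens_opD f g h B x : (forall z, h z = f z + g z) ->
  op_tens h B x = op_tens f B x + op_tens g B x.
Proof.
move=> hE; apply/ffunP => i; rewrite !ffunE -big_split.
by apply: eq_bigr => j _; rewrite hE scalerDr.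
Qed.

Lemma op_tens_opZ f h c B x : (forall z, h z = c *: f z) ->
  op_tens h B x = c *: op_tens f B x.
Proof.
move=> hE; apply/ffunP => i; rewrite !ffunE scaler_sumr.
by apply: eq_bigr => j _; rewrite hE !scalerA mulrC.
Qed.

Lemma op_tens_op0 f B x : (forall z, f z = 0) -> op_tens f B x = 0.
Proof.
by move=> f0; apply/ffunP => i; rewrite !ffunE big1 // => j _; rewrite f0 scaler0.
Qed.

Lemma eq_op_tens f g B C x : f =1 g -> B = C -> op_tens f B x = op_tens g C x.
Proof.
move=> fg ->; apply/ffunP => i; rewrite !ffunE.
by apply: eq_bigr => j _; rewrite fg.
Qed.

Lemma op_tens1 f x i : op_tens f 1%:M x i = f (x i).
Proof.
rewrite op_tensE (bigD1 i) //= mxE eqxx scale1r big1 ?addr0 // => j ji.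
by rewrite mxE eq_sym (negbTE ji) scale0r.
Qed.

Lemma op_tens_diag f d x i : op_tens f (diag_mx d) x i = d 0 i *: f (x i).
Proof.
rewrite op_tensE (bigD1 i) //= mxE eqxx mulr1n big1 ?addr0 // => j ji.
by rewrite mxE eq_sym (negbTE ji) mulr0n scale0r.
Qed.

Lemma op_tens_delta f a b x i :
  op_tens f (delta_mx a b) x i = (i == a)%:R *: f (x b).
Proof.
rewrite op_tensE (bigD1 b) //= mxE eqxx andbT big1 ?addr0 // => j jb.
by rewrite mxE (negbTE jb) andbF scale0r.
Qed.

End OpTens.

Section Existence.
Variables (K : fieldType) (n : nat) (U : hopf_pres K n).
Local Notation weight := ('I_n.+1 -> K).
Local Notation G := (gen U).

Lemma verma_tens_actL m (W : rep U m) (nu : weight) (g : G) :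
  linear (verma_tens_act W (nu := nu) g).
Proof.
move=> c x y; rewrite /verma_tens_act scaler_sumr -big_split /=.
by apply: eq_bigr => -[w1 w2] _; apply: op_tensL; apply: vactL.
Qed.

Variables (V : rep U n.+1) (T : typeA V).

Lemma singular_vector (nu : weight) (j : 'I_n.+1) :
  (forall (a : 'I_n.+1) m, (a < j)%N -> br T nu a j m != 0) ->
  exists u : {ffun 'I_n.+1 -> verma U nu},
  [/\ forall i, verma_tens_act V (raise U i) u = 0,
      forall i, verma_tens_act V (cartan U i) u =
        chi U (nu i + (i == j)%:R) *: u,
      u j = hw U nu &
      forall (phi : verma U nu -> K^o) b, linear phi ->
        (forall i x, phi (fact T i x) = 0) -> b != j -> phi (u b) = 0].
Proof.
move=> hbr.
(* With sigma = - 1 / [kap], the coordinate at [lo i] of the equation e_i u = 0, namely kap e_i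
   (u_i) + u_(i+1) = 0, holds. *)
pose y := lowered (fact T (nu := nu)) (hw U nu) (br T nu) (- (kap T)^-1) j.
have ey (i : 'I_n) t : (t <= j)%N ->
    eact i (y t) = (((0 < t) && (i + t == j))%N%:R * - (kap T)^-1) *: y t.-1.
  by apply: (@e_lowered _ _ _ _ _ (fun i m => hact T i m));
    [exact: eactL|exact: factL|move=> *; exact: hactL|exact: ef_comm
    |exact: ff_far|exact: hf_far|exact: hf_near|exact: vact_raise_hw|exact: hop_hw
    |exact: br_mul|exact: hbr].
have wy t : (t <= j)%N -> verma_weight
    (fun a => nu a + (a == j)%:R - (a == inord (j - t))%:R) (y t).
  apply: lowered_weight.
  - move=> mu x z hx hz i.
    by rewrite (linear_add (vactL _)) hx hz scalerDr.
  - move=> mu c x hx i.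
    by rewrite (linear_scale _ (vactL _)) hx !scalerA mulrC.
  - by move=> mu i x; apply: fact_weight.
  - by move=> i; apply: vact_cartan_hw.
have fy (phi : verma U nu -> K^o) t : linear phi ->
    (forall i x, phi (fact T i x) = 0) -> (0 < t <= j)%N -> phi (y t) = 0.
  exact: lowered_functional.
have y0 : y 0%N = hw U nu by [].
clearbody y.
(* The coordinate at b is reached after j - b lowerings; above j the vector has no component. *)
exists [ffun b : 'I_n.+1 => if (b <= j)%N then y (j - b)%N else 0]; split.
- move=> i; apply/ffunP => b; rewrite (tens_e T) !ffunE.
  have [bj|jb] := leqP b j; last first.
    rewrite (linear_zero (eactL _)) scaler0 add0r; case: eqP => [bi|_].
      rewrite ifN ?scaler0 //; move: jb; rewrite bi /= /bump /=; lia.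
    by rewrite scale0r.
  rewrite ey ?leq_subr // scalerA.
  have [->|bi] := eqVneq b (lo i); last first.
    rewrite scale0r addr0 [((0 < _) && _)%N](_ : _ = false) ?mul0r ?mulr0 ?scale0r //.
    by move/eqP: bi bj => bi bj; apply/negP => hb; apply: bi; apply/val_inj; rewrite /=; lia.
  rewrite kape_lo scale1r /= /bump /= add1n.
  have [ij|ji] := ltnP i j; last first.
    by rewrite [((0 < _) && _)%N](_ : _ = false) ?mul0r ?mulr0 ?scale0r ?addr0 //; lia.
  rewrite [((0 < _) && _)%N](_ : _ = true) ?mul1r; last lia.
  rewrite mulrN mulfV ?kap_neq0 // scaleN1r subnS.
  exact: addNr.
- move=> i; apply/ffunP => b; rewrite [RHS]ffunE; apply: (tens_cartan T).
  rewrite ffunE; have [bj|jb] := leqP b j; last first.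
    by rewrite scaler0 (linear_zero (cactL _)).
  have hb : inord (j - (j - b)) = b :> 'I_n.+1 by rewrite subKn // inord_val.
  have := wy (j - b)%N (leq_subr _ _) i; rewrite hb; exact.
- by rewrite ffunE leqnn subnn.
move=> phi b phiL phif bj; rewrite ffunE.
have [le|_] := leqP b j; last exact: linear_zero.
apply: fy => //.
by rewrite subn_gt0 leq_subr andbT ltn_neqAle le andbT; rewrite -val_eqE in bj.
Qed.

End Existence.

(** * The chain of functionals and its values on a singular vector *)

Section DualChain.
Variables (K : fieldType) (n : nat) (M : lmodType K).
Variables (e f : 'I_n -> M -> M) (h : 'I_n -> nat -> M -> M) (v : M).
Variables (br : 'I_n.+1 -> 'I_n.+1 -> nat -> K) (k : 'I_n.+1).
Variable phi : M -> K^o.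
Hypothesis eL : forall i, linear (e i).
Hypothesis fL : forall i, linear (f i).
Hypothesis hL : forall i m, linear (h i m).
Hypothesis phiL : linear phi.
Hypothesis ef_comm : forall i k x,
  e i (f k x) = f k (e i x) + (i == k)%:R *: h i 0 x.
Hypothesis ee_far : forall (i k : 'I_n) x, (i.+1 < k)%N ->
  e i (e k x) = e k (e i x).
Hypothesis he_far : forall (i k : 'I_n) m x, (i.+1 < k)%N || (k.+1 < i)%N ->
  h i m (e k x) = e k (h i m x).
Hypothesis he_near : forall (i k : 'I_n) m x, (i.+1 == k) || (k.+1 == i) ->
  h i m.+1 (e k x) = e k (h i m x).
Hypothesis e_v : forall i, e i v = 0.
Hypothesis phi_f : forall i x, phi (f i x) = 0.
Hypothesis phi_h : forall i m x, phi (h i m x) = br (lo i) (up i) m * phi x.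
Hypothesis br_mul : forall a b c m p,
  br a b m.+1 * br b c p.+1 - br a b m * br b c p = br a c (m + p).+1.
Hypothesis br_neq0 : forall (a : 'I_n.+1) m, (k < a)%N -> br k a m != 0.

Let L := (n - k)%N.
(** Precomposition reverses products, so on functionals the f_i raise and the e_i lower. [phi],
    which vanishes on the images of the f_i, is the highest weight vector, and index t stands for
    the simple root k + t. *)
Let E t (p : M -> K^o) : M -> K^o := p \o extop f (k + t).
Let F t (p : M -> K^o) : M -> K^o := p \o extop e (k + t).
Let H t m (p : M -> K^o) : M -> K^o := p \o extop (h^~ m) (k + t).
Let D (p : M -> K^o) := linear p.
Let beta t m := br (inord (k + t)) (inord (k + t).+1) m.
Let g t m := br k (inord (k + t).+1) (t + m).

Let idx t : (t < L)%N -> exists i : 'I_n, (k + t)%N = i.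
Proof. by move=> tj; apply: ord_ex; rewrite /L in tj; lia. Qed.

Let g_neq0 t : (t < L)%N -> g t 0 != 0.
Proof. by rewrite /L => tj; apply: br_neq0; rewrite inordK; lia. Qed.

Let beta0 m : (0 < L)%N -> beta 0 m = g 0 m.
Proof. by move=> j0; rewrite /beta /g add0n !addn0 inord_val. Qed.

Let betaS t m : (t.+1 < L)%N ->
  beta t.+1 m.+1 * g t 1 - beta t.+1 m * g t 0 = g t.+1 m.
Proof.
move=> tj; rewrite /beta /g addn1 addn0 mulrC [br _ _ m * _]mulrC.
by rewrite addnS br_mul.
Qed.

Definition dual_chain t : M -> K^o := chain F (coefa 1 g) (coefb 1 g) t phi.

Let opL (o : nat -> M -> M) t : linear (fun p : M -> K^o => p \o o t).
Proof. by []. Qed.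

Let DF t p : D p -> D (F t p).
Proof. by move=> hp a x y; rewrite /F /= (extopL (k + t) eL) hp. Qed.

Let DD p q : D p -> D q -> D (p + q).
Proof.
move=> hp hq a x y.
by rewrite [LHS]/(p (a *: x + y) + q (a *: x + y)) hp hq scalerDr addrACA.
Qed.

Let DZ c p : D p -> D (c *: p).
Proof.
move=> hp a x y.
have hxy : (p (a *: x + y) : K) = a * (p x : K) + (p y : K) := hp a x y.
rewrite [LHS]/(c * (p (a *: x + y) : K) : K) hxy.
exact: etrans (mulrDr c (a * p x : K) (p y : K)) (congr1 (fun u : K => u + c * p y) (mulrCA c a (p x))).
Qed.

Lemma dual_chainL t : linear (dual_chain t).
Proof. exact: (@chain_stable K _ F D (coefa 1 g) (coefb 1 g) DF DD DZ t phi phiL). Qed.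

Let E_dual s t : (s < L)%N -> (t <= L)%N ->
  E s (dual_chain t) = ((s.+1 == t)%:R * 1) *: dual_chain t.-1.
Proof.
move=> sL tL; apply: (@E_chain K _ L E F H D _ _ (fun t => opL _ _)
  (fun t => opL _ _) (fun t m => opL (fun t => extop (h^~ m) t) _)
  DF DD DZ _ _ _ _ _ beta _) => //.
- move=> a b p aj bj ab hp; have [i ia] := idx aj; have [r rb] := idx bj.
  apply/funext => x; rewrite /E /F /= ia rb !extopE ef_comm.
  case: eqP => [ir|_]; first by rewrite ir -ia in rb; lia.
  by rewrite scale0r addr0.
- move=> a p aj hp; have [i ia] := idx aj; apply/funext => x.
  rewrite [RHS]/(F a (E a p) x + H a 0 p x) /E /F /H /= ia !extopE.
  by rewrite ef_comm eqxx scale1r (linear_add hp).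
- move=> a b p ab bj hp; have [|i ia] := @idx a; first lia.
  have [r rb] := idx bj; apply/funext => x; rewrite /F /= ia rb !extopE.
  by congr (p _); apply/esym/ee_far; lia.
- move=> a b m p aj bj ab hp; have [i ia] := idx aj; have [r rb] := idx bj.
  apply/funext => x; rewrite /H /F /= ia rb !extopE he_far //; lia.
- move=> a b m p aj bj ab hp; have [i ia] := idx aj; have [r rb] := idx bj.
  apply/funext => x; rewrite /H /F /= ia rb !extopE he_near //; lia.
- by move=> a aj; apply: (coefab _ g_neq0 beta0 betaS).
- move=> a aj; have [i ia] := idx aj; apply/funext => x.
  by rewrite /E /= ia extopE phi_f.
- move=> a m aj; have [i ia] := idx aj; apply/funext => x.
  by rewrite /H /beta /= ia extopE phi_h inord_lo inord_up.
- move=> a aj; rewrite (chain_constE _ beta0 betaS) // mul1r divff //.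
  exact: g_neq0.
Qed.

Let chain_dualS t p z :
  (chain F (coefa 1 g) (coefb 1 g) t.+1 p z : K) =
  coefa 1 g t * (chain F (coefa 1 g) (coefb 1 g) t p (extop e (k + t) z) : K) +
  coefb 1 g t * (chain F (coefa 1 g) (coefb 1 g) t (F t p) z : K).
Proof. by []. Qed.

Let functionalZ p (c : K) z : D p -> (p (c *: z) : K) = c * (p z : K).
Proof. by move=> hp; exact: (linear_scale c hp z). Qed.

(** For i >= k this is the action of the raising operator on the chain. For i < k, f_i commutes with
    every e in the chain and [phi] vanishes on its image. *)
Lemma dual_chain_f (i : 'I_n) t x : (t <= L)%N ->
  dual_chain t (f i x) =
  ((0 < t) && (k + t == i.+1))%N%:R * (dual_chain t.-1 x : K).
Proof.
move=> tL; have [ik|ki] := ltnP i k.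
  have -> : ((0 < t) && (k + t == i.+1))%N = false by lia.
  have hO : dual_chain t \o f i = 0.
    rewrite [LHS](@chain_comm K _ F D (coefa 1 g) (coefb 1 g) DF DD DZ
      (fun p => p \o f i) t phi (opL (fun _ => f i) 0)) //.
      have -> : phi \o f i = 0 by apply/funext => z; exact: phi_f.
      by rewrite (linear_zero (chainL _ _ (fun t => opL _ _) _)).
    move=> s p st hp; have [|r rs] := @idx s; first lia.
    apply/funext => z; rewrite /F /= rs !extopE ef_comm.
    case: eqP => [ri|_]; first by rewrite ri in rs; lia.
    by rewrite scale0r addr0.
  by rewrite mul0r; exact: (congr1 (fun p : M -> K^o => p x) hO).
have iL : (i - k < L)%N by rewrite /L; have := ltn_ord i; lia.
have := congr1 (fun p : M -> K^o => p x) (E_dual iL tL).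
rewrite /E /= subnKC // extopE => ->; rewrite mulr1.
by congr (_%:R * _); lia.
Qed.

Lemma chain_dual_v t (p : M -> K^o) : D p -> p v = 0 ->
  chain F (coefa 1 g) (coefb 1 g) t p v = 0.
Proof.
elim: t p => // t IH p hp pv.
rewrite [LHS]chain_dualS.
have ev : extop e (k + t) v = 0.
  by rewrite /extop; case: insubP.
rewrite ev (linear_zero (@chain_stable K _ F D _ _ DF DD DZ t p hp)).
rewrite IH; [by rewrite !mulr0 addr0|exact: DF|by rewrite /F /= ev linear_zero].
Qed.

Lemma dual_chain_v t : phi v = 1 -> dual_chain t v = (t == 0%N)%:R.
Proof.
move=> phiv; case: t => [|t]; first exact: phiv.
rewrite [LHS]chain_dualS.
have ev : extop e (k + t) v = 0.
  by rewrite /extop; case: insubP.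
rewrite ev (linear_zero (@chain_stable K _ F D _ _ DF DD DZ t phi phiL)) chain_dual_v.
- by rewrite !mulr0 addr0.
- exact: DF.
- by rewrite /F /= ev linear_zero.
Qed.

Section Evaluation.
Variables (y : nat -> M) (s : K).
Hypothesis ey : forall (i : 'I_n) b, e i (y b) = ((i == b :> nat)%:R * s) *: y b.+1.

(** A monomial in e_k, ..., e_(k+t-1), each used once, is nonzero on [y b] only if b = k and the
    factors act in increasing order. That monomial always takes the second summand of the chain,
    whence the product of the [coefb]; at the bottom, where both summands give the same monomial,
    [coefa] is 0. *)
Lemma chain_dual_eval t b (p : M -> K^o) : D p -> (t <= L)%N ->
  (chain F (coefa 1 g) (coefb 1 g) t p (y b) : K) =
  if t == 0%N then (p (y b) : K) else
  (b == k)%:R * (\prod_(r < t) coefb 1 g r * s ^+ t) * (p (y (k + t)%N) : K).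
Proof.
elim: t b p => [//|t IH] b p hp tL.
rewrite [LHS]chain_dualS; have [i it] := idx tL; rewrite it extopE ey.
rewrite (functionalZ _ _ (@chain_stable K _ F D _ _ DF DD DZ t p hp)).
rewrite !IH; [|exact: DF|lia|done|lia].
rewrite /F /= it !extopE !ey !(functionalZ _ _ hp) eqxx -it addnS big_ord_recr /=.
rewrite exprS; have [t0|t0] := eqVneq t 0%N.
  rewrite t0 /= big_ord0 expr0 !addn0 mul0r add0r eq_sym.
  by case: eqP => [->|_]; rewrite /= ?mulr0n ?mulr1n; ring.
have [bk|bk] := eqVneq b k; last first.
  rewrite mulr0n !mul0r mulr0 addr0; have [bt|_] := eqVneq (k + t)%N b; last first.
    by rewrite !mul0r mulr0.
  by rewrite (_ : (b.+1 == k)%N = false) ?mul0r ?mulr0 //; lia.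
by rewrite bk (_ : (k + t == k)%N = false) ?mulr1n ?mulr0n; [ring|lia].
Qed.

Variables (tau : 'I_n.+1 -> 'I_n.+1 -> K) (psi : 'I_n.+1 -> M -> K) (c c' : K).
Variable j : 'I_n.+1.
Hypothesis M_ind : forall P : M -> Prop,
  P 0 -> (forall x z, P x -> P z -> P (x + z)) -> (forall d x, P x -> P (d *: x)) ->
  P v -> (forall i x, P x -> P (f i x)) -> forall x, P x.
Hypothesis tau_mul : forall a b d, tau a b * tau b d = tau a d.
Hypothesis tau_id : forall a, tau a a = 1.
Hypothesis psiL : forall a, linear (psi a : M -> K^o).
Hypothesis psi_v : forall a, psi a v = c' * (a == k)%:R.
Hypothesis psi_f : forall a i x,
  psi a (f i x) = (a == up i)%:R * (tau (lo i) (up i) * psi (lo i) x).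
Hypothesis phi_v : phi v = 1.
Hypothesis phi_y : forall b, (b <= n)%N -> phi (y b) = c * (b == j)%:R.

(** Both sides take the same values on [v] and obey the same recursion under the f_i, which generate
    the module from [v]. The factors [tau] of consecutive roots multiply up to [tau k a]. *)
Lemma psi_dual x a : psi a x =
  if (k <= a)%N then c' * tau k a * (dual_chain (a - k) x : K) else 0.
Proof.
move: x a; apply: M_ind => [a|x z hx hz a|d x hx a|a|i x hx a].
- have -> : psi a 0 = 0 by exact: (linear_zero (psiL a)).
  by case: ifP => // _; rewrite (linear_zero (dual_chainL _)) mulr0.
- have -> : psi a (x + z) = psi a x + psi a z by exact: (linear_add (psiL a)).
  rewrite hx hz; case: ifP => _; last by rewrite addr0.
  have -> : (dual_chain (a - k) (x + z) : K) =
    (dual_chain (a - k) x : K) + (dual_chain (a - k) z : K).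
    exact: (linear_add (dual_chainL _)).
  by rewrite mulrDr.
- have -> : psi a (d *: x) = d * psi a x by exact: (linear_scale d (psiL a)).
  rewrite hx; case: ifP => _; last by rewrite mulr0.
  by rewrite (functionalZ _ _ (dual_chainL _)) mulrCA.
- rewrite psi_v; case: leqP => [ka|ak].
    rewrite dual_chain_v // subn_eq0 -val_eqE /= eqn_leq ka andbT.
    case: leqP => [ak|_]; last by rewrite !mulr0.
    have -> : a = k by apply/val_inj/eqP; rewrite /= eqn_leq ak.
    by rewrite tau_id !mulr1.
  by rewrite -val_eqE /= ltn_eqF // mulr0.
rewrite psi_f hx; have [ka|ak] := leqP k a; last first.
  rewrite -val_eqE /= /bump /= add1n; case: eqP => [ai|_]; last by rewrite mulr0n mul0r.
  by rewrite ifN ?mulr0 // -ltnNge; lia.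
rewrite dual_chain_f; last by rewrite /L leq_sub2r // -ltnS.
rewrite -val_eqE /= /bump /= add1n subnKC //.
have [ai|_] := eqVneq (a : nat) i.+1; last by rewrite andbF mulr0n !mul0r mulr0.
have -> : a = up i by apply/val_inj; rewrite /= /bump /= add1n.
rewrite /= /bump /= add1n andbT mulr1n mul1r subn_gt0 ltnS; case: leqP => [ki|_]; last first.
  by rewrite mulr0n !mul0r !mulr0.
rewrite subSn //= mulr1n mul1r -(tau_mul k (lo i) (up i)); ring.
Qed.

(** The functional with a = k is [phi] itself and gives the identity entry. For a > k,
    [chain_dual_eval] leaves b = k, then [phi] forces a = j, and [prod_coefb] with j - k factors
    supplies the coefficient, its signs absorbed in the power of - s. *)
Lemma psi_eval (a : 'I_n.+1) b : (b <= n)%N -> psi a (y b) = c * c' *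
  (((a == k) && (b == j :> nat))%:R + ((k < j) && (a == j) && (b == k :> nat))%N%:R *
    - (tau k j * (- s) ^+ (j - k) / br k j (j - k).-1)).
Proof.
move=> bn; rewrite psi_dual; case: (ltngtP k a) => [ka|ak|ka].
- rewrite [dual_chain _ _]chain_dual_eval //; last by rewrite /L leq_sub2r // -ltnS.
  rewrite subn_eq0 leqNgt ka /=.
  have -> : (k + (a - k))%N = a by rewrite subnKC // ltnW.
  rewrite [phi _]phi_y; last by rewrite -ltnS.
  have -> : (a == k) = false by apply/eqP => e0; rewrite e0 ltnn in ka.
  rewrite /= add0r -[a == j]val_eqE /=.
  have [ej|_] := eqVneq (a : nat) j; last by rewrite andbF /= !(mulr0n, mulr0, mul0r).
  have -> : a = j by apply/val_inj.
  rewrite -ej ka /=; have [bk|_] := eqVneq b k; last by rewrite /= !(mulr0n, mulr0, mul0r).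
  have [t et] : exists t, (a - k)%N = t.+1 by exists (a - k).-1; lia.
  rewrite et (@prod_coefb _ _ _ L); last by rewrite /L; have := ltn_ord a; lia.
  + rewrite /g expr1n addn0 (_ : (k + t).+1 = a); last lia.
    rewrite ej inord_val /= ?mulr1n !mulr1 [(- s) ^+ _]exprNn [(-1) ^+ t.+1]exprS.
    ring.
  + exact: g_neq0.
- have -> : (a == k) = false by apply/eqP => e0; rewrite e0 ltnn in ak.
  rewrite /= add0r.
  case: ltnP => [kj|_]; last by rewrite /= ?mulr0n ?mul0r mulr0.
  have -> : (a == j) = false by apply/eqP => e0; move: ak kj; rewrite e0; lia.
  by rewrite /= ?mulr0n ?mul0r mulr0.
- have -> : a = k by apply/val_inj.
  rewrite subnn tau_id /dual_chain /= phi_y // eqxx /=.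
  have -> : (k < j)%N && (k == j) = false by rewrite -val_eqE /=; lia.
  by rewrite /= ?mulr0n mul0r addr0; ring.
Qed.
End Evaluation.

End DualChain.

(* [v_c (x) v_d |-> d c d v_c (x) v_d + o c d v_d (x) v_c], with [o c c]
   ignored. *)
Definition wt0_mx (K : fieldType) m (d o : 'I_m -> 'I_m -> K) : 'M[K]_(m * m) :=
  \matrix_(i, j) let: (a, b) := mxtens_unindex i in
    let: (a', b') := mxtens_unindex j in
    ((a == a') && (b == b'))%:R * d a' b' +
    ((a' != b') && (a == b') && (b == a'))%:R * o a' b'.

(** * The composite of two intertwiners and the fusion matrix *)

Section Fusion.
Variables (K : fieldType) (n : nat) (U : hopf_pres K n) (V : rep U n.+1).
Variable T : typeA V.
Local Notation weight := ('I_n.+1 -> K).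
Implicit Types lam nu : weight.

(** nu is lam minus the weight of v_j, as far as [chi] can tell: the eigenvalues of the Cartan
    generators on a vector of V give no more than this. *)
Definition weight_step lam nu (j : 'I_n.+1) : Prop :=
  forall i, chi U (lam i - nu i) = wv T (i == j).

(** The joint eigenspaces of the Cartan generators on V are the coordinate lines, because [wv true]
    and [wv false] differ. *)
Lemma weight_vectorP mu (v : 'cV[K]_n.+1) : weight_vector V mu v ->
  exists j c, v = c *: delta_mx j 0 /\ forall i, chi U (mu i) = wv T (i == j).
Proof.
case=> v0 hv.
have vi i j : wv T (i == j) * v j 0 = chi U (mu i) * v j 0.
  have := congr1 (fun w : 'cV_n.+1 => w j 0) (hv i).
  by rewrite (V_cartan T) mul_diag_mx !mxE.
have [j vj] : exists j, v j 0 != 0.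
  apply/existsP; apply: contraNT v0 => /existsPn hv0; apply/eqP/matrixP => i k.
  by rewrite ord1 mxE; apply/eqP; have := hv0 i; rewrite negbK.
have cj i : chi U (mu i) = wv T (i == j) by apply: (mulIf vj); rewrite -vi.
exists j, (v j 0); split=> //; apply/matrixP => i k; rewrite ord1 !mxE eqxx andbT.
have [->|ij] := eqVneq i j; first by rewrite mulr1.
have := vi i i; rewrite cj eqxx (negbTE ij) => /eqP.
rewrite -subr_eq0 -mulrBl mulf_eq0 subr_eq0 (negbTE (wv_neq T)) /= => /eqP ->.
by rewrite mulr0.
Qed.

Lemma delta_weight_vector mu j : (forall i, chi U (mu i) = wv T (i == j)) ->
  weight_vector V mu (delta_mx j 0).
Proof.
move=> hmu; split=> [|i].
  by apply/eqP => /matrixP /(_ j 0); rewrite !mxE !eqxx => /eqP; rewrite oner_eq0.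
apply/matrixP => a k; rewrite (V_cartan T) mul_diag_mx !mxE hmu ord1 eqxx andbT.
by have [->|_] := eqVneq a j; rewrite /= ?mulr0n ?mulr0.
Qed.

Lemma ex_Phi lam nu j : (forall i, lam i = nu i + (i == j)%:R) ->
  (forall (a : 'I_n.+1) m, (a < j)%N -> br T nu a j m != 0) ->
  exists Phi, @is_Phi K n U lam nu n.+1 V (delta_mx j 0) Phi.
Proof.
move=> hlam /singular_vector [u [ue uc uj uphi]].
have [|||i|Phi [PhiL Phihw PhiE]] :=
  @verma_univ K n U _ (verma_tens_act V (nu := nu)) lam u.
- exact: verma_tens_actL.
- exact: tens_rel.
- exact: ue.
- by rewrite hlam; exact: uc.
exists Phi; split=> // i.
have [phi [phiL phihw phif phic _]] := hw_coord T nu.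
apply: (proj2 (lower_sub_hw phiL phihw phif phic _ _)); rewrite Phihw mxE andbT.
by have [->|ij] := eqVneq i j; [rewrite uj|rewrite uphi].
Qed.

Section Composite.
Variables (lam nu1 nu2 : weight) (j k : 'I_n.+1) (c c' : K).
Variable Phi1 : verma U lam -> {ffun 'I_n.+1 -> verma U nu1}.
Variable Phi2 : verma U nu1 -> {ffun 'I_n.+1 -> verma U nu2}.
Hypothesis Phi1P : is_Phi V (c *: delta_mx j 0) Phi1.
Hypothesis Phi2P : is_Phi V (c' *: delta_mx k 0) Phi2.
Hypothesis br_neq0 : forall (a : 'I_n.+1) m, (k < a)%N -> br T nu1 k a m != 0.

(** Applies to arbitrary intertwiners: that Phi1 (hw) is killed by the e_i fixes how they act on its
    coordinates, and the functionals phi2 (Phi2 (-)_a) obey the dual recursion because Phi2 commutes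
    with the f_i. [psi_eval] then applies with s = - 1 / [kap]. *)
Lemma composite_coord (phi2 : verma U nu2 -> K) (a b : 'I_n.+1) :
  linear (phi2 : verma U nu2 -> K^o) -> phi2 (hw U nu2) = 1 ->
  (forall i x, phi2 (fact T i x) = 0) ->
  (forall i x, phi2 (cact i x) = chi U (nu2 i) * phi2 x) ->
  (forall i x, phi2 (vact (kin T i) x) = tau T nu2 (lo i) (up i) * phi2 x) ->
  phi2 (Phi2 (Phi1 (hw U lam) b) a) = c * c' *
  (((a == k) && (b == j :> nat))%:R +
   ((k < j)%N && (a == j) && (b == k :> nat))%:R *
   - (tau T nu2 k j * (- - (kap T)^-1) ^+ (j - k) / br T nu1 k j (j - k).-1)).
Proof.
move=> phi2L phi2hw phi2f phi2c phi2k.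
have [Phi1L Phi1E Phi1hw] := Phi1P; have [Phi2L Phi2E Phi2hw] := Phi2P.
have [phi1 [phi1L phi1hw phi1f phi1c [phi1h _]]] := hw_coord T nu1.
pose u := Phi1 (hw U lam).
(* Coordinate b' of e_i u = 0, divided by [kape i b']; only b' = [lo i] gives a nonzero value, where
   [kape] is [kap]. *)
have ue (i : 'I_n) b' : eact i (u b') =
    ((b' == lo i)%:R * - (kap T)^-1) *: u (up i).
  have : verma_tens_act V (raise U i) u b' = 0.
    by rewrite /u -Phi1E vact_raise_hw (linear_zero Phi1L) ffunE.
  rewrite (tens_e T) => h0; apply: (scalerI (kape_neq0 T i b')).
  rewrite -[LHS]addr0 -(subrr ((b' == lo i)%:R *: u (up i))) addrA h0 add0r.
  rewrite scalerA; case: eqP => [->|_]; last by rewrite !mul0r mulr0 !scale0r oppr0.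
  by rewrite (kape_lo T) mul1r mulrN mulfV ?(kap_neq0 T) // scale1r scaleN1r.
(* Extended by 0 past n, so that the relation e_i y_b = s y_(b+1) can be stated for all natural
   b. *)
pose y b' : verma U nu1 := if (b' <= n)%N then u (inord b') else 0.
have yE (b' : 'I_n.+1) : y b' = u b' by rewrite /y -ltnS ltn_ord inord_val.
have -> : Phi1 (hw U lam) b = y b by rewrite yE.
have yn (b' : nat) : (b' <= n)%N -> phi1 (y b') = c * (b' == j :> nat)%:R.
  move=> bn; rewrite /y bn; apply: (etrans (proj1 (lower_sub_hw phi1L phi1hw phi1f phi1c _ _) (Phi1hw _))).
  by rewrite !mxE eqxx andbT -val_eqE /= inordK.
have ey (i : 'I_n) b' : eact i (y b') = ((i == b' :> nat)%:R * - (kap T)^-1) *: y b'.+1.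
  rewrite /y; have [bn|nb] := leqP b' n; last first.
    rewrite (linear_zero (eactL _)) ifN ?scaler0 //; lia.
  have hb : (inord b' == lo i) = (i == b' :> nat).
    by rewrite -val_eqE /= inordK // eq_sym.
  apply: etrans (ue i (inord b')) _; rewrite hb.
  case: eqP => [ib|_]; last by rewrite !mul0r !scale0r.
  rewrite -ib ltn_ord inord_up; exact: erefl.
apply: (@psi_eval K n (verma U nu1) (@eact K n U nu1) (fact T (nu := nu1))
  (fun i m => hact T i m) (hw U nu1) (br T nu1) k phi1 (@eactL _ _ _ _)
  phi1L (@ef_comm _ _ _ _ T nu1) (@ee_far _ _ _ _ T nu1)
  (@he_far _ _ _ _ T nu1) (@he_near _ _ _ _ T nu1)
  (@vact_raise_hw K n U nu1) phi1f phi1h (@br_mul _ _ _ _ T nu1) br_neq0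
  y _ ey (tau T nu2) (fun a x => phi2 (Phi2 x a)) c c' j
  (@fact_ind _ _ _ _ T nu1) (@tau_mul _ _ _ _ T nu2) (@tau_id _ _ _ _ T nu2) _ _ _ phi1hw yn a b _).
- by move=> a' d x z; rewrite Phi2L !ffunE phi2L.
- move=> a'; have := proj1 (lower_sub_hw phi2L phi2hw phi2f phi2c _ _) (Phi2hw a').
  by rewrite !mxE eqxx andbT.
- move=> a' i x; rewrite [Phi2 _]Phi2E (tens_f T).
  rewrite (linear_add phi2L) phi2f add0r (linear_scale _ phi2L).
  by rewrite phi2k.
- by rewrite -ltnS.
Qed.

End Composite.

Variables (regular : weight -> Prop) (lam : weight) (jc : 'I_n.+1 -> 'I_n.+1 -> K).
Hypothesis regular_br : forall nu (a b : 'I_n.+1) m, regular nu -> (a < b)%N ->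
  br T nu a b m != 0.
Hypothesis regular_step : forall nu nu' j, regular nu ->
  weight_step nu nu' j -> regular nu'.
Hypothesis lam_regular : regular lam.
Hypothesis jcE : forall nu1 nu2 j k, weight_step lam nu1 j ->
  weight_step nu1 nu2 k -> (k < j)%N ->
  - (tau T nu2 k j * (kap T)^-1 ^+ (j - k) / br T nu1 k j (j - k).-1) = jc k j.

Let J := wt0_mx (fun _ _ => 1) (fun a b : 'I_n.+1 => (a < b)%N%:R * jc a b).

Lemma tens_delta_col m p (c c' : K) (k : 'I_m) (j : 'I_p) :
  (c *: delta_mx k 0 : 'cV[K]_m) *t (c' *: delta_mx j 0 : 'cV[K]_p) =
  (c * c') *: delta_mx (mxtens_index (k, j)) 0 :> 'cV[K]_(m * p).
Proof.
apply/matrixP => i i0; have [[a b] ->] : exists ab, i = mxtens_index ab.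
  by exists (mxtens_unindex i); rewrite mxtens_unindexK.
rewrite !mxE mxtens_indexK /= (can_eq (@mxtens_indexK m p)) -pair_eqE /=.
by rewrite !ord1 /= !andbT mulrACA -natrM mulnb.
Qed.

Lemma mul_wt0_delta (a b k j : 'I_n.+1) :
  (J *m delta_mx (mxtens_index (k, j)) 0 : 'cV[K]_(n.+1 * n.+1))
    (mxtens_index (a, b)) 0 =
  ((a == k) && (b == j))%:R +
  ((k < j)%N && (a == j) && (b == k))%:R * jc k j.
Proof.
rewrite -colE !mxE !mxtens_indexK mulr1; congr (_ + _).
rewrite mulrA -natrM mulnb; congr (_%:R * _).
case: (ltngtP k j) => [kj|kj|/val_inj ->]; rewrite ?andbF ?andbT ?eqxx //=.
by rewrite -val_eqE /= ltn_eqF.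
Qed.

(** Linearity and the intertwining property are inherited from the two factors; the leading
    coefficients are those of [composite_coord], which [jcE] rewrites in terms of lam. *)
Lemma is_fusion_wt0 : is_fusion_matrix V V lam J.
Proof.
move=> nu1 nu2 w v Phi1 Phi2.
move=> /weight_vectorP [j [c [-> hj]]] /weight_vectorP [k [c' [-> hk]]] h1 h2.
have [Phi1L Phi1E Phi1hw] := h1; have [Phi2L Phi2E Phi2hw] := h2.
have r1 : regular nu1 by apply: regular_step hj.
split.
- move=> a x y; apply/ffunP => i; rewrite !ffunE Phi1L !ffunE Phi2L !ffunE.
  exact: erefl.
- exact: (comp_act T).
move=> i; have [phi [phiL phihw phif phic [_ phik]]] := hw_coord T nu2.
apply: (proj2 (lower_sub_hw phiL phihw phif phic _ _)).
have [[a b] ->] : exists ab, i = mxtens_index ab.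
  by exists (mxtens_unindex i); rewrite mxtens_unindexK.
rewrite ffunE mxtens_indexK /=.
rewrite (composite_coord h1 h2 _ _ _ phiL) //; last by move=> d m; apply: regular_br.
rewrite tens_delta_col -scalemxAr mxE mul_wt0_delta [c' * c]mulrC; congr (_ * (_ + _)).
case: ltnP => kj /=; last by rewrite !mul0r.
by rewrite opprK (jcE hj hk kj).
Qed.

(** For each basis vector v_k (x) v_j regularity provides actual intertwiners Phi1 and Phi2. A
    matrix with the defining property and the explicit one both give leading terms of the same
    composite, so [phi] identifies their columns. *)
Lemma fusion_matrix_wt0 : fusion_matrix V V lam = J.
Proof.
apply: xget_unique; first exact: is_fusion_wt0.
move=> J' hJ'; apply/matrixP => r s.
have [[a b] ->] : exists ab, r = mxtens_index ab.
  by exists (mxtens_unindex r); rewrite mxtens_unindexK.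
have [[k j] ->] : exists ab, s = mxtens_index ab.
  by exists (mxtens_unindex s); rewrite mxtens_unindexK.
pose nu1 : weight := fun i => lam i - (i == j)%:R.
pose nu2 : weight := fun i => nu1 i - (i == k)%:R.
have hj : weight_step lam nu1 j by move=> i; rewrite subKr (chi_bool T).
have hk : weight_step nu1 nu2 k by move=> i; rewrite subKr (chi_bool T).
have r1 := regular_step lam_regular hj; have r2 := regular_step r1 hk.
have [||Phi1 h1] := @ex_Phi lam nu1 j; first by move=> i; rewrite subrK.
  by move=> d m; apply: regular_br.
have [||Phi2 h2] := @ex_Phi nu1 nu2 k; first by move=> i; rewrite subrK.
  by move=> d m; apply: regular_br.
have wj := delta_weight_vector hj; have wk := delta_weight_vector hk.
have [_ _ e1] := hJ' _ _ _ _ _ _ wj wk h1 h2.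
have [_ _ e2] := is_fusion_wt0 wj wk h1 h2.
have [phi [phiL phihw phif phic _]] := hw_coord T nu2.
have := proj1 (lower_sub_hw phiL phihw phif phic _ _) (e1 (mxtens_index (a, b))).
rewrite (proj1 (lower_sub_hw phiL phihw phif phic _ _) (e2 (mxtens_index (a, b)))).
have /= := tens_delta_col 1 1 k j; rewrite !scale1r mulr1 scale1r => ->.
by rewrite -!colE !mxE.
Qed.

End Fusion.

(** * Quantum gl *)

Section RelationShapes.
Variables (K : fieldType) (G : Type) (A : lalgType K) (X : lmodType K).
Variables (l : G -> A) (act : A -> X -> X) (op : G -> X -> X).
Hypothesis act_linear : forall x, linear (act ^~ x).
Hypothesis actM : forall a b x, act (a * b) x = act a (act b x).
Hypothesis act1 : forall x, act 1 x = x.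
Hypothesis actl : forall g x, act (l g) x = op g x.

Let actD a b x := linear_add (act_linear x) a b.
Let actB a b x := linear_sub (act_linear x) a b.
Let actZ c a x := linear_scale c (act_linear x) a.

(** This and the following unfoldings of the shapes of relations are stated for an arbitrary action,
    since they serve both operators on a module and the action on a Verma module. *)
Lemma act_inverse a b x : act (l a * l b - 1) x = op a (op b x) - x.
Proof. by rewrite actB actM act1 !actl. Qed.

Lemma act_comm a b x :
  act (l a * l b - l b * l a) x = op a (op b x) - op b (op a x).
Proof. by rewrite actB !actM !actl. Qed.

Lemma act_qcomm a b (c : K) x :
  act (l a * l b - c *: (l b * l a)) x = op a (op b x) - c *: op b (op a x).
Proof. by rewrite actB actZ !actM !actl. Qed.

Lemma act_ef a b (c : K) d d' g g' x :
  act (l a * l b - l b * l a - c *: (l d * l d' - l g * l g')) x =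
  op a (op b x) - op b (op a x) - c *: (op d (op d' x) - op g (op g' x)).
Proof. by rewrite !actB actZ actB !actM !actl. Qed.

Lemma act_serre a b (c : K) x :
  act (l a * l a * l b - c *: (l a * l b * l a) + l b * l a * l a) x =
  op a (op a (op b x)) - c *: op a (op b (op a x)) + op b (op a (op a x)).
Proof. by rewrite actD actB actZ !actM !actl. Qed.

Lemma act_bracket a b (c c' : K) d d' x :
  act (l a * l b - l b * l a - c *: l d + c' *: l d') x =
  op a (op b x) - op b (op a x) - c *: op d x + c' *: op d' x.
Proof. by rewrite actD !actB !actZ !actM !actl. Qed.

End RelationShapes.

Section TwistedSerre.
Variables (K : fieldType) (X : lmodType K) (q : K) (A1 A2 B1 B2 : X -> X).
Hypothesis q_neq0 : q != 0.
Hypothesis A1L : linear A1.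
Hypothesis A2L : linear A2.
Hypothesis B1L : linear B1.
Hypothesis B2L : linear B2.
Hypothesis AB11 : forall x, A1 (B1 x) = q ^+ 2 *: B1 (A1 x).
Hypothesis AB12 : forall x, A1 (B2 x) = q^-1 *: B2 (A1 x).
Hypothesis AB21 : forall x, A2 (B1 x) = q^-1 *: B1 (A2 x).

Definition serre (C1 C2 : X -> X) x :=
  C1 (C1 (C2 x)) - (q + q^-1) *: C1 (C2 (C1 x)) + C2 (C1 (C1 x)).

(* With the B's moved to the left, the coefficients of the six mixed monomials
   cancel. *)
Lemma serre_add (C1 C2 : X -> X) x :
  (forall y, C1 y = A1 y + B1 y) -> (forall y, C2 y = A2 y + B2 y) ->
  serre A1 A2 x = 0 -> serre B1 B2 x = 0 -> serre C1 C2 x = 0.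
Proof.
move=> C1E C2E; rewrite /serre => hA hB.
have hA' : A1 (A1 (A2 x)) = (q + q^-1) *: A1 (A2 (A1 x)) - A2 (A1 (A1 x)).
  by apply/eqP; rewrite -subr_eq0; apply/eqP; rewrite -[RHS]hA; lmod K X; ring.
have hB' : B1 (B1 (B2 x)) = (q + q^-1) *: B1 (B2 (B1 x)) - B2 (B1 (B1 x)).
  by apply/eqP; rewrite -subr_eq0; apply/eqP; rewrite -[RHS]hB; lmod K X; ring.
rewrite !C1E !C2E.
rewrite !(linear_add A1L, linear_add A2L, linear_add B1L, linear_add B2L).
do 3 rewrite ?(AB11, AB12, AB21, linear_scale _ A1L, linear_scale _ A2L,
  linear_scale _ B1L, linear_scale _ B2L).
rewrite hA' hB'.
by lmod K X; field.
Qed.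

End TwistedSerre.

(** * Families of operators satisfying the relations of the quantum group *)

Section UqModule.
Variables (K : fieldType) (n : nat) (q : K).

(* The relations among the e_i, and then those among the f_i, are kept apart:
   they fail in the intermediate modules used to construct functionals on Verma
   modules. *)
Record Uq_module00 (X : lmodType K) (op : qgen n -> X -> X) : Prop := {
  um_lin : forall g, linear (op g);
  um_kk : forall i j x, op (Qk i) (op (Qk j) x) = op (Qk j) (op (Qk i) x);
  um_kkv : forall i x, op (Qk i) (op (Qkinv i) x) = x;
  um_kvk : forall i x, op (Qkinv i) (op (Qk i) x) = x;
  um_ke : forall i j x, op (Qk i) (op (Qe j) x) =
    q ^ root_pairing i j *: op (Qe j) (op (Qk i) x);
  um_kf : forall i j x, op (Qk i) (op (Qf j) x) =
    q ^ (- root_pairing i j) *: op (Qf j) (op (Qk i) x);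
  um_ef : forall i x, op (Qe i) (op (Qf i) x) = op (Qf i) (op (Qe i) x) +
    (q - q^-1)^-1 *: (op (Qk (lo i)) (op (Qkinv (up i)) x) -
                      op (Qkinv (lo i)) (op (Qk (up i)) x));
  um_ef_neq : forall i j x, i != j ->
    op (Qe i) (op (Qf j) x) = op (Qf j) (op (Qe i) x)
}.

Record Uq_module0 (X : lmodType K) (op : qgen n -> X -> X) : Prop := {
  um_00 :> Uq_module00 op;
  um_ee : forall (i j : 'I_n) x, (i.+1 < j)%N ->
    op (Qe i) (op (Qe j) x) = op (Qe j) (op (Qe i) x);
  um_se : forall (i j : 'I_n) x, (i.+1 == j) || (j.+1 == i) ->
    serre q (op (Qe i)) (op (Qe j)) x = 0
}.

Record Uq_module (X : lmodType K) (op : qgen n -> X -> X) : Prop := {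
  um_0 :> Uq_module0 op;
  um_ff : forall (i j : 'I_n) x, (i.+1 < j)%N ->
    op (Qf i) (op (Qf j) x) = op (Qf j) (op (Qf i) x);
  um_sf : forall (i j : 'I_n) x, (i.+1 == j) || (j.+1 == i) ->
    serre q (op (Qf i)) (op (Qf j)) x = 0
}.

(** The relations among the f_i are asked only modulo [J], which will be the subspace generated by
    these very relations. *)
Lemma Uq_module_rel_mod (X : lmodType K) (op : qgen n -> X -> X) (J : X -> Prop) r x :
  Uq_module0 op -> J 0 ->
  (forall (i j : 'I_n) x, (i.+1 < j)%N ->
    J (op (Qf i) (op (Qf j) x) - op (Qf j) (op (Qf i) x))) ->
  (forall (i j : 'I_n) x, (i.+1 == j) || (j.+1 == i) ->
    J (serre q (op (Qf i)) (op (Qf j)) x)) ->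
  Uq_rel q r -> J (free_act op r x).
Proof.
move=> h J0 Jff Jsf hr.
pose al := free_act_linear op.
pose aM := free_actM (um_lin h).
pose a1 := free_act1 op; pose ac := free_act_letter op.
case: r / hr => [i j|i|i|i j|i j|i|i j ij|i j ij|i j ij|i j ij|i j ij].
- by rewrite (act_comm al aM ac) (um_kk h) subrr.
- by rewrite (act_inverse al aM a1 ac) (um_kkv h) subrr.
- by rewrite (act_inverse al aM a1 ac) (um_kvk h) subrr.
- by rewrite (act_qcomm al aM ac) (um_ke h) subrr.
- by rewrite (act_qcomm al aM ac) (um_kf h) subrr.
- by rewrite (act_ef al aM ac) (um_ef h) -addrA -opprD subrr.
- by rewrite (act_comm al aM ac) (um_ef_neq h) // subrr.
- by rewrite (act_comm al aM ac) (um_ee h) // subrr.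
- by rewrite (act_comm al aM ac); apply: Jff.
- by rewrite (act_serre al aM ac) [X in J X](um_se h).
- by rewrite (act_serre al aM ac); apply: Jsf.
Qed.

Lemma Uq_module_rel (X : lmodType K) (op : qgen n -> X -> X) r x :
  Uq_module op -> Uq_rel q r -> free_act op r x = 0.
Proof.
move=> h; apply: (Uq_module_rel_mod (J := fun y => y = 0) x h) => // i j y ij.
  by rewrite (um_ff h) // subrr.
exact: (um_sf h).
Qed.

Variable ch : K -> K.
Definition Uqc : hopf_pres K n :=
  {| gen := qgen n; Defs.rel := @Uq_rel _ n q; cop := @Uq_cop n;
     raise := @Qe n; cartan := @Qk n; chi := ch |}.

Lemma verma_Uq_module nu :
  Uq_module (fun g => @vact K n Uqc nu (@letter K (gen Uqc) g)).
Proof.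
pose al := @vact_linear K n Uqc nu; pose aM := @vactM K n Uqc nu.
pose a1 := @vact1 K n Uqc nu.
pose ac (g : qgen n) (x : verma Uqc nu) := erefl (@vact K n Uqc nu (@letter K (gen Uqc) g) x).
have R := @vact_rel K n Uqc nu.
split; [split; [split|..]|..].
- by move=> g; apply: vactL.
- move=> i j x; apply/eqP; rewrite -subr_eq0 -(act_comm al aM ac); apply/eqP/R; exact: Uq_kk.
- move=> i x; apply/eqP; rewrite -subr_eq0 -(act_inverse al aM a1 ac); apply/eqP/R; exact: Uq_kkV.
- move=> i x; apply/eqP; rewrite -subr_eq0 -(act_inverse al aM a1 ac); apply/eqP/R; exact: Uq_kVk.
- move=> i j x; apply/eqP; rewrite -subr_eq0 -(act_qcomm al aM ac); apply/eqP/R; exact: Uq_ke.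
- move=> i j x; apply/eqP; rewrite -subr_eq0 -(act_qcomm al aM ac); apply/eqP/R; exact: Uq_kf.
- move=> i x; apply/eqP; rewrite -subr_eq0 opprD addrA -(act_ef al aM ac); apply/eqP/R; exact: Uq_ef.
- move=> i j x ij; apply/eqP; rewrite -subr_eq0 -(act_comm al aM ac); apply/eqP/R; exact: Uq_ef_neq.
- move=> i j x ij; apply/eqP; rewrite -subr_eq0 -(act_comm al aM ac); apply/eqP/R; exact: Uq_ee.
- by move=> i j x ij; apply: etrans (esym (act_serre al aM ac _ _ _ _)) _; apply: R; exact: Uq_serre_e.
- move=> i j x ij; apply/eqP; rewrite -subr_eq0 -(act_comm al aM ac); apply/eqP/R; exact: Uq_ff.
- by move=> i j x ij; apply: etrans (esym (act_serre al aM ac _ _ _ _)) _; apply: R; exact: Uq_serre_f.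
Qed.

End UqModule.

Section CartanIntegers.
Variable n : nat.

Definition cartan_int (i j : 'I_n) : int :=
  root_pairing (lo i) j - root_pairing (up i) j.

Lemma opp_cartan_int (i j : 'I_n) :
  - cartan_int i j = root_pairing (up i) j - root_pairing (lo i) j.
Proof. exact: opprB. Qed.

Lemma lo_neq_up (i : 'I_n) : (lo i == up i) = false.
Proof. by rewrite -val_eqE /= /bump /= add1n ltn_eqF. Qed.

Lemma lo_eq_up (i j : 'I_n) : (lo i == up j) = (i == j.+1 :> nat).
Proof. by rewrite -val_eqE. Qed.

Lemma up_eq_lo (i j : 'I_n) : (up i == lo j) = (i.+1 == j :> nat).
Proof. by rewrite -val_eqE. Qed.

Lemma lo_eq (i j : 'I_n) : (lo i == lo j) = (i == j).
Proof. by rewrite -!val_eqE. Qed.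

Lemma up_eq (i j : 'I_n) : (up i == up j) = (i == j).
Proof. by rewrite -!val_eqE. Qed.

Lemma cartan_intE (i j : 'I_n) : cartan_int i j =
  if i == j then 2 else if (i.+1 == j :> nat) || (j.+1 == i :> nat) then -1 else 0.
Proof.
rewrite /cartan_int /root_pairing lo_eq up_eq lo_eq_up up_eq_lo [j.+1 == _]eq_sym.
have [->|ij] := eqVneq i j.
  have -> : (j == j.+1 :> nat) = false by lia.
  by have -> : (j.+1 == j :> nat) = false by lia.
case e1: (i.+1 == j :> nat); case e2: (i == j.+1 :> nat) => //=.
by move/eqP: e1; move/eqP: e2; lia.
Qed.

Lemma cartan_intC i j : cartan_int i j = cartan_int j i.
Proof. by rewrite !cartan_intE eq_sym orbC. Qed.

Lemma cartan_int_far (i j : 'I_n) : (i.+1 < j)%N || (j.+1 < i)%N ->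
  cartan_int i j = 0.
Proof.
move=> ij; rewrite cartan_intE !ifN //; first by lia.
by apply/eqP => e; rewrite e in ij; lia.
Qed.

Lemma cartan_int_near (i j : 'I_n) : (i.+1 == j) || (j.+1 == i) ->
  cartan_int i j = -1.
Proof.
move=> ij; rewrite cartan_intE ij ifN //.
by apply/eqP => e; rewrite e in ij; lia.
Qed.

End CartanIntegers.

Section UqVector.
Variables (K : fieldType) (n : nat) (q : K).
Hypothesis q_neq0 : q != 0.
Local Notation V := (@Uq_vector K n q).

Lemma diag_mx_delta m (d : 'rV[K]_m) (a b : 'I_m) :
  diag_mx d *m delta_mx a b = d 0 a *: delta_mx a b.
Proof.
apply/matrixP => i j; rewrite mul_diag_mx !mxE.
by have [->|_] := eqVneq i a; rewrite // !mulr0.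
Qed.

Lemma delta_mx_diag m (d : 'rV[K]_m) (a b : 'I_m) :
  delta_mx a b *m diag_mx d = d 0 b *: delta_mx a b.
Proof.
apply/matrixP => i j; rewrite mul_mx_diag !mxE mulrC.
by have [->|_] := eqVneq j b; rewrite // andbF !mulr0.
Qed.

Lemma Vkk i j : V (Qk i) *m V (Qk j) = V (Qk j) *m V (Qk i).
Proof. exact: diag_mxC. Qed.
Lemma Vkkv_comm i j : V (Qk i) *m V (Qkinv j) = V (Qkinv j) *m V (Qk i).
Proof. exact: diag_mxC. Qed.
Lemma Vkkv i : V (Qk i) *m V (Qkinv i) = 1%:M.
Proof.
rewrite /= mulmx_diag; apply/matrixP => a b; rewrite !mxE mulfV //.
by rewrite expf_neq0.
Qed.

Lemma exprz_bool (b c : bool) : q ^+ b = q ^ (b%:Z - c%:Z) * q ^+ c.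
Proof. by case: b; case: c; rewrite //= ?subrr ?expr0z ?mul1r // ?subr0 ?mulr1 // sub0r exprN1 mulVf. Qed.

Lemma Vke i j : V (Qk i) *m V (Qe j) =
  q ^ root_pairing i j *: (V (Qe j) *m V (Qk i)).
Proof.
by rewrite /= diag_mx_delta delta_mx_diag !mxE scalerA -exprz_bool.
Qed.

Lemma Vkf i j : V (Qk i) *m V (Qf j) =
  q ^ (- root_pairing i j) *: (V (Qf j) *m V (Qk i)).
Proof.
by rewrite /= diag_mx_delta delta_mx_diag !mxE scalerA /root_pairing opprB -exprz_bool.
Qed.

Lemma exprz_boolV (b c : bool) : q ^- b = q ^ (- (b%:Z - c%:Z)) * q ^- c.
Proof. by rewrite (exprz_bool b c) invfM invr_expz. Qed.

Lemma Vkve i j : V (Qkinv i) *m V (Qe j) =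
  q ^ (- root_pairing i j) *: (V (Qe j) *m V (Qkinv i)).
Proof.
by rewrite /= diag_mx_delta delta_mx_diag !mxE scalerA -exprz_boolV.
Qed.

Lemma Vkvf i j : V (Qkinv i) *m V (Qf j) =
  q ^ root_pairing i j *: (V (Qf j) *m V (Qkinv i)).
Proof.
rewrite -[root_pairing i j]opprK /root_pairing [- (_ - _)]opprB.
by rewrite /= diag_mx_delta delta_mx_diag !mxE scalerA -exprz_boolV.
Qed.

Lemma Vef i j : V (Qe i) *m V (Qf j) = (i == j)%:R *: delta_mx (lo i) (lo i).
Proof.
rewrite /= mul_delta_mx_cond up_eq -scaler_nat.
by case: eqP => [->|_]; rewrite ?scale1r ?scale0r.
Qed.

Lemma Vfe i j : V (Qf j) *m V (Qe i) = (i == j)%:R *: delta_mx (up i) (up i).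
Proof.
rewrite /= mul_delta_mx_cond lo_eq -scaler_nat eq_sym.
by case: eqP => [->|_]; rewrite ?scale1r ?scale0r.
Qed.

Lemma Vef_comm i : q - q^-1 != 0 ->
  V (Qe i) *m V (Qf i) - V (Qf i) *m V (Qe i) = (q - q^-1)^-1 *:
    (V (Qk (lo i)) *m V (Qkinv (up i)) - V (Qkinv (lo i)) *m V (Qk (up i))).
Proof.
move=> hq; rewrite Vef Vfe eqxx !scale1r /= !mulmx_diag.
apply/matrixP => a b; rewrite !mxE.
have [<-|ab] := eqVneq a b; last first.
  rewrite !mulr0n subrr mulr0.
  have -> : (a == lo i) && (b == lo i) = false.
    by apply/andP => -[/eqP ea /eqP eb]; rewrite ea eb eqxx in ab.
  have -> : (a == up i) && (b == up i) = false.
    by apply/andP => -[/eqP ea /eqP eb]; rewrite ea eb eqxx in ab.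
  exact: subrr.
rewrite !andbb !mulr1n ![_ == a]eq_sym.
have [->|al] := eqVneq a (lo i).
  by rewrite lo_neq_up /= subr0 expr0 expr1 divr1 mulr1 mulVf.
have [_|_] := eqVneq a (up i).
  by rewrite /= expr0 expr1 invr1 !mul1r -[q^-1 - q]opprB mulrN mulVf // sub0r.
by rewrite /= expr0 subrr invr1 mul1r subrr mulr0.
Qed.

Lemma Vee (i j : 'I_n) : (j != i.+1 :> nat) -> V (Qe i) *m V (Qe j) = 0.
Proof. by move=> ij; rewrite /= mul_delta_mx_cond up_eq_lo eq_sym (negbTE ij). Qed.

Lemma Vff (i j : 'I_n) : (i != j.+1 :> nat) -> V (Qf i) *m V (Qf j) = 0.
Proof. by move=> ij; rewrite /= mul_delta_mx_cond lo_eq_up (negbTE ij). Qed.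

End UqVector.

Section UqModuleTheory.
Variables (K : fieldType) (n : nat) (q : K) (X : lmodType K).
Variable op : qgen n -> X -> X.
Hypothesis q_neq0 : q != 0.
Hypothesis opP : Uq_module00 q op.
Local Notation k i := (op (Qk i)).
Local Notation kv i := (op (Qkinv i)).
Local Notation e i := (op (Qe i)).
Local Notation f i := (op (Qf i)).

Let opL := um_lin opP.

Lemma qinv_cancel (m : int) : q ^ (- m) * q ^ m = 1.
Proof. by rewrite -expfzDr // addNr expr0z. Qed.

Lemma um_kvq (o : X -> X) i m x : linear o ->
  (forall y, k i (o y) = q ^ m *: o (k i y)) ->
  kv i (o x) = q ^ (- m) *: o (kv i x).
Proof.
move=> oL ho; have := congr1 (kv i) (ho (kv i x)).
rewrite (um_kvk opP) (um_kkv opP) (linear_scale _ (opL _)) => ->.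
by rewrite scalerA qinv_cancel scale1r.
Qed.

Lemma um_kve i j x : kv i (e j x) = q ^ (- root_pairing i j) *: e j (kv i x).
Proof. by apply: um_kvq => //; exact: (um_ke opP). Qed.

Lemma um_kvf i j x : kv i (f j x) = q ^ (root_pairing i j) *: f j (kv i x).
Proof.
rewrite -[root_pairing i j in RHS]opprK; apply: um_kvq => //; exact: (um_kf opP).
Qed.

Lemma um_kvk_comm i j x : kv i (k j x) = k j (kv i x).
Proof.
have := @um_kvq (k j) i 0 x (opL _); rewrite oppr0 expr0z scale1r; apply => y.
by rewrite scale1r; exact: (um_kk opP).
Qed.

Definition bigK (i : 'I_n) x := k (lo i) (kv (up i) x).
Definition bigKv (i : 'I_n) x := kv (lo i) (k (up i) x).

Lemma bigKvL i : linear (bigKv i).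
Proof. by apply: linear_comp; apply: opL. Qed.

Lemma bigK_e i j x : bigK i (e j x) = q ^ cartan_int i j *: e j (bigK i x).
Proof.
rewrite /bigK um_kve (linear_scale _ (opL _)) (um_ke opP) scalerA.
by rewrite -expfzDr // addrC.
Qed.

Lemma bigKv_e i j x : bigKv i (e j x) = q ^ (- cartan_int i j) *: e j (bigKv i x).
Proof.
rewrite /bigKv (um_ke opP) (linear_scale _ (opL _)) um_kve scalerA.
by rewrite -expfzDr // opp_cartan_int.
Qed.

Lemma bigK_f i j x : bigK i (f j x) = q ^ (- cartan_int i j) *: f j (bigK i x).
Proof.
rewrite /bigK um_kvf (linear_scale _ (opL _)) (um_kf opP) scalerA.
by rewrite -expfzDr // opp_cartan_int addrC.
Qed.

Lemma bigKv_f i j x : bigKv i (f j x) = q ^ cartan_int i j *: f j (bigKv i x).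
Proof.
rewrite /bigKv (um_kf opP) (linear_scale _ (opL _)) um_kvf scalerA.
by rewrite -expfzDr // addrC.
Qed.

End UqModuleTheory.

(** * Tensor product of a module with the vector representation *)

Section UqTensor.
Variables (K : fieldType) (n : nat) (q : K) (X : lmodType K).
Variable op : qgen n -> X -> X.
Hypothesis q_neq0 : q != 0.
Hypothesis qq_neq0 : q - q^-1 != 0.
Hypothesis opP : Uq_module q op.
Local Notation V := (@Uq_vector K n q).
Local Notation KV i := (V (Qk (lo i)) *m V (Qkinv (up i))).
Let op0 : Uq_module0 q op := um_0 opP.
Let op00 : Uq_module00 q op := um_00 op0.
Let opL := um_lin op0.

(** The action of [verma_tens_act], for an arbitrary family of operators in place of a Verma
    module. *)
Definition tens_op (g : qgen n) (x : {ffun 'I_n.+1 -> X}) : {ffun 'I_n.+1 -> X} :=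
  \sum_(c <- @Uq_cop n g) op_tens (wact op c.1) (rep_word (U := Uqc n q id) V c.2) x.

Lemma tens_op_e i x : tens_op (Qe i) x =
  op_tens (op (Qe i)) (KV i) x + op_tens id (V (Qe i)) x.
Proof.
by rewrite /tens_op big_cons big_seq1; congr (_ + _); apply: eq_op_tens => //;
  rewrite [LHS]/= ?mulmx1.
Qed.

Lemma tens_op_f i x : tens_op (Qf i) x =
  op_tens (op (Qf i)) 1%:M x + op_tens (bigKv op i) (V (Qf i)) x.
Proof.
by rewrite /tens_op big_cons big_seq1; congr (_ + _); apply: eq_op_tens => //;
  rewrite [LHS]/= ?mulmx1.
Qed.

Lemma tens_op_k i x : tens_op (Qk i) x = op_tens (op (Qk i)) (V (Qk i)) x.
Proof. by rewrite /tens_op big_seq1; apply: eq_op_tens => //; rewrite [LHS]/= ?mulmx1. Qed.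

Lemma tens_op_kv i x :
  tens_op (Qkinv i) x = op_tens (op (Qkinv i)) (V (Qkinv i)) x.
Proof. by rewrite /tens_op big_seq1; apply: eq_op_tens => //; rewrite [LHS]/= ?mulmx1. Qed.

Lemma tens_opL g : linear (tens_op g).
Proof.
move=> c x y; rewrite /tens_op scaler_sumr -big_split /=.
by apply: eq_bigr => -[w1 w2] _; apply: op_tensL; apply: wactL.
Qed.

Lemma KV_e i j : KV i *m V (Qe j) = q ^ cartan_int i j *: (V (Qe j) *m KV i).
Proof.
rewrite -mulmxA (Vkve q_neq0) -scalemxAr !mulmxA (Vke q_neq0) -scalemxAl scalerA.
by rewrite -expfzDr // addrC.
Qed.

Lemma KV_f i j : KV i *m V (Qf j) = q ^ (- cartan_int i j) *: (V (Qf j) *m KV i).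
Proof.
rewrite -mulmxA (Vkvf q_neq0) -scalemxAr !mulmxA (Vkf q_neq0) -scalemxAl scalerA.
by rewrite -expfzDr // opp_cartan_int addrC.
Qed.

Lemma KV_comm i j : KV i *m KV j = KV j *m KV i.
Proof. by rewrite /= !mulmx_diag; congr diag_mx; apply/rowP => a; rewrite !mxE mulrC. Qed.

Local Notation tA i := (op_tens (op (Qe i)) (KV i)).
Local Notation tB i := (op_tens (@id X) (V (Qe i))).
Local Notation tC i := (op_tens (op (Qf i)) (1%:M : 'M[K]_n.+1)).
Local Notation tD i := (op_tens (bigKv op i) (V (Qf i))).

Let tAL i : linear (tA i). Proof. by apply: op_tensL. Qed.
Let tBL i : linear (tB i). Proof. by apply: op_tensL. Qed.
Let tCL i : linear (tC i). Proof. by apply: op_tensL. Qed.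
Let tDL i : linear (tD i). Proof. by apply: op_tensL; apply: bigKvL op0 _. Qed.

Lemma tAB i j x : tA i (tB j x) = q ^ cartan_int i j *: tB j (tA i x).
Proof.
rewrite !op_tens_comp // KV_e op_tens_mulZ.
by congr (_ *: _); apply: eq_op_tens.
Qed.

Lemma tDC i j x : tD i (tC j x) = q ^ cartan_int i j *: tC j (tD i x).
Proof.
rewrite !op_tens_comp //; last exact: bigKvL op0 _.
rewrite mulmx1 mul1mx; apply: op_tens_opZ => y /=.
exact: bigKv_f.
Qed.

Lemma tAD i j x : tA i (tD j x) = tD j (tA i x).
Proof.
rewrite !op_tens_comp //; last exact: bigKvL op0 _.
rewrite KV_f op_tens_mulZ cartan_intC; apply/esym; apply: op_tens_opZ => y /=.
exact: bigKv_e.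
Qed.

Let tens_eE i x : tens_op (Qe i) x = tA i x + tB i x.
Proof. exact: tens_op_e. Qed.
Let tens_fE i x : tens_op (Qf i) x = tC i x + tD i x.
Proof. exact: tens_op_f. Qed.

Let VeeE (i j : 'I_n) : (i.+1 < j)%N || (j.+1 < i)%N -> V (Qe i) *m V (Qe j) = 0.
Proof. by move=> ij; apply: (@Vee K n q); lia. Qed.
Let VffE (i j : 'I_n) : (i.+1 < j)%N || (j.+1 < i)%N -> V (Qf i) *m V (Qf j) = 0.
Proof. by move=> ij; apply: (@Vff K n q); lia. Qed.

(** Write e_i = A + B and f_j = C + D with A = e_i (x) K_i, B = 1 (x) e_i, C = f_j (x) 1, D = K_j^-1
    (x) f_j. B commutes with C, and A with D because both orders produce the same power of q. There
    remains [e_i, f_j] (x) K_i + K_j^-1 (x) [e_i, f_j]. *)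
Lemma tens_ef i j x : tens_op (Qe i) (tens_op (Qf j) x) =
  tens_op (Qf j) (tens_op (Qe i) x) +
  (op_tens (fun y => op (Qe i) (op (Qf j) y) - op (Qf j) (op (Qe i) y)) (KV i) x +
   op_tens (bigKv op j) (V (Qe i) *m V (Qf j) - V (Qf j) *m V (Qe i)) x).
Proof.
have AC : tA i (tC j x) = tC j (tA i x) +
    op_tens (fun y => op (Qe i) (op (Qf j) y) - op (Qf j) (op (Qe i) y)) (KV i) x.
  rewrite !op_tens_comp // mulmx1 mul1mx -(@op_tens_opD _ _ _ _ _ (op (Qe i) \o op (Qf j))) //.
  by move=> y /=; rewrite addrC subrK.
have BD : tB i (tD j x) = tD j (tB i x) +
    op_tens (bigKv op j) (V (Qe i) *m V (Qf j) - V (Qf j) *m V (Qe i)) x.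
  rewrite !op_tens_comp //; last exact: bigKvL op0 _.
  rewrite -[_ \o id]/(bigKv op j) -[id \o _]/(bigKv op j).
  by rewrite -op_tens_mulD addrC subrK.
have BC : tB i (tC j x) = tC j (tB i x).
  by rewrite !op_tens_comp // mulmx1 mul1mx.
rewrite !tens_eE !tens_fE (linear_add (tAL i)) (linear_add (tBL i)).
rewrite (linear_add (tCL j)) (linear_add (tDL j)) AC BD BC tAD.
lmod K {ffun 'I_n.+1 -> X}; ring.
Qed.

(** Commuting matrices give the three Serre monomials the same matrix factor. *)
Lemma op_tens_serre (f1 f2 : X -> X) (B1 B2 : 'M[K]_n.+1) x :
  linear f1 -> linear f2 -> B1 *m B2 = B2 *m B1 ->
  serre q (op_tens f1 B1) (op_tens f2 B2) x =
  op_tens (serre q f1 f2) (B1 *m (B1 *m B2)) x.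
Proof.
move=> f1L f2L hB; rewrite /serre !op_tens_comp //; try exact: linear_comp.
have -> : B2 *m B1 *m B1 = B1 *m (B1 *m B2) by rewrite -hB -mulmxA -hB.
have -> : B1 *m B2 *m B1 = B1 *m (B1 *m B2) by rewrite -mulmxA -hB.
rewrite -[B1 *m B1 *m B2]mulmxA.
apply/ffunP => b; rewrite !ffunE scaler_sumr -sumrB -big_split.
by apply: eq_bigr => c _ /=; lmod K X; ring.
Qed.

(** Each of the three monomials contains B1 B1 or equals B1 B2 B1. This covers the generators of the
    vector representation, where both products vanish. *)
Lemma op_tens_serre0 (f1 f2 : X -> X) (B1 B2 : 'M[K]_n.+1) x :
  linear f1 -> linear f2 -> B1 *m B1 = 0 -> B1 *m B2 *m B1 = 0 ->
  serre q (op_tens f1 B1) (op_tens f2 B2) x = 0.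
Proof.
move=> f1L f2L h1 h2; rewrite /serre !op_tens_comp //; try exact: linear_comp.
by rewrite -[B2 *m B1 *m B1]mulmxA h1 h2 mul0mx mulmx0 !op_tens0 scaler0 subr0 addr0.
Qed.

(** The coproduct respects the relations. Each e_i, and each f_i, is a sum of two operators that
    commute up to the power of q given by the Cartan matrix, and each relation is checked on the two
    kinds of summands separately. *)
Lemma tens_Uq_module : Uq_module q tens_op.
Proof.
split; [split; [split|..]|..].
- exact: tens_opL.
- move=> i j x; rewrite !tens_op_k !op_tens_comp //.
  by apply: eq_op_tens; [exact: (um_kk op0)|exact: Vkk].
- move=> i x; rewrite tens_op_kv tens_op_k op_tens_comp // Vkkv //.
  by apply/ffunP => b; rewrite op_tens1 /= (um_kkv op0).
- move=> i x; rewrite tens_op_kv tens_op_k op_tens_comp // -Vkkv_comm Vkkv //.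
  by apply/ffunP => b; rewrite op_tens1 /= (um_kvk op0).
- move=> i j x; rewrite !tens_op_k !tens_eE.
  rewrite (linear_add (op_tensL _ (opL _))) scalerDr !op_tens_comp //; congr (_ + _).
    rewrite [V (Qk i) *m (_ *m _)](_ : _ = KV j *m V (Qk i)); last first.
      rewrite mulmxA (Vkk _ i) -!mulmxA (Vkkv_comm _ i) //.
    apply: op_tens_opZ => y /=; exact: (um_ke op0).
  by rewrite Vke // op_tens_mulZ; congr (_ *: _); apply: eq_op_tens.
- move=> i j x; rewrite !tens_op_k !tens_fE.
  rewrite (linear_add (op_tensL _ (opL _))) scalerDr !op_tens_comp //; last first.
    exact: bigKvL op0 _.
  congr (_ + _).
    rewrite mulmx1 mul1mx; apply: op_tens_opZ => y /=; exact: (um_kf op0).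
  rewrite Vkf // op_tens_mulZ; congr (_ *: _); apply: eq_op_tens => // y /=.
  by rewrite /bigKv -(um_kvk_comm q_neq0 op0) (um_kk op0).
(* The identity K (x) K - K' (x) K' = (K - K') (x) K + K' (x) (K - K'), with K' the inverse of K. *)
- move=> i x; rewrite tens_ef; congr (_ + _).
  rewrite !(tens_op_k, tens_op_kv) !op_tens_comp //.
  rewrite Vef_comm // op_tens_mulZ op_tens_mulD.
  rewrite (@op_tens_opZ _ _ _ (fun y => bigK op i y - bigKv op i y) _ (q - q^-1)^-1); last first.
    by move=> y; rewrite (um_ef op0) addrAC subrr add0r.
  rewrite (@op_tens_opD _ _ _ (bigK op i) (fun y => - bigKv op i y)) //.
  rewrite (@op_tens_opZ _ _ _ (bigKv op i) (fun y => - bigKv op i y) (-1)); last first.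
    by move=> y; rewrite scaleN1r.
  rewrite -[- (V (Qkinv (lo i)) *m _)]scaleN1r op_tens_mulZ.
  rewrite -[op (Qk (lo i)) \o _]/(bigK op i) -[op (Qkinv (lo i)) \o _]/(bigKv op i).
  lmod K {ffun 'I_n.+1 -> X}; ring.
- move=> i j x ij; rewrite tens_ef Vef Vfe (negbTE ij) !scale0r subrr op_tens0 addr0.
  by rewrite op_tens_op0 ?addr0 // => y; rewrite (um_ef_neq op0) // subrr.
- move=> i j x ij; rewrite !tens_eE (linear_add (tAL i)) (linear_add (tAL j)).
  rewrite (linear_add (tBL i)) (linear_add (tBL j)) !tAB.
  rewrite [cartan_int j i]cartan_intC cartan_int_far ?ij // expr0z !scale1r.
  have -> : tA i (tA j x) = tA j (tA i x).
    rewrite !op_tens_comp //; apply: eq_op_tens; last exact: KV_comm.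
    by move=> y /=; apply: (um_ee op0).
  have -> : tB i (tB j x) = tB j (tB i x).
    by rewrite !op_tens_comp // !VeeE ?ij ?orbT // !op_tens0.
  lmod K {ffun 'I_n.+1 -> X}; ring.
- move=> i j x ij.
  have cii : q ^ cartan_int i i = q ^+ 2 by rewrite cartan_intE eqxx.
  have cij : q ^ cartan_int i j = q^-1 by rewrite cartan_int_near // exprN1.
  have cji : q ^ cartan_int j i = q^-1 by rewrite cartan_intC.
  apply: (serre_add (A1 := tA i) (A2 := tA j) (B1 := tB i) (B2 := tB j)) => //.
  + by move=> y; rewrite tAB cii.
  + by move=> y; rewrite tAB cij.
  + by move=> y; rewrite tAB cji.
  + rewrite op_tens_serre; [|exact: opL|exact: opL|exact: KV_comm].
    by apply: op_tens_op0 => y; exact: (um_se op0).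
  + apply: op_tens_serre0 => //; first by apply: (@Vee K n q); lia.
    case/orP: ij => /eqP ij; last by rewrite [_ *m V (Qe j)](@Vee K n q) ?mul0mx //; lia.
    by rewrite -mulmxA [V (Qe j) *m _](@Vee K n q) ?mulmx0 //; lia.
- move=> i j x ij; rewrite !tens_fE (linear_add (tCL i)) (linear_add (tCL j)).
  rewrite (linear_add (tDL i)) (linear_add (tDL j)) !tDC.
  rewrite [cartan_int j i]cartan_intC cartan_int_far ?ij // expr0z !scale1r.
  have -> : tC i (tC j x) = tC j (tC i x).
    rewrite !op_tens_comp //; apply: eq_op_tens => // y /=.
    exact: (um_ff opP).
  have -> : tD i (tD j x) = tD j (tD i x).
    rewrite !op_tens_comp //; try exact: bigKvL op0 _.
    by rewrite !VffE ?ij ?orbT // !op_tens0.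
  lmod K {ffun 'I_n.+1 -> X}; ring.
move=> i j x ij.
have cii : q ^ cartan_int i i = q ^+ 2 by rewrite cartan_intE eqxx.
have cij : q ^ cartan_int i j = q^-1 by rewrite cartan_int_near // exprN1.
have cji : q ^ cartan_int j i = q^-1 by rewrite cartan_intC.
(* For the f_i the summand K_i^-1 (x) f_i takes the role of A: it is the one whose passage to the
   right of the other yields q to the Cartan integer. *)
apply: (serre_add (A1 := tD i) (A2 := tD j) (B1 := tC i) (B2 := tC j)) => //.
- by move=> y; rewrite tDC cii.
- by move=> y; rewrite tDC cij.
- by move=> y; rewrite tDC cji.
- by move=> y; rewrite tens_fE addrC.
- by move=> y; rewrite tens_fE addrC.
- apply: op_tens_serre0; try exact: bigKvL op0 _.
    by apply: (@Vff K n q); lia.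
  case/orP: ij => /eqP ij; first by rewrite [_ *m V (Qf j)](@Vff K n q) ?mul0mx //; lia.
  by rewrite -mulmxA [V (Qf j) *m _](@Vff K n q) ?mulmx0 //; lia.
- rewrite op_tens_serre; [|exact: opL|exact: opL|by []].
  by apply: op_tens_op0 => y; exact: (um_sf opP).
Qed.

End UqTensor.

(* Instantiated both with the e_i against the f_i and conversely. *)
Section Ladder.
Variables (K : fieldType) (n : nat) (q c : K) (X : lmodType K).
Variables (A B D D' : 'I_n -> X -> X).
Hypothesis q_neq0 : q != 0.
Hypothesis AL : forall i, linear (A i).
Hypothesis BL : forall i, linear (B i).
Hypothesis AB : forall i j x,
  A i (B j x) = B j (A i x) + (i == j)%:R *: (c *: (D i x - D' i x)).
Hypothesis DA : forall i j x, D i (A j x) = q ^ cartan_int i j *: A j (D i x).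
Hypothesis DA' : forall i j x,
  D' i (A j x) = q ^ (- cartan_int i j) *: A j (D' i x).

Let AB_eq i x : A i (B i x) = B i (A i x) + c *: (D i x - D' i x).
Proof. by rewrite AB eqxx scale1r. Qed.

Let AB_neq i j x : i != j -> A i (B j x) = B j (A i x).
Proof. by rewrite AB => /negbTE ->; rewrite scale0r addr0. Qed.

Let linA i := (linear_sub (AL i), linear_add (AL i), linear_opp (AL i),
  fun a => linear_scale a (AL i)).
Let linB i := (linear_sub (BL i), linear_add (BL i), linear_opp (BL i),
  fun a => linear_scale a (BL i)).

(** Only l = i and l = j produce Cartan terms, and these commute with the remaining [A] because the
    Cartan integer of i and j is 0. *)
Lemma ladder_comm (i j l : 'I_n) x : (i.+1 < j)%N ->
  A i (A j (B l x)) - A j (A i (B l x)) = B l (A i (A j x) - A j (A i x)).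
Proof.
move=> ij; have nij : i != j by apply/eqP => h; rewrite h in ij; lia.
have cij : cartan_int i j = 0 by rewrite cartan_int_far // ij.
have cji : cartan_int j i = 0 by rewrite cartan_intC.
have Aij y : A i (B j y) = B j (A i y) by apply: AB_neq.
have Aji y : A j (B i y) = B i (A j y) by apply: AB_neq; rewrite eq_sym.
have [->|li] := eqVneq l i.
  do 3 rewrite ?(Aji, AB_eq, linA, linB).
  by rewrite DA DA' cij oppr0 expr0z; lmod K X; ring.
have [->|lj] := eqVneq l j.
  do 3 rewrite ?(Aij, AB_eq, linA, linB).
  by rewrite DA DA' cji oppr0 expr0z; lmod K X; ring.
by rewrite !AB_neq 1?eq_sym // linB.
Qed.

(** Only l = i and l = j produce Cartan terms. Once these act first, their coefficients cancel, by
    the Cartan integers 2 and -1 in the first case and -1 in the second. *)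
Lemma ladder_serre (i j l : 'I_n) x : (i.+1 == j) || (j.+1 == i) ->
  serre q (A i) (A j) (B l x) = B l (serre q (A i) (A j) x).
Proof.
move=> ij; have nij : i != j by apply/eqP => h; rewrite h in ij; lia.
have cii : cartan_int i i = 2 by rewrite cartan_intE eqxx.
have cij : cartan_int i j = -1 by rewrite cartan_int_near.
have cji : cartan_int j i = -1 by rewrite cartan_intC.
have Aij y : A i (B j y) = B j (A i y) by apply: AB_neq.
have Aji y : A j (B i y) = B i (A j y) by apply: AB_neq; rewrite eq_sym.
rewrite /serre; have [->|li] := eqVneq l i.
  do 4 rewrite ?(Aji, AB_eq, linA, linB).
  do 3 rewrite ?(DA, DA', linA); rewrite cii cij opprK expr1z exprN1 -!invr_expz.
  by rewrite -!exprnP; lmod K X; field.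
have [->|lj] := eqVneq l j.
  do 4 rewrite ?(Aij, AB_eq, linA, linB).
  do 3 rewrite ?(DA, DA', linA); rewrite cji opprK expr1z exprN1.
  by lmod K X; field.
by rewrite !AB_neq 1?eq_sym // !linB.
Qed.

End Ladder.

Section UqCommutators.
Variables (K : fieldType) (n : nat) (q : K) (X : lmodType K).
Variable op : qgen n -> X -> X.
Hypothesis q_neq0 : q != 0.
Hypothesis opP : Uq_module00 q op.
Local Notation e i := (op (Qe i)).
Local Notation f i := (op (Qf i)).
Let opL := um_lin opP.
Let c := (q - q^-1)^-1.

Lemma um_efE i j x : e i (f j x) =
  f j (e i x) + (i == j)%:R *: (c *: (bigK op i x - bigKv op i x)).
Proof.
have [->|ij] := eqVneq i j; first by rewrite scale1r (um_ef opP).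
by rewrite scale0r addr0 (um_ef_neq opP).
Qed.

Let um_feE i j x : f i (e j x) =
  e j (f i x) + (i == j)%:R *: (c *: (bigKv op i x - bigK op i x)).
Proof.
rewrite um_efE eq_sym; case: eqP => [->|_]; lmod K X; ring.
Qed.

Lemma ee_comm_f (i j l : 'I_n) x : (i.+1 < j)%N ->
  e i (e j (f l x)) - e j (e i (f l x)) = f l (e i (e j x) - e j (e i x)).
Proof.
apply: (@ladder_comm K n q c X (fun i => e i) (fun i => f i) (bigK op) (bigKv op)) => //.
- exact: um_efE.
- exact: bigK_e.
- exact: bigKv_e.
Qed.

Lemma serre_e_f (i j l : 'I_n) x : (i.+1 == j) || (j.+1 == i) ->
  serre q (e i) (e j) (f l x) = f l (serre q (e i) (e j) x).
Proof.
apply: (@ladder_serre K n q c X (fun i => e i) (fun i => f i) (bigK op) (bigKv op)) => //.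
- exact: um_efE.
- exact: bigK_e.
- exact: bigKv_e.
Qed.

Lemma ff_comm_e (i j l : 'I_n) x : (i.+1 < j)%N ->
  e l (f i (f j x) - f j (f i x)) = f i (f j (e l x)) - f j (f i (e l x)).
Proof.
move=> ij; apply/esym; move: ij.
apply: (@ladder_comm K n q c X (fun i => f i) (fun i => e i) (bigKv op) (bigK op)) => //.
- exact: bigKv_f.
- exact: bigK_f.
Qed.

Lemma e_serre_f (i j l : 'I_n) x : (i.+1 == j) || (j.+1 == i) ->
  e l (serre q (f i) (f j) x) = serre q (f i) (f j) (e l x).
Proof.
move=> ij; apply/esym; move: ij.
apply: (@ladder_serre K n q c X (fun i => f i) (fun i => e i) (bigKv op) (bigK op)) => //.
- exact: bigKv_f.
- exact: bigK_f.
Qed.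

Lemma serre_weight (o : X -> X) (i j : 'I_n) a b x : linear o ->
  (forall y, o (f i y) = a *: f i (o y)) ->
  (forall y, o (f j y) = b *: f j (o y)) ->
  o (serre q (f i) (f j) x) = (a * a * b) *: serre q (f i) (f j) (o x).
Proof.
move=> oL hi hj; rewrite /serre !(linear_sub oL, linear_add oL, linear_opp oL, linear_scale _ oL).
do 4 rewrite ?(hi, hj, linear_scale _ (opL _)).
by lmod K X; ring.
Qed.

Lemma ff_weight (o : X -> X) (i j : 'I_n) a b x : linear o ->
  (forall y, o (f i y) = a *: f i (o y)) ->
  (forall y, o (f j y) = b *: f j (o y)) ->
  o (f i (f j x) - f j (f i x)) =
    (a * b) *: (f i (f j (o x)) - f j (f i (o x))).
Proof.
move=> oL hi hj; rewrite !(linear_sub oL).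
do 3 rewrite ?(hi, hj, linear_scale _ (opL _)).
by lmod K X; ring.
Qed.

End UqCommutators.

(** The span of the [b w] is expressed as the intersection of all subspaces [Q] containing them; it
    is everything as soon as each generator maps each [b w] into it. *)
Lemma verma_span (K : fieldType) n (U : hopf_pres K n) lam (W : Type)
    (b : W -> verma U lam) w0 : hw U lam = b w0 ->
  (forall g w (Q : verma U lam -> Prop), Q 0 ->
     (forall x y, Q x -> Q y -> Q (x + y)) -> (forall c x, Q x -> Q (c *: x)) ->
     (forall w', Q (b w')) -> Q (vact (letter K g) (b w))) ->
  forall Q : verma U lam -> Prop, Q 0 ->
     (forall x y, Q x -> Q y -> Q (x + y)) -> (forall c x, Q x -> Q (c *: x)) ->
     (forall w', Q (b w')) -> forall x, Q x.
Proof.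
move=> hb hg Q Q0 QD QZ Qb x.
pose P (y : verma U lam) := forall Q : verma U lam -> Prop, Q 0 ->
  (forall x y, Q x -> Q y -> Q (x + y)) -> (forall c x, Q x -> Q (c *: x)) ->
  (forall w', Q (b w')) -> Q y.
suff: P x by apply.
move: x; apply: verma_ind.
- by move=> R R0.
- by move=> x y hx hy R R0 RD RZ Rb; apply: (RD); [apply: hx|apply: hy].
- by move=> c x hx R R0 RD RZ Rb; apply: (RZ); apply: hx.
- by move=> R R0 RD RZ Rb; rewrite hb.
move=> g x hx R R0 RD RZ Rb; have gL := vactL (lam := lam) (letter K g).
apply: (hx (fun y => R (vact (letter K g) y))).
- by rewrite (linear_zero gL).
- by move=> y z hy hz; rewrite (linear_add gL); apply: RD.
- by move=> c y hy; rewrite (linear_scale _ gL); apply: RZ.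
- by move=> w; apply: hg.
Qed.

(** * The functional on quantum Verma modules, from a module of words *)

Section KWeight.
Variables (K : fieldType) (n : nat) (q : K) (ka : 'I_n.+1 -> K).
Hypothesis q_neq0 : q != 0.
Hypothesis ka_neq0 : forall i, ka i != 0.

(** The eigenvalue of k_i on f_w v, where k_i v = [ka i] v. *)
Definition kwt (i : 'I_n.+1) (w : seq 'I_n) : K :=
  foldr (fun j c => q ^ (- root_pairing i j) * c) (ka i) w.

Lemma kwt_neq0 i w : kwt i w != 0.
Proof. by elim: w => //= j w IH; rewrite mulf_neq0 // expfz_neq0. Qed.

Section Span.
Variables (X : lmodType K) (op : qgen n -> X -> X) (v : X).
Hypothesis opP : Uq_module00 q op.
Hypothesis e_v : forall i, op (Qe i) v = 0.
Hypothesis k_v : forall i, op (Qk i) v = ka i *: v.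
Let opL := um_lin opP.

Definition fwd (w : seq 'I_n) : X := foldr (fun j => op (Qf j)) v w.

Lemma k_fwd i w : op (Qk i) (fwd w) = kwt i w *: fwd w.
Proof.
elim: w => //= j w IH.
by rewrite (um_kf opP) IH (linear_scale _ (opL _)) scalerA.
Qed.

Lemma kv_fwd i w : op (Qkinv i) (fwd w) = (kwt i w)^-1 *: fwd w.
Proof.
rewrite -[fwd w in RHS](um_kvk opP i) k_fwd (linear_scale _ (opL _)) scalerA.
by rewrite mulVf ?scale1r // kwt_neq0.
Qed.

(** The k_i act on f_w v by scalars, and e_i moves to the right through the f's, leaving Cartan
    terms at the letters equal to i. *)
Lemma Uq_span g w (Q : X -> Prop) : Q 0 ->
  (forall x y, Q x -> Q y -> Q (x + y)) -> (forall c x, Q x -> Q (c *: x)) ->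
  (forall w', Q (fwd w')) -> Q (op g (fwd w)).
Proof.
move=> Q0 QD QZ Qb; case: g => i.
- elim: w Q Q0 QD QZ Qb => [|j w IH] Q Q0 QD QZ Qb; first by rewrite /= e_v.
  rewrite /= (um_efE opP); apply: (QD).
    apply: (IH (fun x => Q (op (Qf j) x))).
    + by rewrite (linear_zero (opL _)).
    + by move=> x y hx hy; rewrite (linear_add (opL _)); apply: QD.
    + by move=> c x hx; rewrite (linear_scale _ (opL _)); apply: QZ.
    + by move=> w'; apply: (Qb (j :: w')).
  rewrite -/(fwd w) /bigK /bigKv kv_fwd k_fwd !(linear_scale _ (opL _)).
  rewrite k_fwd kv_fwd !scalerA -scalerBl; do 2 apply: (QZ); exact: Qb.
- exact: (Qb (i :: w)).
- by rewrite k_fwd; apply: QZ.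
- by rewrite kv_fwd; apply: QZ.
Qed.

End Span.

Section WordModule.
(* The vector [y] stands for the sum of the [y w] f_w v over the words [w]. *)
Local Notation X := (seq 'I_n -> K^o).

(** The eigenvalue on f_w v of (K_i - K_i^-1) / (q - q^-1), the commutator of e_i and f_i. *)
Definition hval (i : 'I_n) w : K := (q - q^-1)^-1 *
  (kwt (lo i) w / kwt (up i) w - (kwt (lo i) w)^-1 * kwt (up i) w).

(** e_i deletes one letter i from a word, with factor [hval] of the suffix behind it. Read on
    coefficients, this is a sum over all ways of inserting i into w. *)
Fixpoint word_e (i : 'I_n) (w : seq 'I_n) (y : seq 'I_n -> K) : K :=
  hval i w * y (i :: w) +
  if w is j :: w' then word_e i w' (fun u => y (j :: u)) else 0.

(** Arbitrary functions, that is infinite sums, are allowed: each coefficient of the image involves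
    only finitely many coefficients of [y]. *)
Definition word_op (g : qgen n) (y : X) : X := fun w =>
  match g with
  | Qe i => word_e i w y
  | Qf i => if w is j :: w' then (i == j)%:R * (y w' : K) else 0
  | Qk i => kwt i w * (y w : K)
  | Qkinv i => (kwt i w)^-1 * (y w : K)
  end.

Definition word_hw : X := fun w => (w == [::])%:R.

Lemma word_e_linear i w a (y z : seq 'I_n -> K) :
  word_e i w (fun u => a * y u + z u) = a * word_e i w y + word_e i w z.
Proof.
elim: w y z => [|j w IH] y z /=; first by ring.
by rewrite (IH (fun u => y (j :: u))); ring.
Qed.

Lemma word_opL g : linear (word_op g).
Proof.
move=> a y z; apply/funext => w; case: g => i.
- exact: word_e_linear.
- case: w => [|l w].
    apply: esym; apply: etrans (addr0 (a * 0 : K)) (mulr0 a).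
  have h : (i == l)%:R * (a * (y w : K) + (z w : K)) =
    a * ((i == l)%:R * (y w : K)) + (i == l)%:R * (z w : K) by ring.
  exact: h.
- have h : kwt i w * (a * (y w : K) + (z w : K)) =
    a * (kwt i w * (y w : K)) + kwt i w * (z w : K) by ring.
  exact: h.
- have h : (kwt i w)^-1 * (a * (y w : K) + (z w : K)) =
    a * ((kwt i w)^-1 * (y w : K)) + (kwt i w)^-1 * (z w : K) by ring.
  exact: h.
Qed.

Lemma word_e_scale i w a (y : seq 'I_n -> K) :
  word_e i w (fun u => a * y u) = a * word_e i w y.
Proof.
have := word_e_linear i w a y (fun=> 0).
have -> : word_e i w (fun=> 0) = 0.
  by elim: (w) => /= [|j w' ->]; rewrite mulr0 addr0.
rewrite addr0 => <-; congr word_e; apply/funext => u; exact/esym/addr0.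
Qed.

Lemma word_ke i j w (y : seq 'I_n -> K) :
  word_e j w (fun u => kwt i u * y u) =
  q ^ (- root_pairing i j) * kwt i w * word_e j w y.
Proof.
elim: w y => [|l w IH] y /=; first by rewrite !addr0; ring.
rewrite [X in _ + X](_ : _ = q ^ (- root_pairing i l) *
    word_e j w (fun u => kwt i u * y (l :: u))).
  by rewrite IH; ring.
rewrite -word_e_scale; congr word_e; apply/funext => u; exact: esym (mulrA _ _ _).
Qed.

Lemma word_ef i j w (y : seq 'I_n -> K) :
  word_e i w (fun u => if u is l :: u' then (j == l)%:R * y u' else 0) =
  (if w is l :: w' then (j == l)%:R * word_e i w' y else 0) +
  (i == j)%:R * (hval i w * y w).
Proof.
rewrite [i == j]eq_sym.
case: w => [|l w] /=; first by rewrite addr0 add0r; ring.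
by rewrite word_e_scale; ring.
Qed.

Lemma word_module00 : Uq_module00 q word_op.
Proof.
split.
- exact: word_opL.
- by move=> i j y; apply/funext => w; exact: mulrCA.
- by move=> i y; apply/funext => w; apply: mulVKf; exact: kwt_neq0.
- by move=> i y; apply/funext => w; apply: mulKf; exact: kwt_neq0.
- move=> i j y; apply/funext => w.
  have h : kwt i w * word_e j w y = q ^ root_pairing i j *
      word_e j w (fun u => kwt i u * (y u : K)).
    by rewrite word_ke !mulrA [q ^ _ * _]mulrC qinv_cancel // mul1r.
  exact: h.
- move=> i j y; apply/funext => w; case: w => [|l w].
    by exact: etrans (mulr0 (kwt i [::])) (esym (mulr0 _)).
  have h : kwt i (l :: w) * ((j == l)%:R * (y w : K)) =
      q ^ (- root_pairing i j) * ((j == l)%:R * (kwt i w * (y w : K))).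
    rewrite /=; have [->|_] := eqVneq j l; rewrite ?mulr0n ?mulr1n; ring.
  exact: h.
- move=> i y; apply/funext => w.
  have h : word_e i w (fun u => if u is l :: u' then (i == l)%:R * (y u' : K) else 0) =
    (if w is l :: w' then (i == l)%:R * word_e i w' y else 0) +
    (q - q^-1)^-1 * (kwt (lo i) w * ((kwt (up i) w)^-1 * (y w : K)) -
      (kwt (lo i) w)^-1 * (kwt (up i) w * (y w : K))).
    rewrite word_ef eqxx mul1r /hval; congr (_ + _); ring.
  exact: h.
- move=> i j y ij; apply/funext => w.
  have h : word_e i w (fun u => if u is l :: u' then (j == l)%:R * (y u' : K) else 0) =
    (if w is l :: w' then (j == l)%:R * word_e i w' y else 0).
    by rewrite word_ef (negbTE ij) mul0r addr0.
  exact: h.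
Qed.

Lemma word_e0 i w : word_e i w (fun=> 0) = 0.
Proof. by elim: w => /= [|j w ->]; rewrite mulr0 addr0. Qed.

Lemma word_e_hw i : word_op (Qe i) word_hw = 0.
Proof.
apply/funext => w; case: w => [|j w]; first exact: etrans (addr0 _) (mulr0 _).
have h : hval i (j :: w) * 0 + word_e i w (fun=> 0) = 0.
  by rewrite word_e0 mulr0 addr0.
exact: h.
Qed.

Lemma word_k_hw i : word_op (Qk i) word_hw = ka i *: word_hw.
Proof.
apply/funext => w; case: w => [//|j w].
exact: etrans (mulr0 (kwt i (j :: w))) (esym (mulr0 (ka i))).
Qed.

Lemma word_decomp (y : X) : y = (y [::] : K) *: word_hw +
  \sum_(l < n) word_op (Qf l) (fun u => y (l :: u)).
Proof.
apply/funext => w.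
have h : (y w : K) = (y [::] : K) * (w == [::])%:R +
    \sum_(l < n) (word_op (Qf l) (fun u => y (l :: u)) w : K).
  case: w => [|l w] /=; first by rewrite mulr1 big1 ?addr0.
  rewrite mulr0 add0r (bigD1 l) //= eqxx mul1r big1 ?addr0 // => l' hl.
  by rewrite (negbTE hl) mul0r.
by apply: etrans h _; congr (_ + _); rewrite fct_sumE.
Qed.

(** Infinite sums are not combinations of the f_w v, so vanishing on these would not suffice.
    Instead coefficients are read letter by letter: by the finite decomposition [word_decomp], the
    coefficient of O y at l :: w is that of O applied to a tail of y at w. *)
Lemma word_op_zero (O : X -> X) y : linear O ->
  (forall l z, O (word_op (Qf l) z) = word_op (Qf l) (O z)) ->
  O word_hw = 0 -> O y = 0.
Proof.
move=> OL Of O0; apply/funext => w; elim: w y => [|l w IH] y.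
  rewrite [y]word_decomp (linear_add OL) (linear_scale _ OL) O0 scaler0 add0r.
  rewrite (lin_sum OL) fct_sumE big1 // => l _.
  by rewrite Of.
rewrite {1}[y]word_decomp (linear_add OL) (linear_scale _ OL) O0 scaler0 add0r.
rewrite (lin_sum OL) fct_sumE big1 // => l' _.
by rewrite Of /= IH; exact: mulr0.
Qed.

(** The Serre expressions in the e_i commute with every f_l and kill the highest weight vector, so
    they act by 0. *)
Lemma word_module0 : Uq_module0 q word_op.
Proof.
have W := word_module00; have L := word_opL.
split=> // [i j y ij|i j y ij].
  apply/eqP; rewrite -subr_eq0; apply/eqP.
  apply: (@word_op_zero (fun y => word_op (Qe i) (word_op (Qe j) y) -
                                  word_op (Qe j) (word_op (Qe i) y))).
  - by move=> a z t; rewrite !L; lmod K (seq 'I_n -> K^o); ring.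
  - by move=> l z; exact: (ee_comm_f q_neq0 W).
  - by rewrite !word_e_hw !(linear_zero (L _)) subr0.
apply: word_op_zero.
- by move=> a z t; rewrite /serre !L; lmod K (seq 'I_n -> K^o); ring.
- by move=> l z; exact: (serre_e_f q_neq0 W).
- by rewrite /serre !word_e_hw !(linear_zero (L _)) scaler0 subr0 addr0.
Qed.

(** The subspace cut out by the relations among the f_i: they are applied to arbitrary vectors and
    the result is closed under further f's, so all two-sided multiples of the relations are
    covered. *)
Inductive f_relation : X -> Prop :=
| f_relation0 : f_relation 0
| f_relationD x y of f_relation x & f_relation y : f_relation (x + y)
| f_relationZ (c : K) x of f_relation x : f_relation (c *: x)
| f_relation_f i x of f_relation x : f_relation (word_op (Qf i) x)
| f_relation_ff (i j : 'I_n) x of (i.+1 < j)%N :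
    f_relation (word_op (Qf i) (word_op (Qf j) x) -
                word_op (Qf j) (word_op (Qf i) x))
| f_relation_sf (i j : 'I_n) x of (i.+1 == j) || (j.+1 == i) :
    f_relation (serre q (word_op (Qf i)) (word_op (Qf j)) x).

(** Every generator is a combination of words of positive length, so the highest weight vector
    survives modulo [f_relation]. *)
Lemma f_relation_coef x : f_relation x -> x [::] = 0.
Proof.
elim=> [//|y z _ hy _ hz|c y _ hy|//|i j y _|i j y _].
- have h : (y [::] : K) + (z [::] : K) = 0 by rewrite hy hz addr0.
  exact: h.
- have h : c * (y [::] : K) = 0 by rewrite hy mulr0.
  exact: h.
- exact: (subrr (0 : K)).
- have h : (0 : K) - (q + q^-1) * 0 + 0 = 0 by rewrite mulr0 subr0 addr0.
  exact: h.
Qed.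

Lemma f_relation_diag (o : X -> X) (s : 'I_n -> K) x : linear o ->
  (forall i y, o (word_op (Qf i) y) = s i *: word_op (Qf i) (o y)) ->
  f_relation x -> f_relation (o x).
Proof.
move=> oL hs; have W := word_module00.
elim=> [|y z _ hy _ hz|c y _ hy|i y _ hy|i j y ij|i j y ij].
- by rewrite (linear_zero oL); exact: f_relation0.
- by rewrite (linear_add oL); apply: f_relationD.
- by rewrite (linear_scale _ oL); apply: f_relationZ.
- by rewrite hs; apply: f_relationZ; apply: f_relation_f.
- rewrite (ff_weight W _ _ (a := s i) (b := s j)) //.
  by apply: f_relationZ; apply: f_relation_ff.
- rewrite (serre_weight W _ _ (a := s i) (b := s j)) //.
  by apply: f_relationZ; apply: f_relation_sf.
Qed.

(** The k_i rescale the relations, and the e_i commute with them, which is the ladder lemma with the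
    roles of e and f exchanged. *)
Lemma f_relation_op g x : f_relation x -> f_relation (word_op g x).
Proof.
have W := word_module00; have L := word_opL.
have hk i y : f_relation y -> f_relation (word_op (Qk i) y).
  by apply: f_relation_diag => // j z; exact: (um_kf W).
have hkv i y : f_relation y -> f_relation (word_op (Qkinv i) y).
  by apply: f_relation_diag => // j z; exact: (um_kvf q_neq0 W).
move=> hx; case: g => [l|l|l|l]; [|exact: f_relation_f|exact: hk|exact: hkv].
elim: hx => [|y z _ hy _ hz|c y _ hy|i y hy' hy|i j y ij|i j y ij].
- by rewrite (linear_zero (L _)); exact: f_relation0.
- by rewrite (linear_add (L _)); apply: f_relationD.
- by rewrite (linear_scale _ (L _)); apply: f_relationZ.
- rewrite (um_efE W); apply: f_relationD; first exact: f_relation_f.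
  do 2 apply: f_relationZ; apply: f_relationD; first by apply/hk/hkv.
  by rewrite -scaleN1r; apply: f_relationZ; apply/hkv/hk.
- by rewrite (ff_comm_e q_neq0 W) //; apply: f_relation_ff.
- by rewrite (e_serre_f q_neq0 W) //; apply: f_relation_sf.
Qed.

End WordModule.
End KWeight.

Section VermaCoordinate.
Variables (K : fieldType) (n : nat) (q : K) (ch : K -> K).
Hypothesis q_neq0 : q != 0.
Hypothesis ch_neq0 : forall a, ch a != 0.
Local Notation U := (Uqc n q ch).
Variable nu : 'I_n.+1 -> K.
Let ka i := ch (nu i).
Let ka_neq0 i : ka i != 0. Proof. exact: ch_neq0. Qed.
Let op := word_op q ka.

(** The functional is the coefficient at the empty word of the image in the word module modulo
    [f_relation]; no f_i contributes to that coefficient. *)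
Lemma uq_verma_coord : exists phi : verma U nu -> K,
  [/\ linear (phi : verma U nu -> K^o), phi (hw U nu) = 1,
     forall i x, phi (vact (@letter K (gen U) (Qf i)) x) = 0,
     forall i x, phi (vact (@letter K (gen U) (Qk i)) x) = ch (nu i) * phi x &
     forall i x, phi (vact (@letter K (gen U) (Qkinv i)) x) = (ch (nu i))^-1 * phi x].
Proof.
have W := word_module00 q_neq0 ka_neq0; have L := word_opL q ka.
have [|||||||||phi phiL phiE] := @verma_univ_mod K n U _ K^o op
  (f_relation q ka) (fun y => y [::]) L _ _ _ _ _ _ _ nu (@word_hw K n).
- exact: f_relation0.
- exact: f_relationD.
- exact: f_relationZ.
- exact: f_relation_op.
- by [].
- exact: f_relation_coef.
- move=> r x; apply: Uq_module_rel_mod.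
  + exact: word_module0.
  + exact: f_relation0.
  + exact: f_relation_ff.
  + exact: f_relation_sf.
- by move=> i; rewrite [op _ _]word_e_hw; exact: f_relation0.
- by move=> i; rewrite [op _ _]word_k_hw subrr; exact: f_relation0.
exists phi; split=> //.
- exact: etrans (phiE 1) (congr1 (fun y => y [::]) (free_act1 op _)).
- move=> i; apply: (lquot_ind_act (h := fun=> 0) phiE) => b.
  exact: (congr1 (fun y => y [::]) (free_act_letterM L (Qf i) b _)).
- move=> i; apply: (lquot_ind_act (h := fun u : K => ch (nu i) * u) phiE) => b.
  exact: (congr1 (fun y => y [::]) (free_act_letterM L (Qk i) b _)).
- move=> i; apply: (lquot_ind_act (h := fun u : K => (ch (nu i))^-1 * u) phiE) => b.
  exact: (congr1 (fun y => y [::]) (free_act_letterM L (Qkinv i) b _)).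
Qed.

End VermaCoordinate.

Lemma wact_morph (K : fieldType) (G : choiceType) (X Y : lmodType K)
    (op : G -> X -> X) (op' : G -> Y -> Y) (Phi : X -> Y) w x :
  (forall g y, Phi (op g y) = op' g (Phi y)) ->
  Phi (wact op w x) = wact op' w (Phi x).
Proof. by move=> h; elim: w => //= g w IH; rewrite /wact /= h [Phi _]IH. Qed.

(** * Composite intertwiners and coassociativity *)

Section Assemble.
Variables (K : fieldType) (M : lmodType K) (m p : nat).
Implicit Types z : 'I_p -> {ffun 'I_m -> M}.

Definition assemble z : {ffun 'I_(m * p) -> M} :=
  [ffun k => z (mxtens_unindex k).2 (mxtens_unindex k).1].

Lemma assembleD z z' :
  assemble (fun b => z b + z' b) = assemble z + assemble z'.
Proof. by apply/ffunP => k; rewrite !ffunE. Qed.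

Lemma eq_assemble z z' : z =1 z' -> assemble z = assemble z'.
Proof. by move=> h; apply/ffunP => k; rewrite !ffunE h. Qed.

Lemma assemble_op_tens f (B : 'M[K]_m) (C : 'M[K]_p) z :
  assemble (fun b => \sum_b' C b b' *: op_tens f B (z b')) =
  op_tens f (B *t C) (assemble z).
Proof.
apply/ffunP => k; rewrite !ffunE sum_ffunE.
under eq_bigr => b' _ do rewrite !ffunE scaler_sumr.
pose h (ab : 'I_m * 'I_p) := mxtens_index ab.
rewrite (reindex h) /=; last first.
  by exists (@mxtens_unindex m p) => x _; [exact: mxtens_indexK|exact: mxtens_unindexK].
rewrite exchange_big pair_bigA /=; apply: eq_bigr => -[a b] _ /=.
by rewrite !mxE ffunE mxtens_indexK /= scalerA mulrC.
Qed.

Lemma assemble_op_tens1 T f (B : 'M[K]_m) (C : 'M[K]_p) z :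
  (forall y, T y = op_tens f B y) ->
  assemble (fun b => \sum_b' C b b' *: T (z b')) =
  op_tens f (B *t C) (assemble z).
Proof.
move=> h; rewrite -assemble_op_tens; apply: eq_assemble => b.
by apply: eq_bigr => b' _; rewrite h.
Qed.

Lemma assemble_op_tens2 T f f' (B B' : 'M[K]_m) (C : 'M[K]_p) z :
  (forall y, T y = op_tens f B y + op_tens f' B' y) ->
  assemble (fun b => \sum_b' C b b' *: T (z b')) =
  op_tens f (B *t C) (assemble z) + op_tens f' (B' *t C) (assemble z).
Proof.
move=> h; rewrite -!assemble_op_tens -assembleD; apply: eq_assemble => b.
by rewrite -big_split; apply: eq_bigr => b' _; rewrite h scalerDr.
Qed.

End Assemble.

Section Coassociativity.
Variables (K : fieldType) (n : nat) (U : hopf_pres K n) (m p : nat).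
Variables (W : rep U m) (V : rep U p) (lam nu1 nu2 : 'I_n.+1 -> K).
Variable Phi1 : verma U lam -> {ffun 'I_p -> verma U nu1}.
Variable Phi2 : verma U nu1 -> {ffun 'I_m -> verma U nu2}.
Hypothesis Phi2L : linear Phi2.
Hypothesis Phi1E :
  forall g x, Phi1 (vact (letter K g) x) = verma_tens_act V g (Phi1 x).
Hypothesis Phi2E :
  forall g x, Phi2 (vact (letter K g) x) = verma_tens_act W g (Phi2 x).

Lemma Phi_word w x :
  Phi2 (vact (word K w) x) = wact (verma_tens_act W (nu := nu2)) w (Phi2 x).
Proof.
exact: etrans (congr1 Phi2 (vact_word w x)) (wact_morph w x Phi2E).
Qed.

(** The right side is the action of g through coproduct tensor identity applied to its coproduct:
    Phi1 distributes g over M and V, and Phi2 then turns the part acting on M into the tensor action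
    on M (x) W. *)
Lemma Phi_comp_act g x :
  Phi_comp Phi2 Phi1 (vact (letter K g) x) = \sum_(c <- cop g)
    assemble (fun b => \sum_b' rep_word V c.2 b b' *:
      wact (verma_tens_act W (nu := nu2)) c.1 (Phi2 (Phi1 x b'))).
Proof.
apply/ffunP => k; rewrite ffunE Phi1E !sum_ffunE (lin_sum Phi2L) sum_ffunE.
apply: eq_bigr => c _; rewrite !ffunE (lin_sum Phi2L) !sum_ffunE.
apply: eq_bigr => b' _; rewrite (linear_scale _ Phi2L).
apply: etrans (ffunE _ _) (etrans _ (esym (ffunE _ _))).
by congr (_ *: _); exact: (congr1 (fun y => fun_of_fin y _) (Phi_word _ _)).
Qed.

End Coassociativity.

Lemma linear_comb2 (K : fieldType) (A X : lmodType K) (g : A -> X) a b c u v y z :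
  linear g -> g u = y -> g v = z ->
  g (c *: (a *: u - b *: v)) = c *: (a *: y - b *: z).
Proof.
by move=> gL <- <-; rewrite (linear_scale _ gL) (linear_sub gL) !(linear_scale _ gL).
Qed.

Lemma scale_eq (K : fieldType) (X : lmodType K) (x y : X) (a c d : K) :
  y = c *: x -> a * c = d -> a *: y = d *: x.
Proof. by move=> -> <-; rewrite scalerA. Qed.

Section HopX.
Variables (K : fieldType) (n : nat) (q : K) (X : lmodType K).
Variable op : qgen n -> X -> X.
Hypothesis q_neq0 : q != 0.
Hypothesis opP : Uq_module00 q op.
Let opL := um_lin opP.

(** The q-number [h_i + m], with K_i in the role of q^(h_i). *)
Definition qshift (i : 'I_n) (m : nat) (x : X) : X :=
  (q - q^-1)^-1 *: (q ^+ m *: bigK op i x - q ^- m *: bigKv op i x).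

Lemma qshift_f_far (i j : 'I_n) m x : (i.+1 < j)%N || (j.+1 < i)%N ->
  qshift i m (op (Qf j) x) = op (Qf j) (qshift i m x).
Proof.
move=> ij; rewrite /qshift (bigK_f q_neq0 opP) (bigKv_f q_neq0 opP).
rewrite cartan_int_far // oppr0 expr0z !scale1r.
by rewrite (linear_scale _ (opL _)) (linear_sub (opL _)) !(linear_scale _ (opL _)).
Qed.

Lemma qshift_e_far (i j : 'I_n) m x : (i.+1 < j)%N || (j.+1 < i)%N ->
  qshift i m (op (Qe j) x) = op (Qe j) (qshift i m x).
Proof.
move=> ij; rewrite /qshift (bigK_e q_neq0 opP) (bigKv_e q_neq0 opP).
rewrite cartan_int_far // oppr0 expr0z !scale1r.
by rewrite (linear_scale _ (opL _)) (linear_sub (opL _)) !(linear_scale _ (opL _)).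
Qed.

Lemma qshift_f_near (i j : 'I_n) m x : (i.+1 == j) || (j.+1 == i) ->
  qshift i m (op (Qf j) x) = op (Qf j) (qshift i m.+1 x).
Proof.
move=> ij; rewrite /qshift (bigK_f q_neq0 opP) (bigKv_f q_neq0 opP).
rewrite cartan_int_near // opprK expr1z exprN1.
rewrite (linear_scale _ (opL _)) (linear_sub (opL _)) !(linear_scale _ (opL _)).
by rewrite exprSr invfM !scalerA [_^-1 * q^-1]mulrC.
Qed.

Lemma qshift_e_near (i j : 'I_n) m x : (i.+1 == j) || (j.+1 == i) ->
  qshift i m.+1 (op (Qe j) x) = op (Qe j) (qshift i m x).
Proof.
move=> ij; rewrite /qshift (bigK_e q_neq0 opP) (bigKv_e q_neq0 opP).
rewrite cartan_int_near // opprK expr1z exprN1.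
rewrite (linear_scale _ (opL _)) (linear_sub (opL _)) !(linear_scale _ (opL _)).
by rewrite exprSr invfM !scalerA mulfK // divfK //.
Qed.

Lemma ef_qshift i j x : op (Qe i) (op (Qf j) x) =
  op (Qf j) (op (Qe i) x) + (i == j)%:R *: qshift i 0 x.
Proof. by rewrite (um_efE opP) /qshift expr0 invr1 !scale1r. Qed.

Lemma qshift_weight i m x a b : a != 0 -> b != 0 ->
  op (Qk (lo i)) x = a *: x -> op (Qk (up i)) x = b *: x ->
  qshift i m x = ((q - q^-1)^-1 * (q ^+ m * (a / b) - q ^- m * (b / a))) *: x.
Proof.
move=> a0 b0 ha hb.
have inv j c : c != 0 -> op (Qk j) x = c *: x -> op (Qkinv j) x = c^-1 *: x.
  move=> c0 hc; rewrite -[x in RHS](um_kvk opP j) hc (linear_scale _ (opL _)).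
  by rewrite scalerA mulVf ?scale1r.
rewrite /qshift /bigK /bigKv (inv _ _ b0 hb) hb !(linear_scale _ (opL _)) ha.
rewrite (inv _ _ a0 ha); lmod K X; ring.
Qed.

Section Functional.
Variables (phi : X -> K) (ka : 'I_n.+1 -> K).
Hypothesis phiL : linear (phi : X -> K^o).
Hypothesis phik : forall i x, phi (op (Qk i) x) = ka i * phi x.
Hypothesis phikv : forall i x, phi (op (Qkinv i) x) = (ka i)^-1 * phi x.

Lemma functional_bigKv i x :
  phi (bigKv op i x) = ka (up i) / ka (lo i) * phi x.
Proof. by rewrite /bigKv phikv phik; ring. Qed.

Lemma functional_qshift i m x : phi (qshift i m x) = (q - q^-1)^-1 *
  (q ^+ m * (ka (lo i) / ka (up i)) - q ^- m * (ka (up i) / ka (lo i))) * phi x.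
Proof.
have phiZ c z : phi (c *: z) = c * phi z by exact: (linear_scale c phiL).
have phiB z t : phi (z - t) = phi z - phi t by exact: (linear_sub phiL).
by rewrite phiZ phiB !phiZ functional_bigKv /bigK phik phikv; ring.
Qed.

End Functional.

End HopX.

Section UqCoassociativity.
Variables (K : fieldType) (n : nat) (q : K) (X : lmodType K).
Variable op : qgen n -> X -> X.
Hypothesis opL : forall g, linear (op g).
Local Notation U := (Uqc n q id).
Local Notation V := (@Uq_vector K n q : rep U n.+1).
Local Notation VV := (rep_tens V V).

Lemma op_tens_id1 (y : {ffun 'I_n.+1 -> X}) : y = op_tens id 1%:M y.
Proof. by apply/ffunP => b; rewrite op_tens1. Qed.

Lemma tensmx11 m p : (1%:M : 'M[K]_m) *t (1%:M : 'M[K]_p) = 1%:M.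
Proof.
apply/matrixP => i j; rewrite !mxE -natrM mulnb; congr (_%:R : K).
by rewrite -(can_eq (@mxtens_unindexK m p) i j) -pair_eqE.
Qed.

(** Coassociativity, checked on each of the four kinds of generators. *)
Lemma tens_coassoc g (z : 'I_n.+1 -> {ffun 'I_n.+1 -> X}) :
  \sum_(c <- @Uq_cop n g) assemble (fun b => \sum_b' rep_word V c.2 b b' *:
      wact (tens_op q op) c.1 (z b')) =
  \sum_(c <- @Uq_cop n g) op_tens (wact op c.1) (rep_word VV c.2) (assemble z).
Proof.
have bigKE i : wact op [:: Qkinv (lo i); Qk (up i)] =1 bigKv op i by [].
case: g => i.
- rewrite !big_cons !big_nil !addr0.
  rewrite (assemble_op_tens2 _ _ (tens_op_e q op i)).
  rewrite [X in _ + X](assemble_op_tens1 _ _ op_tens_id1) -addrA; congr (_ + _).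
    apply: eq_op_tens => //; rewrite /rep_word /= /rep_tens !big_seq1 /=.
    by rewrite !mulmx1 tensmx_mul.
  rewrite -op_tens_mulD; apply: eq_op_tens => //.
  by rewrite /rep_word /= /rep_tens big_cons big_seq1 /= !mulmx1.
- rewrite !big_cons !big_nil !addr0.
  rewrite (assemble_op_tens2 _ _ (tens_op_f q op i)).
  have TK y : wact (tens_op q op) [:: Qkinv (lo i); Qk (up i)] y =
      op_tens (bigKv op i) (V (Qkinv (lo i)) *m V (Qk (up i))) y.
    by rewrite /wact /= tens_op_k tens_op_kv op_tens_comp.
  rewrite [X in _ + X](assemble_op_tens1 _ _ TK) -addrA; congr (_ + _).
    by apply: eq_op_tens => //; exact: tensmx11.
  rewrite -op_tens_mulD; apply: eq_op_tens => //.
  by rewrite /rep_word /= /rep_tens big_cons big_seq1 /= !mulmx1.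
- rewrite !big_seq1 (assemble_op_tens1 _ _ (tens_op_k q op i)).
  by apply: eq_op_tens => //; rewrite /rep_word /= /rep_tens big_seq1 /= !mulmx1.
- rewrite !big_seq1 (assemble_op_tens1 _ _ (tens_op_kv q op i)).
  by apply: eq_op_tens => //; rewrite /rep_word /= /rep_tens big_seq1 /= !mulmx1.
Qed.

Lemma tens_op_e_coord i x b : tens_op q op (Qe i) x b =
  (q ^+ (lo i == b) / q ^+ (up i == b)) *: op (Qe i) (x b) +
  (b == lo i)%:R *: x (up i).
Proof.
rewrite tens_op_e ffunE op_tens_delta /= mulmx_diag op_tens_diag.
by rewrite !mxE.
Qed.

Lemma tens_op_f_coord i x b : tens_op q op (Qf i) x b =
  op (Qf i) (x b) + (b == up i)%:R *: bigKv op i (x (lo i)).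
Proof. by rewrite tens_op_f ffunE op_tens_delta op_tens1. Qed.

Lemma tens_op_k_coord i x b :
  tens_op q op (Qk i) x b = q ^+ (i == b) *: op (Qk i) (x b).
Proof. by rewrite tens_op_k op_tens_diag mxE. Qed.

End UqCoassociativity.

(** * The quantum group as an instance of [typeA] *)

Section QuantumTypeA.
Variables (K : fieldType) (n : nat) (q : K) (ch : K -> K).
Hypothesis ch0 : ch 0 = 1.
Hypothesis ch1 : ch 1 = q.
Hypothesis chD : forall a b, ch (a + b) = ch a * ch b.
Hypothesis q_root : forall m, (0 < m)%N -> q ^+ m != 1.
Local Notation U := (Uqc n q ch).
Local Notation V := (@Uq_vector K n q).
Local Notation vop nu := (fun g => @vact K n U nu (@letter K (gen U) g)).
Implicit Types nu : 'I_n.+1 -> K.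

Lemma chK a : ch a * ch (- a) = 1.
Proof. by rewrite -chD subrr ch0. Qed.

Lemma ch_neq0 a : ch a != 0.
Proof. by apply/eqP => h; have /eqP := chK a; rewrite h mul0r eq_sym oner_eq0. Qed.

Lemma chN a : ch (- a) = (ch a)^-1.
Proof. by apply: (mulfI (ch_neq0 a)); rewrite chK mulfV // ch_neq0. Qed.

Lemma chB a b : ch (a - b) = ch a / ch b.
Proof. by rewrite chD chN. Qed.

Lemma ch_nat m : ch m%:R = q ^+ m.
Proof.
elim: m => [|m IH]; first by rewrite ch0 expr0.
by rewrite -natr1 chD IH ch1 exprSr.
Qed.

Lemma q_neq0 : q != 0. Proof. by rewrite -ch1 ch_neq0. Qed.

Lemma qq_neq0 : q - q^-1 != 0.
Proof.
rewrite subr_eq0; apply/eqP => h; have := q_root (isT : (0 < 2)%N).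
by rewrite expr2 {1}h mulVf ?q_neq0 // eqxx.
Qed.

Let W nu : Uq_module q (vop nu) := verma_Uq_module q ch nu.
Let W0 nu : Uq_module00 q (vop nu) := um_00 (um_0 (W nu)).

Definition uq_hop (i : 'I_n) (m : nat) : free_alg K (gen U) :=
  (q - q^-1)^-1 *: (q ^+ m *: @word K (gen U) [:: Qk (lo i); Qkinv (up i)] -
                    q ^- m *: @word K (gen U) [:: Qkinv (lo i); Qk (up i)]).
Definition uq_kin (i : 'I_n) : free_alg K (gen U) :=
  @word K (gen U) [:: Qkinv (lo i); Qk (up i)].

Lemma vact_hop nu i m x :
  vact (uq_hop i m) x = qshift q (vop nu) i m x.
Proof.
by apply: (linear_comb2 (g := fun a => vact a x)); [exact: vact_linear|exact: vact_word|exact: vact_word].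
Qed.

Lemma vact_kin nu i (x : verma U nu) : vact (uq_kin i) x = bigKv (vop nu) i x.
Proof. exact: vact_word. Qed.

Definition uq_br nu (a b : 'I_n.+1) (m : nat) : K := (q - q^-1)^-1 *
  (q ^+ m * (ch (nu a) / ch (nu b)) - q ^- m * (ch (nu b) / ch (nu a))).
Definition uq_tau nu (a b : 'I_n.+1) : K := ch (nu b) / ch (nu a).

Lemma uq_hop_hw nu i m : vact (uq_hop i m) (hw U nu) =
  uq_br nu (lo i) (up i) m *: hw U nu.
Proof.
rewrite vact_hop; apply: (qshift_weight (W0 nu)).
- exact: ch_neq0.
- exact: ch_neq0.
- exact: vact_cartan_hw.
- exact: vact_cartan_hw.
Qed.

Lemma uq_hw_coord nu : exists phi : verma U nu -> K,
  [/\ linear (phi : verma U nu -> K^o), phi (hw U nu) = 1,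
      forall i x, phi (vact (@letter K (gen U) (Qf i)) x) = 0,
      forall i x, phi (cact i x) = chi U (nu i) * phi x &
      (forall i m x, phi (vact (uq_hop i m) x) =
         uq_br nu (lo i) (up i) m * phi x) /\
      (forall i x, phi (vact (uq_kin i) x) = uq_tau nu (lo i) (up i) * phi x)].
Proof.
have [phi [phiL phihw phif phik phikv]] := uq_verma_coord (q := q) q_neq0 ch_neq0 nu.
exists phi; split; [exact: phiL|exact: phihw|exact: phif|exact: phik|split].
- move=> i m x; apply: etrans (congr1 phi (vact_hop i m x)) _.
  exact: (@functional_qshift K n q (verma U nu) (vop nu) phi (fun i => ch (nu i)) phiL phik phikv i m x).
- move=> i x; apply: etrans (congr1 phi (vact_kin i x)) _.
  exact: (@functional_bigKv K n (verma U nu) (vop nu) phi (fun i => ch (nu i)) phik phikv i x).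
Qed.

Lemma uq_fact_ind nu (P : verma U nu -> Prop) :
  P 0 -> (forall x y, P x -> P y -> P (x + y)) ->
  (forall c x, P x -> P (c *: x)) -> P (hw U nu) ->
  (forall i x, P x -> P (vact (@letter K (gen U) (Qf i)) x)) -> forall x, P x.
Proof.
move=> P0 PD PZ Phw Pf.
apply: (@verma_span K n U nu _ (fwd (vop nu) (hw U nu)) [::]) => //.
  move=> g w Q Q0 QD QZ Qb.
  apply: (@Uq_span K n q (fun i => ch (nu i)) q_neq0 _ _ (vop nu)) => //.
  - by move=> i; exact: ch_neq0.
  - by move=> i; exact: vact_raise_hw.
  - by move=> i; exact: vact_cartan_hw.
by elim=> // i w; exact: Pf.
Qed.

Lemma ch_simple_root a (i : 'I_n.+1) (j : 'I_n) :
  ch (a - simple_root K j i) = q ^ (- root_pairing i j) * ch a.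
Proof.
rewrite chB /simple_root chB !ch_nat /root_pairing opprB expfzDr ?q_neq0 //.
by rewrite -invr_expz -!exprnP invf_div; ring.
Qed.

Lemma uq_fact_weight nu mu j (x : verma U nu) : verma_weight mu x ->
  verma_weight (fun i => mu i - simple_root K j i)
    (vact (@letter K (gen U) (Qf j)) x).
Proof.
move=> hx i; apply: etrans (um_kf (W0 nu) i j x) _.
apply: etrans (congr1 (fun y => _ *: vact (@letter K (gen U) (Qf j)) y) (hx i)) _.
by rewrite (linear_scale _ (vactL _)) scalerA -ch_simple_root.
Qed.

Lemma uq_tens_act nu : verma_tens_act (U := U) V (nu := nu) =
  tens_op q (vop nu).
Proof.
apply/funext => g; apply/funext => x; apply: eq_bigr => c _.
by apply: eq_op_tens => // y; exact: vact_word.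
Qed.

Lemma uq_tens_rel nu r (x : {ffun 'I_n.+1 -> verma U nu}) : Uq_rel q r ->
  free_act (verma_tens_act (U := U) V (nu := nu)) r x = 0.
Proof.
move=> hr; apply: Uq_module_rel hr; rewrite uq_tens_act.
exact: (tens_Uq_module q_neq0 qq_neq0 (W nu)).
Qed.

Lemma uq_comp_act lam nu1 nu2 Phi1 Phi2 :
  linear (Phi1 : verma U lam -> {ffun 'I_n.+1 -> verma U nu1}) ->
  linear (Phi2 : verma U nu1 -> {ffun 'I_n.+1 -> verma U nu2}) ->
  (forall g x, Phi1 (vact (letter K g) x) = verma_tens_act (U := U) V g (Phi1 x)) ->
  (forall g x, Phi2 (vact (letter K g) x) = verma_tens_act (U := U) V g (Phi2 x)) ->
  forall g x, Phi_comp Phi2 Phi1 (vact (letter K g) x) =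
    verma_tens_act (rep_tens (U := U) V V) g (Phi_comp Phi2 Phi1 x).
Proof.
move=> _ Phi2L Phi1E Phi2E g x.
apply: etrans (Phi_comp_act Phi2L Phi1E Phi2E g x) _.
rewrite uq_tens_act; apply: etrans (tens_coassoc _ _ _ _) _; first by move=> g'; apply: vactL.
by apply: eq_bigr => c _; apply: eq_op_tens => // y; apply: esym; exact: vact_word.
Qed.

Lemma uq_tens_e nu i (x : {ffun 'I_n.+1 -> verma U nu}) b :
  verma_tens_act (U := U) V (Qe i) x b =
  (q ^+ (lo i == b) / q ^+ (up i == b)) *: eact i (x b) +
  (b == lo i)%:R *: x (up i).
Proof.
exact: etrans (congr1 (fun T => fun_of_fin (T (Qe i) x) b) (uq_tens_act nu))
  (tens_op_e_coord _ _ _ _ _).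
Qed.

Lemma uq_tens_f nu i (x : {ffun 'I_n.+1 -> verma U nu}) b :
  verma_tens_act (U := U) V (Qf i) x b =
  vact (@letter K (gen U) (Qf i)) (x b) +
  (b == up i)%:R *: vact (uq_kin i) (x (lo i)).
Proof.
apply: etrans (congr1 (fun T => fun_of_fin (T (Qf i) x) b) (uq_tens_act nu)) _.
apply: etrans (tens_op_f_coord _ _ _ _ _) _.
exact: (congr1 (fun y => vact (@letter K (gen U) (Qf i)) (x b) + (b == up i)%:R *: y)
  (esym (vact_kin i (x (lo i))))).
Qed.

Lemma uq_tens_cartan nu i (x : {ffun 'I_n.+1 -> verma U nu}) b a :
  cact i (x b) = chi U (a - (i == b)%:R) *: x b ->
  verma_tens_act (U := U) V (cartan U i) x b = chi U a *: x b.
Proof.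
move=> h.
apply: etrans (congr1 (fun T => fun_of_fin (T (Qk i) x) b) (uq_tens_act nu)) _.
apply: etrans (tens_op_k_coord _ _ _ _ _) _.
apply: scale_eq h _.
by rewrite /= chB ch_nat mulrC divfK // expf_neq0 // q_neq0.
Qed.

(** Left transparent: later proofs obtain the values of [br], [tau] and [kap] by conversion. *)
Definition uq_typeA : typeA (U := U) V.
Proof.
apply: (@TypeA K n U V (@Qf n) uq_hop uq_kin (fun b => q ^+ b)
  (fun i b => q ^+ (lo i == b) / q ^+ (up i == b)) q uq_br uq_tau).
- move=> nu i j x; apply: etrans (ef_qshift (W0 nu) i j x) _.
  by congr (_ + _ *: _); exact: esym (vact_hop i 0 x).
- by move=> nu i j x; exact: (um_ee (um_0 (W nu)) x).
- by move=> nu i j x; exact: (um_ff (W nu) x).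
- move=> nu i j m x ij; apply: etrans (vact_hop i m _) _.
  apply: etrans (qshift_f_far q_neq0 (W0 nu) m x ij) _.
  by congr (vact _ _); exact: esym (vact_hop i m x).
- move=> nu i j m x ij; apply: etrans (vact_hop i m _) _.
  apply: etrans (qshift_f_near q_neq0 (W0 nu) m x ij) _.
  by congr (vact _ _); exact: esym (vact_hop i m.+1 x).
- move=> nu i j m x ij; apply: etrans (vact_hop i m _) _.
  apply: etrans (qshift_e_far q_neq0 (W0 nu) m x ij) _.
  by congr (vact _ _); exact: esym (vact_hop i m x).
- move=> nu i j m x ij; apply: etrans (vact_hop i m.+1 _) _.
  apply: etrans (qshift_e_near q_neq0 (W0 nu) m x ij) _.
  by congr (vact _ _); exact: esym (vact_hop i m x).
- exact: uq_hop_hw.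
- exact: uq_hw_coord.
- exact: uq_fact_ind.
- exact: uq_fact_weight.
(* Equality would give q^k = 1 with k > 0. *)
- move=> a k k0 /=; rewrite chB ch_nat; apply/eqP => h.
  have /eqP := q_root k0; apply; apply: (mulfI (ch_neq0 a)).
  by rewrite -{1}h divfK ?mulr1 // expf_neq0 // q_neq0.
- by move=> b; exact: ch_nat.
- by rewrite expr1 expr0; have := q_root (isT : (0 < 1)%N); rewrite expr1.
- by [].
- by move=> i; rewrite eqxx eq_sym lo_neq_up expr0 divr1 expr1.
- by move=> i b; rewrite mulf_neq0 ?invr_neq0 ?expf_neq0 ?q_neq0.
- exact: q_neq0.
- exact: uq_tens_e.
- exact: uq_tens_f.
- exact: uq_tens_cartan.
- exact: uq_tens_rel.
- exact: uq_comp_act.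
(* The identity [x+1][y+1] - [x][y] = [x+y+1] at x = nu_a - nu_b + m and y = nu_b - nu_d + p. *)
- move=> nu a b d m p; rewrite /uq_br !exprS exprD !invfM.
  have := ch_neq0 (nu a); have := ch_neq0 (nu b); have := ch_neq0 (nu d).
  have := qq_neq0; have := q_neq0.
  set A := ch (nu a); set B := ch (nu b); set D := ch (nu d).
  have := expf_neq0 m q_neq0; have := expf_neq0 p q_neq0.
  set x := q ^+ m; set y := q ^+ p => hy hx hq hqq hD hB hA.
  have hq2 : q * q - 1 != 0 by rewrite subr_eq0 -expr2; exact: q_root.
  by field; rewrite ?hq ?hx ?hy ?hA ?hB ?hD ?hq2.
- by move=> nu a b d; rewrite /uq_tau; field; rewrite ?ch_neq0.
- by move=> nu a; rewrite /uq_tau divff ?ch_neq0.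
Defined.

End QuantumTypeA.

(** * Classical gl *)

Section GlModule.
Variables (K : fieldType) (m : nat).

Definition gl_bracket (X : lmodType K) (op : 'I_m * 'I_m -> X -> X) g g' : Prop :=
  forall x, op g (op g' x) = op g' (op g x) +
    (g.2 == g'.1)%:R *: op (g.1, g'.2) x - (g'.2 == g.1)%:R *: op (g'.1, g.2) x.

Record gl_module (X : lmodType K) (op : 'I_m * 'I_m -> X -> X) : Prop := {
  gl_lin : forall g, linear (op g);
  gl_comm : forall g g', gl_bracket op g g'
}.

Lemma gl_bracket_sym (X : lmodType K) (op : 'I_m * 'I_m -> X -> X) g g' :
  gl_bracket op g g' -> gl_bracket op g' g.
Proof. by move=> h x; rewrite h; lmod K X; ring. Qed.

End GlModule.

(* Parabolic induction from gl_1 x gl_m to gl_(1+m): the nilradical of the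
   opposite parabolic is abelian and acts by the multiplications z_a, d_a being
   the partial derivatives. *)
Section ParabolicInduction.
Variables (K : fieldType) (m : nat) (X : lmodType K) (c : K).
Variables (w : 'I_m * 'I_m -> X -> X) (z d : 'I_m -> X -> X).
Hypothesis wP : gl_module w.
Hypothesis zL : forall a, linear (z a).
Hypothesis dL : forall a, linear (d a).
Hypothesis zz : forall a b x, z a (z b x) = z b (z a x).
Hypothesis dd : forall a b x, d a (d b x) = d b (d a x).
Hypothesis dz : forall a b x, d a (z b x) = z b (d a x) + (a == b)%:R *: x.
Hypothesis wz : forall g a x, w g (z a x) = z a (w g x).
Hypothesis wd : forall g a x, w g (d a x) = d a (w g x).
Let wL := gl_lin wP.

Let nn x := \sum_a z a (d a x).
Let tt b x := \sum_a w (a, b) (d a x).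

Lemma sum_delta (h : 'I_m -> X) a : \sum_b (a == b)%:R *: h b = h a.
Proof.
rewrite (bigD1 a) //= eqxx scale1r big1 ?addr0 // => b ba.
by rewrite eq_sym (negbTE ba) scale0r.
Qed.

Let nnL : linear nn.
Proof.
move=> k x y; rewrite /nn scaler_sumr -big_split; apply: eq_bigr => a _.
by rewrite dL zL.
Qed.

Let ttL b : linear (tt b).
Proof.
move=> k x y; rewrite /tt scaler_sumr -big_split; apply: eq_bigr => a _.
by rewrite dL wL.
Qed.

Let nn_z a x : nn (z a x) = z a (nn x) + z a x.
Proof.
rewrite /nn (lin_sum (zL a)) -[X in _ + X](sum_delta (fun b => z b x)) -big_split.
apply: eq_bigr => b _ /=; rewrite dz (linear_add (zL b)) zz (linear_scale _ (zL b)).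
by rewrite eq_sym.
Qed.

Let nn_d a x : nn (d a x) = d a (nn x) - d a x.
Proof.
rewrite /nn (lin_sum (dL a)) -[X in _ - X](sum_delta (fun b => d b x)) -sumrB.
apply: eq_bigr => b _ /=; rewrite dz addrK.
by rewrite [d b (d a x)]dd.
Qed.

Let nn_w g x : nn (w g x) = w g (nn x).
Proof.
by rewrite /nn (lin_sum (wL g)); apply: eq_bigr => a _; rewrite wz wd.
Qed.

Let tt_z b a x : tt b (z a x) = z a (tt b x) + w (a, b) x.
Proof.
rewrite /tt (lin_sum (zL a)) -[X in _ + X](sum_delta (fun a' => w (a', b) x)) -big_split.
apply: eq_bigr => a' _ /=; rewrite dz (linear_add (wL _)) (linear_scale _ (wL _)) wz.
by rewrite eq_sym.
Qed.

Let tt_d b a x : tt b (d a x) = d a (tt b x).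
Proof.
by rewrite /tt (lin_sum (dL a)); apply: eq_bigr => a' _; rewrite dd wd.
Qed.

Let tt_w b g x : tt b (w g x) =
  w g (tt b x) + (b == g.1)%:R *: tt g.2 x - w (g.1, b) (d g.2 x).
Proof.
rewrite /tt (lin_sum (wL g)) scaler_sumr.
rewrite -[X in _ - X](sum_delta (fun a => w (g.1, b) (d a x))) -big_split -sumrB.
apply: eq_bigr => a _ /=; rewrite -wd (gl_comm wP) /=.
by rewrite eq_sym.
Qed.

Let nn_tt b x : nn (tt b x) = tt b (nn x) - tt b x.
Proof.
rewrite /tt (lin_sum nnL) -sumrB; apply: eq_bigr => a _.
by rewrite nn_w nn_d (linear_sub (wL _)).
Qed.

(** The operators [w] do not commute, so neither do the [tt]. Their commutator is exactly what
    compensates the commutators of [tt] with [nn] in the bracket of two operators [pind] (0, b). *)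
Let tt_tt b e x : tt b (tt e x) = tt e (tt b x) + tt e (d b x) - tt b (d e x).
Proof.
have -> : tt b (tt e x) = \sum_a (w (a, e) (tt b (d a x)) +
    (b == a)%:R *: tt e (d a x) - w (a, b) (d e (d a x))).
  by rewrite {2}/tt (lin_sum (ttL b)); apply: eq_bigr => a _; rewrite tt_w.
rewrite sumrB big_split /= (sum_delta (fun a => tt e (d a x))).
congr (_ + _ - _); apply: eq_bigr => a _; first by rewrite tt_d.
by rewrite dd.
Qed.

(** gl_(1+m) on the polynomials in the z_a with coefficients in the gl_m-module, c being the weight
    of the added index 0. Here [nn] is the Euler operator, and the operator for (0, b) is found by
    moving E_(0b) to the right through the E_(a0) = z_a. *)
Definition pind (g : 'I_m.+1 * 'I_m.+1) (x : X) : X :=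
  match unlift ord0 g.1, unlift ord0 g.2 with
  | None, None => c *: x - nn x
  | Some a, None => z a x
  | Some a, Some b => w (a, b) x + z a (d b x)
  | None, Some b => c *: d b x - tt b x - nn (d b x)
  end.

Let lins := (linear_sub nnL, linear_add nnL, linear_opp nnL, fun a => linear_scale a nnL).
Let lint b := (linear_sub (ttL b), linear_add (ttL b), linear_opp (ttL b), fun a => linear_scale a (ttL b)).
Let linz b := (linear_sub (zL b), linear_add (zL b), linear_opp (zL b), fun a => linear_scale a (zL b)).
Let lind b := (linear_sub (dL b), linear_add (dL b), linear_opp (dL b), fun a => linear_scale a (dL b)).
Let linw b := (linear_sub (wL b), linear_add (wL b), linear_opp (wL b), fun a => linear_scale a (wL b)).

Lemma pindL g : linear (pind g).
Proof.
move=> k x y; rewrite /pind.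
case: (unlift _ _) => [a|]; case: (unlift _ _) => [b|];
  rewrite ?(zL, dL, wL, nnL, ttL, linz, lins) //; lmod K X; ring.
Qed.

Let l0 := @lift m.+1 ord0.

Let eq0l a : (ord0 == l0 a) = false. Proof. by []. Qed.
Let eql0 a : (l0 a == ord0) = false. Proof. by []. Qed.
Let eqll a b : (l0 a == l0 b) = (a == b).
Proof. exact: (inj_eq lift_inj). Qed.

Lemma pind_bracket g g' : gl_bracket pind g g'.
Proof.
(* These rules bring compositions of the operators into a common order; what remains is an identity
   of linear combinations. *)
pose nf := (lins, lint, linz, lind, linw, nn_z, nn_d, nn_w, nn_tt, tt_z, tt_d,
  tt_w, wz, wd, dz).
have p00 x : pind (ord0, ord0) x = c *: x - nn x by rewrite /pind unlift_none.
have pa0 a x : pind (l0 a, ord0) x = z a x by rewrite /pind unlift_none liftK.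
have p0b b x : pind (ord0, l0 b) x = c *: d b x - tt b x - nn (d b x).
  by rewrite /pind unlift_none liftK.
have pab a b x : pind (l0 a, l0 b) x = w (a, b) x + z a (d b x).
  by rewrite /pind !liftK.
have b00a0 a : gl_bracket pind (ord0, ord0) (l0 a, ord0).
  move=> x; rewrite /= !(p00, pa0, p0b, pab) ?(eq0l, eql0, eqll, eqxx) /=.
  by rewrite ?linz nn_z; lmod K X; ring.
have b000b b : gl_bracket pind (ord0, ord0) (ord0, l0 b).
  move=> x; rewrite /= !(p00, pa0, p0b, pab) ?(eq0l, eql0, eqll, eqxx) /=.
  rewrite ?(lins, lind, lint) ?(nn_tt, nn_d).
  rewrite ?(lins, lind, lint); rewrite ?(nn_tt, nn_d) ?(lins, lind, lint).
  by lmod K X; ring.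
have b00ab a b : gl_bracket pind (ord0, ord0) (l0 a, l0 b).
  move=> x; rewrite /= !(p00, pa0, p0b, pab) ?(eq0l, eql0, eqll, eqxx) /=.
  rewrite ?(lins, lind, linz, linw) nn_w nn_z nn_d ?linz.
  by lmod K X; ring.
have ba0c0 a b : gl_bracket pind (l0 a, ord0) (l0 b, ord0).
  move=> x; rewrite /= !(p00, pa0, p0b, pab) ?(eq0l, eql0, eqll, eqxx) /=.
  by rewrite zz; lmod K X; ring.
have b0ba0 b a : gl_bracket pind (ord0, l0 b) (l0 a, ord0).
  move=> x; rewrite /= !(p00, pa0, p0b, pab) ?(eq0l, eql0, eqll, eqxx) /=.
  rewrite dz tt_z ?lins ?linz nn_z.
  by lmod K X; ring.
have b0b0d b a : gl_bracket pind (ord0, l0 b) (ord0, l0 a).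
  move=> x; rewrite /= !(p00, pa0, p0b, pab) ?(eq0l, eql0, eqll, eqxx) /=.
  rewrite ?nf (tt_tt b a) ?nf !(dd b a).
  by lmod K X; ring.
have b0bcd b a e : gl_bracket pind (ord0, l0 b) (l0 a, l0 e).
  move=> x; rewrite /= !(p00, pa0, p0b, pab) ?(eq0l, eql0, eqll, eqxx) /=.
  rewrite ?nf /= !(dd b e).
  case: eqP => [->|_]; rewrite /= ?scale1r ?scale0r.
    by lmod K X; ring.
  by lmod K X; ring.
have babc0 b a e : gl_bracket pind (l0 a, l0 e) (l0 b, ord0).
  move=> x; rewrite /= !(p00, pa0, p0b, pab) ?(eq0l, eql0, eqll, eqxx) /=.
  by rewrite wz dz ?(linz) zz; lmod K X; ring.
have babcd a b e k : gl_bracket pind (l0 a, l0 b) (l0 e, l0 k).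
  move=> x; rewrite /= !(p00, pa0, p0b, pab) ?(eq0l, eql0, eqll, eqxx) /=.
  rewrite ?nf (gl_comm wP (a, b)) /= (zz a e) (dd b k).
  by lmod K X; ring.
case: g g' => [i j] [k l].
case: (unliftP ord0 i) => [a|] ->; case: (unliftP ord0 j) => [b|] ->;
case: (unliftP ord0 k) => [a'|] ->; case: (unliftP ord0 l) => [b'|] ->.
- exact: babcd.
- exact: babc0.
- exact/gl_bracket_sym/b0bcd.
- exact/gl_bracket_sym/b00ab.
- exact/gl_bracket_sym/babc0.
- exact: ba0c0.
- exact/gl_bracket_sym/b0ba0.
- exact/gl_bracket_sym/b00a0.
- exact: b0bcd.
- exact: b0ba0.
- exact: b0b0d.
- exact/gl_bracket_sym/b000b.
- exact: b00ab.
- exact: b00a0.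
- exact: b000b.
- by move=> x; rewrite /=; lmod K X; ring.
Qed.

Lemma pind_module : gl_module pind.
Proof. by split; [exact: pindL|exact: pind_bracket]. Qed.

End ParabolicInduction.

Section Exponential.
Variables (K : fieldType) (m : nat) (X : lmodType K).
Local Notation Y := (('I_m -> nat) -> X).

Definition shiftD (nu : 'I_m -> nat) a : 'I_m -> nat := fun b => (nu b + (a == b))%N.
Definition shiftB (nu : 'I_m -> nat) a : 'I_m -> nat := fun b => (nu b - (a == b))%N.

(* [y] stands for the exponential generating function with coefficients [y nu];
   the truncation in [shiftB] is harmless, as the factor then vanishes. *)
Definition exp_d a (y : Y) : Y := fun nu => y (shiftD nu a).
Definition exp_z a (y : Y) : Y := fun nu => (nu a)%:R *: y (shiftB nu a).
Definition exp_op (g : X -> X) (y : Y) : Y := fun nu => g (y nu).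

Lemma exp_dL a : linear (exp_d a). Proof. by []. Qed.

Lemma exp_zL a : linear (exp_z a).
Proof.
move=> c x y; apply/funext => nu.
have h : (nu a)%:R *: (c *: x (shiftB nu a) + y (shiftB nu a)) =
  c *: ((nu a)%:R *: x (shiftB nu a)) + (nu a)%:R *: y (shiftB nu a).
  by lmod K X; ring.
exact: h.
Qed.

Lemma exp_opL g : linear g -> linear (exp_op g).
Proof. by move=> gL c x y; apply/funext => nu; exact: gL. Qed.

Lemma exp_dd a b y : exp_d a (exp_d b y) = exp_d b (exp_d a y).
Proof.
apply/funext => nu; congr y; apply/funext => i; rewrite /shiftD; lia.
Qed.

Lemma exp_zz a b y : exp_z a (exp_z b y) = exp_z b (exp_z a y).
Proof.
apply/funext => nu; rewrite /exp_z !scalerA -!natrM; congr (_%:R *: y _).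
  rewrite /shiftB [b == a]eq_sym; have [->|] := eqVneq a b; first lia.
  by move=> _; rewrite !subn0 mulnC.
apply/funext => i; rewrite /shiftB; lia.
Qed.

Lemma exp_dz a b y :
  exp_d a (exp_z b y) = exp_z b (exp_d a y) + (a == b)%:R *: y.
Proof.
apply/funext => nu.
have h : (shiftD nu a b)%:R *: y (shiftB (shiftD nu a) b) =
  (nu b)%:R *: y (shiftD (shiftB nu b) a) + (a == b)%:R *: y nu.
  have [->|ab] := eqVneq a b.
    have -> : shiftB (shiftD nu b) b = nu by apply/funext => i; rewrite /shiftB /shiftD; lia.
    rewrite /shiftD eqxx natrD scalerDl; congr (_ + _).
    have [->|n0] := eqVneq (nu b) 0%N; first by rewrite !scale0r.
    congr (_ *: y _); apply/funext => i; rewrite /shiftB.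
    by have [<-|_] := eqVneq b i; lia.
  rewrite scale0r addr0 /shiftD (negbTE ab) addn0.
  have [->|n0] := eqVneq (nu b) 0%N; first by rewrite !scale0r.
  congr (_ *: y _); apply/funext => i; rewrite /shiftB.
  by have [<-|_] := eqVneq b i; rewrite ?(negbTE ab); lia.
exact: h.
Qed.

Lemma exp_opz g a y : linear g -> exp_op g (exp_z a y) = exp_z a (exp_op g y).
Proof. by move=> gL; apply/funext => nu; exact: (linear_scale _ gL). Qed.

Definition exp_const (v : X) : Y := fun nu => [forall a, nu a == 0%N]%:R *: v.

Lemma exp_d_const a v : exp_d a (exp_const v) = 0.
Proof.
apply/funext => nu; rewrite /exp_d /exp_const.
have -> : [forall b, shiftD nu a b == 0%N] = false.
  by apply/forallP => /(_ a); rewrite /shiftD eqxx addn1.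
exact: scale0r.
Qed.

Lemma exp_op_const g v : linear g -> exp_op g (exp_const v) = exp_const (g v).
Proof. by move=> gL; apply/funext => nu; exact: (linear_scale _ gL). Qed.

Lemma exp_const_scale c v : exp_const (c *: v) = c *: exp_const v.
Proof.
apply/funext => nu; exact: etrans (scalerA _ _ _) (etrans (congr1 (fun d => d *: v) (mulrC _ _)) (esym (scalerA _ _ _))).
Qed.

Lemma exp_const0 : exp_const 0 = 0.
Proof. by apply/funext => nu; exact: scaler0. Qed.

End Exponential.

(** The induction adds a new first index. The highest weight vector is the constant series with
    value v, and the functional is the previous one applied to the constant term: z_a has none in
    its image, and on constant terms the operators of gl_m act through [w]. *)
Lemma ex_gl_coord (K : fieldType) (m : nat) (lam : 'I_m -> K) :
  exists (X : lmodType K) (op : 'I_m * 'I_m -> X -> X) (v : X) (phi : X -> K),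
  [/\ gl_module op, forall a b : 'I_m, (a < b)%N -> op (a, b) v = 0,
      forall a, op (a, a) v = lam a *: v &
      [/\ linear (phi : X -> K^o), phi v = 1,
          forall (a b : 'I_m) x, (b < a)%N -> phi (op (a, b) x) = 0 &
          forall a x, phi (op (a, a) x) = lam a * phi x]].
Proof.
elim: m lam => [|m IH] lam.
  (* gl_0 has no generators: the ground field with v = 1. *)
  by exists K^o, (fun _ _ => 0), 1, id; split; [split|..|split] => //; case=> [[]].
have [X [w [v [phi [wP we wv [phiL phiv phif phid]]]]]] :=
  IH (fun a => lam (lift ord0 a)).
pose Y := ('I_m -> nat) -> X.
have wL := gl_lin wP.
pose W g : Y -> Y := exp_op (w g).
have WL g : linear (W g) by apply: exp_opL; exact: wL.
have WP : gl_module W.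
  split=> // g g' y; apply/funext => nu; exact: (gl_comm wP g g' (y nu)).
pose op := pind (lam ord0) W (@exp_z K m X) (@exp_d K m X).
have opP : gl_module op.
  apply: (@pind_module K m Y (lam ord0) W (@exp_z K m X) (@exp_d K m X) WP).
  - exact: exp_zL.
  - exact: exp_dL.
  - exact: exp_zz.
  - exact: exp_dd.
  - exact: exp_dz.
  - by move=> g a y; apply: exp_opz; exact: wL.
  - by [].
have zL := @exp_zL K m X.
have nn0 : \sum_a exp_z a (exp_d a (exp_const v)) = 0 :> Y.
  by rewrite big1 // => a _; rewrite exp_d_const (linear_zero (zL a)).
exists (Y : lmodType K), op, (exp_const v), (fun y => phi (y (fun=> 0%N))); split=> //.
- move=> a b ab; rewrite /op /pind /=.
  case: (unliftP ord0 b) ab => [b' ->|->] // ab.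
  case: (unliftP ord0 a) ab => [a' ->|->] ab.
    rewrite exp_d_const (linear_zero (zL a')) addr0 [W _ _]exp_op_const //.
    by rewrite we ?exp_const0 // -ltnS.
  rewrite exp_d_const scaler0 !big1 ?subr0 // => a' _.
    by rewrite [exp_d a' 0](linear_zero (@exp_dL K m X a')) (linear_zero (zL a')).
  by rewrite exp_d_const (linear_zero (WL _)).
- move=> a; rewrite /op /pind /=.
  case: (unliftP ord0 a) => [a' ->|->]; last by rewrite nn0 subr0.
  rewrite exp_d_const (linear_zero (zL a')) addr0 [W _ _]exp_op_const //.
  by rewrite wv exp_const_scale.
have phiD x y : phi (x + y) = phi x + phi y by exact: (linear_add phiL).
have phiB x y : phi (x - y) = phi x - phi y by exact: (linear_sub phiL).
have phiZ c x : phi (c *: x) = c * phi x by exact: (linear_scale c phiL).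
have z0 a (y : Y) : exp_z a y (fun=> 0%N) = 0 by exact: scale0r.
split.
- by move=> c x y; exact: phiL.
- rewrite /exp_const (_ : [forall a : 'I_m, _] = true) ?scale1r //.
  exact/forallP.
- move=> a b x ba; rewrite /op /pind /=.
  case: (unliftP ord0 a) ba => [a' ->|->] // ba.
  case: (unliftP ord0 b) ba => [b' ->|->] ba.
    have h : phi (w (a', b') (x (fun=> 0%N)) + exp_z a' (exp_d b' x) (fun=> 0%N)) = 0.
      by rewrite z0 addr0 phif // -ltnS.
    exact: h.
  by rewrite z0 -[0 in LHS](scale0r v) phiZ mul0r.
move=> a x; rewrite /op /pind /=.
case: (unliftP ord0 a) => [a' ->|->].
  have h : phi (w (a', a') (x (fun=> 0%N)) + exp_z a' (exp_d a' x) (fun=> 0%N)) =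
    lam (lift ord0 a') * phi (x (fun=> 0%N)) by rewrite z0 addr0 phid.
  exact: h.
have h : phi (lam ord0 *: x (fun=> 0%N) -
    (\sum_a exp_z a (exp_d a x)) (fun=> 0%N)) = lam ord0 * phi (x (fun=> 0%N)).
  by rewrite fct_sumE big1 ?subr0 ?phiZ.
exact: h.
Qed.

Section GlModuleTheory.
Variables (K : fieldType) (n : nat).
Local Notation I := 'I_n.+1.
Local Notation V := (@Ugl_vector K n).

Lemma gl_module_rel (X : lmodType K) (op : I * I -> X -> X) r x :
  gl_module op -> Ugl_rel r -> free_act op r x = 0.
Proof.
move=> opP hr; case: r / hr => i j k l.
pose al := free_act_linear op.
pose aM := free_actM (gl_lin opP).
pose ac := free_act_letter op.
rewrite (act_bracket al aM ac) (gl_comm opP) /=.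
by lmod K X; ring.
Qed.

Lemma verma_gl_module nu :
  gl_module (fun g => @vact K n (Ugl K n) nu (@letter K (gen (Ugl K n)) g)).
Proof.
pose al := @vact_linear K n (Ugl K n) nu; pose aM := @vactM K n (Ugl K n) nu.
pose ac (g : I * I) (x : verma (Ugl K n) nu) :=
  erefl (@vact K n (Ugl K n) nu (@letter K (gen (Ugl K n)) g) x).
split=> [g|[i j] [k l] x]; first exact: vactL.
have /esym R := @vact_rel K n (Ugl K n) nu _ x (Ugl_bracket K i j k l).
have h := etrans R (act_bracket al aM ac _ _ _ _ _ _ _).
suff gen (X : lmodType K) (y z t u : X) (c d : K) :
  0 = y - z - c *: t + d *: u -> y = z + c *: t - d *: u by exact: gen h.
move=> e; apply/eqP; rewrite -subr_eq0; apply/eqP; rewrite [RHS]e.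
by lmod K X; ring.
Qed.

Section Module.
Variables (X : lmodType K) (op : I * I -> X -> X).
Hypothesis opP : gl_module op.
Let opL := gl_lin opP.

Definition gl_shift (i : 'I_n) (m : nat) x :=
  op (lo i, lo i) x - op (up i, up i) x + m%:R *: x.

Lemma gl_shift_weight i m x a b : op (lo i, lo i) x = a *: x ->
  op (up i, up i) x = b *: x -> gl_shift i m x = (a - b + m%:R) *: x.
Proof. by move=> ha hb; rewrite /gl_shift ha hb -scalerBl -scalerDl. Qed.

Lemma gl_diag a b c x : op (a, a) (op (b, c) x) =
  op (b, c) (op (a, a) x) + ((a == b)%:R - (a == c)%:R) *: op (b, c) x.
Proof.
rewrite (gl_comm opP) /= [c == a]eq_sym.
case: (a =P b) => [<-|_]; case: (a =P c) => [<-|_];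
  rewrite /= ?(mulr0n, mulr1n); lmod K X; ring.
Qed.

Lemma gl_ef i j x : op (lo i, up i) (op (up j, lo j) x) =
  op (up j, lo j) (op (lo i, up i) x) + (i == j)%:R *: gl_shift i 0 x.
Proof.
rewrite (gl_comm opP) /= up_eq lo_eq [j == i]eq_sym /gl_shift.
by have [->|_] := eqVneq i j; rewrite /= ?(mulr0n, mulr1n); lmod K X; ring.
Qed.

Lemma gl_comm_far a b c d x : b != c -> d != a ->
  op (a, b) (op (c, d) x) = op (c, d) (op (a, b) x).
Proof.
move=> /negbTE bc /negbTE da; rewrite (gl_comm opP) /= bc da.
by rewrite /= ?mulr0n; lmod K X; ring.
Qed.

Lemma gl_shift_comm i m a b x : gl_shift i m (op (a, b) x) =
  op (a, b) (gl_shift i m x) +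
  ((lo i == a)%:R - (lo i == b)%:R - (up i == a)%:R + (up i == b)%:R) *:
    op (a, b) x.
Proof.
rewrite /gl_shift (linear_add (opL _)) (linear_sub (opL _)).
rewrite (linear_scale _ (opL _)) !gl_diag.
by lmod K X; ring.
Qed.

Definition gl_fwd v (w : seq 'I_n) : X := foldr (fun j => op (up j, lo j)) v w.

Lemma gl_shift_move i m m' (a b : I) x :
  m'%:R = m%:R + (lo i == a)%:R - (lo i == b)%:R - (up i == a)%:R +
    (up i == b)%:R :> K ->
  gl_shift i m (op (a, b) x) = op (a, b) (gl_shift i m' x).
Proof.
move=> hm; rewrite gl_shift_comm /gl_shift hm.
rewrite !(linear_sub (opL _), linear_add (opL _), linear_scale _ (opL _)).
by lmod K X; ring.
Qed.

Section Span.
Variables (v : X) (ka : I -> K).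
Hypothesis e_v : forall i, op (lo i, up i) v = 0.
Hypothesis d_v : forall a, op (a, a) v = ka a *: v.

Let stable g := forall w (Q : X -> Prop), Q 0 ->
  (forall x y, Q x -> Q y -> Q (x + y)) -> (forall c x, Q x -> Q (c *: x)) ->
  (forall w', Q (gl_fwd v w')) -> Q (op g (gl_fwd v w)).

Let stable_bracket g g' g'' (c : K) :
  (forall x, op g'' x = op g (op g' x) + c *: op g' (op g x)) ->
  stable g -> stable g' -> stable g''.
Proof.
move=> gE hg hg' w Q Q0 QD QZ Qb.
have comp k k' : stable k -> stable k' -> Q (op k (op k' (gl_fwd v w))).
  move=> hk hk'; apply: (hk' w (fun x => Q (op k x))).
  + by rewrite (linear_zero (opL _)).
  + by move=> x y hx hy; rewrite (linear_add (opL _)); apply: QD.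
  + by move=> d x hx; rewrite (linear_scale _ (opL _)); apply: QZ.
  + by move=> w'; apply: hk.
by rewrite gE; apply: QD; [|apply: QZ]; apply: comp.
Qed.

Let diag_fwd a w : exists c, op (a, a) (gl_fwd v w) = c *: gl_fwd v w.
Proof.
elim: w => [|j w [c IH]]; first by exists (ka a); exact: d_v.
exists (c + ((a == up j)%:R - (a == lo j)%:R)); rewrite [LHS]gl_diag IH.
by rewrite (linear_scale _ (opL _)) -scalerDl.
Qed.

Let stable_diag a : stable (a, a).
Proof.
move=> w Q Q0 QD QZ Qb; have [c ->] := diag_fwd a w; exact: QZ.
Qed.

Let stable_f i : stable (up i, lo i).
Proof. by move=> w Q _ _ _ Qb; exact: (Qb (i :: w)). Qed.

Let stable_e i : stable (lo i, up i).
Proof.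
elim=> [|j w IH] Q Q0 QD QZ Qb; first by rewrite [op _ _]e_v.
rewrite [op _ _]gl_ef; apply: (QD).
  apply: (IH (fun x => Q (op (up j, lo j) x))).
  + by rewrite (linear_zero (opL _)).
  + by move=> x y hx hy; rewrite (linear_add (opL _)); apply: QD.
  + by move=> c x hx; rewrite (linear_scale _ (opL _)); apply: QZ.
  + by move=> w'; apply: (Qb (j :: w')).
apply: (QZ); have [c hc] := diag_fwd (lo i) w; have [d hd] := diag_fwd (up i) w.
rewrite /gl_shift [op _ _ in X in X - _]hc [op _ _]hd scale0r addr0 -scaleNr.
by apply: QD; apply: QZ; exact: Qb.
Qed.

(** The generators include all the E_ab, not only those of the simple roots. The others are
    brackets, E_(a,i+1) = [E_(a,i), E_(i,i+1)] and its transpose, treated by induction on the larger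
    index. *)
Lemma gl_span g : stable g.
Proof.
suff tri m (a b : I) : (a <= b)%N -> b = m :> nat -> stable (a, b) /\ stable (b, a).
  case: g => a b; case: (leqP a b) => [ab|/ltnW ba].
    by case: (tri b a b ab erefl).
  by case: (tri a b a ba erefl).
elim: m a b => [|m IH] a b ab bm.
  have -> : a = b by apply: val_inj => /=; lia.
  by split; exact: stable_diag.
have [ab'|ab'] := eqVneq a b; first by rewrite ab'; split; exact: stable_diag.
have mn : (m < n)%N by rewrite -ltnS -bm ltn_ord.
pose i := Ordinal mn; have bE : b = up i by apply: val_inj; exact: bm.
have aE : (a <= lo i)%N.
  by rewrite /= -ltnS -bm ltn_neqAle ab'.
have [h1 h2] := IH a (lo i) aE erefl.
rewrite bE; split.
- apply: (stable_bracket (g := (a, lo i)) (g' := (lo i, up i)) (c := -1)) => // x.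
  rewrite (gl_comm opP) /= eqxx (_ : (up i == a) = false) -?bE 1?eq_sym ?(negbTE ab') //.
  by rewrite /= mulr0n mulr1n; lmod K X; ring.
- apply: (stable_bracket (g := (up i, lo i)) (g' := (lo i, a)) (c := -1)) => // x.
  rewrite (gl_comm opP) /= eqxx (_ : (a == up i) = false) -?bE ?(negbTE ab') //.
  by rewrite /= mulr0n mulr1n; lmod K X; ring.
Qed.

End Span.

Definition gl_tens (g : I * I) (x : {ffun I -> X}) : {ffun I -> X} :=
  op_tens (op g) 1%:M x + op_tens id (V g) x.

Lemma gl_tensE g x b : gl_tens g x b = op g (x b) + (b == g.1)%:R *: x g.2.
Proof. by rewrite ffunE op_tens1 op_tens_delta. Qed.

Lemma gl_tens_module : gl_module gl_tens.
Proof.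
split=> [g|g g' x].
  move=> c x y; rewrite /gl_tens !op_tensL //.
  by rewrite scalerDr addrACA.
apply/ffunP => b.
have hT y z t (c d : K) : (y + c *: z - d *: t : {ffun I -> X}) b = y b + c *: z b - d *: t b.
  by rewrite !ffunE.
rewrite hT !gl_tensE !(linear_add (opL _), linear_scale _ (opL _)) (gl_comm opP) /=.
by lmod K X; ring.
Qed.

Local Notation VV := (rep_tens (V : rep (Ugl K n) n.+1) V).

Lemma gl_tens_coassoc g (z : I -> {ffun I -> X}) :
  \sum_(c <- @cop _ _ (Ugl K n) g)
    assemble (fun b => \sum_b' rep_word (U := Ugl K n) V c.2 b b' *:
      wact gl_tens c.1 (z b')) =
  \sum_(c <- @cop _ _ (Ugl K n) g)
    op_tens (wact op c.1) (rep_word VV c.2) (assemble z).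
Proof.
rewrite /= !big_cons !big_nil !addr0.
have gE y : gl_tens g y = op_tens (op g) 1%:M y + op_tens id (V g) y by [].
rewrite (assemble_op_tens2 _ _ gE) [X in _ + X](assemble_op_tens1 _ _ (@op_tens_id1 K n X)).
rewrite -addrA; congr (_ + _).
  by apply: eq_op_tens => //; exact: tensmx11.
rewrite -op_tens_mulD; apply: eq_op_tens => //.
by rewrite /rep_word /= /rep_tens big_cons big_seq1 /= !mulmx1.
Qed.

End Module.
End GlModuleTheory.

(** * The enveloping algebra of gl as an instance of [typeA] *)

Section ClassicalTypeA.
Variables (K : fieldType) (n : nat).
Hypothesis char0 : forall k, (0 < k)%N -> k%:R != 0 :> K.
Local Notation U := (Ugl K n).
Local Notation V := (@Ugl_vector K n).
Local Notation vop nu := (fun g => @vact K n U nu (@letter K (gen U) g)).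
Implicit Types nu : 'I_n.+1 -> K.

Let W nu : gl_module (vop nu) := verma_gl_module nu.

Definition gl_fgen (i : 'I_n) : gen U := (up i, lo i).
Definition gl_hop (i : 'I_n) (m : nat) : free_alg K (gen U) :=
  @letter K (gen U) (lo i, lo i) - @letter K (gen U) (up i, up i) + m%:R *: 1.

Lemma vact_gl_hop nu i m x : vact (gl_hop i m) x = gl_shift (vop nu) i m x.
Proof.
have gen (A X : lmodType K) (g : A -> X) a b o c x0 : linear g -> g o = x0 ->
    g (a - b + c *: o) = g a - g b + c *: x0.
  move=> gL <-.
  by rewrite (linear_add gL) (linear_sub gL) (linear_scale _ gL).
by apply: (gen _ _ (fun a => vact a x)); [exact: vact_linear|exact: vact1].
Qed.

Definition gl_br nu (a b : 'I_n.+1) (m : nat) : K := nu a - nu b + m%:R.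

Lemma gl_hop_hw nu i m :
  vact (gl_hop i m) (hw U nu) = gl_br nu (lo i) (up i) m *: hw U nu.
Proof.
apply: etrans (vact_gl_hop i m _) _.
have h a : vop nu (a, a) (hw U nu) = nu a *: hw U nu by exact: (@vact_cartan_hw K n U nu a).
exact: (@gl_shift_weight K n _ (vop nu) i m _ _ _ (h (lo i)) (h (up i))).
Qed.

Lemma gl_hw_coord nu : exists phi : verma U nu -> K,
  [/\ linear (phi : verma U nu -> K^o), phi (hw U nu) = 1,
      forall i x, phi (vact (@letter K (gen U) (gl_fgen i)) x) = 0,
      forall i x, phi (cact i x) = chi U (nu i) * phi x &
      (forall i m x, phi (vact (gl_hop i m) x) =
         gl_br nu (lo i) (up i) m * phi x) /\
      (forall (i : 'I_n) x, phi (vact 1 x) = 1 * phi x)].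
Proof.
have [X [op [v [phi [opP op_e op_d [phiL phi_v phi_f phi_d]]]]]] := ex_gl_coord nu.
have [||i|i|Phi [PhiL Phi_hw PhiE]] := @verma_univ K n U X op nu v.
- exact: gl_lin opP.
- by move=> r x; exact: gl_module_rel.
- by apply: op_e; rewrite /lo /up /= /bump /= add1n.
- exact: op_d.
have cE i x : phi (Phi (vop nu (i, i) x)) = nu i * phi (Phi x).
  exact: etrans (congr1 phi (PhiE (i, i) x)) (phi_d i _).
exists (fun x => phi (Phi x)); split.
- by apply: linear_comp phiL PhiL.
- by rewrite Phi_hw.
- move=> i x; apply: etrans (congr1 phi (PhiE (gl_fgen i) x)) _.
  by apply: phi_f; rewrite /lo /up /= /bump /= add1n.
- exact: cE.
split=> [i m x|i x]; last by rewrite mul1r; exact: (congr1 (fun y => phi (Phi y)) (vact1 x)).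
apply: etrans (congr1 (fun y => phi (Phi y)) (vact_gl_hop i m x)) _.
have phPL : linear ((fun x => phi (Phi x)) : verma U nu -> K^o).
  by apply: linear_comp phiL PhiL.
have gen (Y : lmodType K) (g : Y -> K) (y z t : Y) a b c :
    linear (g : Y -> K^o) -> g y = a * g t -> g z = b * g t ->
    g (y - z + c *: t) = (a - b + c) * g t.
  move=> gL ha hb.
  have gD u w : g (u + w) = g u + g w by exact: (linear_add gL).
  have gB u w : g (u - w) = g u - g w by exact: (linear_sub gL).
  have gZ d u : g (d *: u) = d * g u by exact: (linear_scale d gL).
  by rewrite gD gB gZ ha hb; ring.
exact: (gen _ _ _ _ _ _ _ _ phPL (cE (lo i) x) (cE (up i) x)).
Qed.

Lemma gl_fact_ind nu (P : verma U nu -> Prop) :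
  P 0 -> (forall x y, P x -> P y -> P (x + y)) ->
  (forall c x, P x -> P (c *: x)) -> P (hw U nu) ->
  (forall i x, P x -> P (vact (@letter K (gen U) (gl_fgen i)) x)) ->
  forall x, P x.
Proof.
move=> P0 PD PZ Phw Pf.
apply: (@verma_span K n U nu _ (gl_fwd (vop nu) (hw U nu)) [::]) => //.
  move=> g w Q Q0 QD QZ Qb.
  apply: (@gl_span K n _ (vop nu) (W nu) _ nu) => //.
  - by move=> i; exact: (@vact_raise_hw K n U nu i).
  - by move=> i; exact: (@vact_cartan_hw K n U nu i).
by elim=> // i w; exact: Pf.
Qed.

Lemma gl_fact_weight nu mu j (x : verma U nu) : verma_weight mu x ->
  verma_weight (fun i => mu i - simple_root K j i)
    (vact (@letter K (gen U) (gl_fgen j)) x).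
Proof.
move=> hx i; apply: etrans (gl_diag (W nu) i (up j) (lo j) x) _.
apply: etrans (congr1 (fun y => vact (@letter K (gen U) (gl_fgen j)) y + _) (hx i)) _.
have gen (X : lmodType K) (g : X -> X) y (a c d : K) : linear g ->
    g (a *: y) + (d - c) *: g y = (a - (c - d)) *: g y.
  by move=> gL; rewrite (linear_scale _ gL); lmod K X; ring.
exact: (gen (verma U nu) _ x _ _ _ (vactL _)).
Qed.

Lemma gl_tens_act nu : verma_tens_act (U := U) V (nu := nu) = gl_tens (vop nu).
Proof.
apply/funext => g; apply/funext => x; apply: etrans (big_cons _ _ _ _ _ _) _.
rewrite /= big_seq1.
apply: (congr2 +%R); apply: eq_op_tens => //.
- by move=> y; exact: (@vact_word K n U nu [::] y).
- exact: mulmx1.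
Qed.

Lemma gl_tens_rel nu r (x : {ffun 'I_n.+1 -> verma U nu}) : Ugl_rel r ->
  free_act (verma_tens_act (U := U) V (nu := nu)) r x = 0.
Proof.
move=> hr; apply: gl_module_rel hr; rewrite gl_tens_act.
exact: gl_tens_module.
Qed.

Lemma gl_comp_act lam nu1 nu2 Phi1 Phi2 :
  linear (Phi1 : verma U lam -> {ffun 'I_n.+1 -> verma U nu1}) ->
  linear (Phi2 : verma U nu1 -> {ffun 'I_n.+1 -> verma U nu2}) ->
  (forall g x, Phi1 (vact (letter K g) x) = verma_tens_act (U := U) V g (Phi1 x)) ->
  (forall g x, Phi2 (vact (letter K g) x) = verma_tens_act (U := U) V g (Phi2 x)) ->
  forall g x, Phi_comp Phi2 Phi1 (vact (letter K g) x) =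
    verma_tens_act (rep_tens (U := U) V V) g (Phi_comp Phi2 Phi1 x).
Proof.
move=> _ Phi2L Phi1E Phi2E g x.
apply: etrans (Phi_comp_act Phi2L Phi1E Phi2E g x) _.
rewrite gl_tens_act; apply: etrans (gl_tens_coassoc _ _ _) _.
by apply: eq_bigr => c _; apply: eq_op_tens => // y; apply: esym; exact: vact_word.
Qed.

Lemma gl_tens_coord nu g (x : {ffun 'I_n.+1 -> verma U nu}) b :
  verma_tens_act (U := U) V g x b =
  vact (@letter K (gen U) g) (x b) + (b == g.1)%:R *: x g.2.
Proof.
exact: etrans (congr1 (fun T => fun_of_fin (T g x) b) (gl_tens_act nu))
  (gl_tensE _ _ _ _).
Qed.

Lemma gl_tens_e nu i (x : {ffun 'I_n.+1 -> verma U nu}) b :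
  verma_tens_act (U := U) V (raise U i) x b =
  1 *: eact i (x b) + (b == lo i)%:R *: x (up i).
Proof. by rewrite scale1r; exact: gl_tens_coord. Qed.

Lemma gl_tens_f nu i (x : {ffun 'I_n.+1 -> verma U nu}) b :
  verma_tens_act (U := U) V (gl_fgen i) x b =
  vact (@letter K (gen U) (gl_fgen i)) (x b) +
  (b == up i)%:R *: vact 1 (x (lo i)).
Proof.
apply: etrans (gl_tens_coord _ _ _) _.
exact: (congr1 (fun y => vact (@letter K (gen U) (gl_fgen i)) (x b) + (b == up i)%:R *: y)
  (esym (vact1 (x (lo i))))).
Qed.

Lemma gl_tens_cartan nu i (x : {ffun 'I_n.+1 -> verma U nu}) b a :
  cact i (x b) = chi U (a - (i == b)%:R) *: x b ->
  verma_tens_act (U := U) V (cartan U i) x b = chi U a *: x b.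
Proof.
move=> h; apply: etrans (gl_tens_coord (i, i) x b) _.
apply: etrans (congr1 (fun y => y + (b == i)%:R *: x i) h) _.
have gen (X : lmodType K) (y : 'I_n.+1 -> X) :
    (a - (i == b)%:R) *: y b + (b == i)%:R *: y i = a *: y b.
  by case: (b =P i) => [->|/eqP/negbTE bi];
    rewrite ?eqxx 1?[i == b]eq_sym ?bi ?mulr0n ?mulr1n; lmod K X; ring.
exact: (gen _ (fun b => x b)).
Qed.

Lemma gl_hop_move nu (i : 'I_n) m m' (a b : 'I_n.+1) (x : verma U nu) :
  m'%:R = m%:R + (lo i == a)%:R - (lo i == b)%:R - (up i == a)%:R +
    (up i == b)%:R :> K ->
  vact (gl_hop i m) (vact (@letter K (gen U) (a, b)) x) =
  vact (@letter K (gen U) (a, b)) (vact (gl_hop i m') x).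
Proof.
move=> hm; apply: etrans (vact_gl_hop i m _) _.
apply: etrans (gl_shift_move (W nu) x hm) _.
exact: (congr1 (vact (@letter K (gen U) (a, b))) (esym (vact_gl_hop i m' x))).
Qed.

Let lo_up_lo (i j : 'I_n) : (i.+1 < j)%N || (j.+1 < i)%N ->
  [/\ (lo i == lo j) = false, (lo i == up j) = false,
      (up i == lo j) = false & (up i == up j) = false].
Proof.
move=> ij; rewrite lo_eq up_eq lo_eq_up up_eq_lo -val_eqE /=.
by split; apply/negP => /eqP h; lia.
Qed.

Let near_cases (i j : 'I_n) : (i.+1 == j) || (j.+1 == i) ->
  [/\ (lo i == lo j) = false, (up i == up j) = false &
      (lo i == up j)%:R = 1 - (up i == lo j)%:R :> K].
Proof.
rewrite lo_eq up_eq lo_eq_up up_eq_lo -val_eqE /= => ij.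
split; try by apply/negP => /eqP h; lia.
rewrite [j.+1 == _]eq_sym in ij.
case/orP: ij => /eqP h.
  have -> : (i == j.+1 :> nat) = false by apply/negP => /eqP; lia.
  by rewrite h eqxx mulr1n subrr.
have -> : (i.+1 == j :> nat) = false by apply/negP => /eqP; lia.
by rewrite h eqxx subr0.
Qed.

Definition gl_typeA : typeA (U := U) V.
Proof.
apply: (@TypeA K n U V gl_fgen gl_hop (fun=> 1) (fun b => b%:R)
  (fun _ _ => 1) 1 gl_br (fun _ _ _ => 1)).
- move=> nu i j x; apply: etrans (gl_ef (W nu) i j x) _.
  by congr (_ + _ *: _); exact: esym (vact_gl_hop i 0 x).
- move=> nu i j x ij; apply: (gl_comm_far (W nu)).
    by rewrite eq_sym lo_eq_up; lia.
  by rewrite eq_sym lo_eq_up; lia.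
- move=> nu i j x ij; apply: (gl_comm_far (W nu)).
    by rewrite lo_eq_up; lia.
  by rewrite lo_eq_up; lia.
- move=> nu i j m x /lo_up_lo [h1 h2 h3 h4]; apply: gl_hop_move.
  by rewrite h1 h2 h3 h4; ring.
- move=> nu i j m x /near_cases [h1 h2 h3]; apply: gl_hop_move.
  by rewrite h1 h2 h3 -natr1 !mulr0n; ring.
- move=> nu i j m x /lo_up_lo [h1 h2 h3 h4]; apply: gl_hop_move.
  by rewrite h1 h2 h3 h4; ring.
- move=> nu i j m x /near_cases [h1 h2 h3]; apply: gl_hop_move.
  by rewrite h1 h2 h3 -natr1 !mulr0n; ring.
- exact: gl_hop_hw.
- exact: gl_hw_coord.
- exact: gl_fact_ind.
- exact: gl_fact_weight.
- move=> a k k0 /=; apply/eqP => h; have /eqP := char0 k0; apply.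
  by apply: oppr_inj; rewrite oppr0; apply: (addrI a); rewrite addr0.
- by [].
- exact: oner_neq0.
- move=> i; apply/matrixP => a b; rewrite !mxE /= [b == i]eq_sym.
  have [->|ab] := eqVneq a b; first by rewrite [b == i]eq_sym andbb mulr1n.
  by have [<-|_] := eqVneq a i; rewrite ?(negbTE ab).
- by [].
- by move=> i b; exact: oner_neq0.
- exact: oner_neq0.
- exact: gl_tens_e.
- exact: gl_tens_f.
- exact: gl_tens_cartan.
- exact: gl_tens_rel.
- exact: gl_comp_act.
- by move=> nu a b d m p; rewrite /gl_br -!natr1 natrD; ring.
- by move=> nu a b d; rewrite mulr1.
- by [].
Defined.

End ClassicalTypeA.

(** * Weight-zero matrices and exchange matrices *)

Section WeightZero.
Variables (K : fieldType) (m : nat).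
Implicit Types d o : 'I_m -> 'I_m -> K.

Lemma wt0_mxE d o a b a' b' :
  wt0_mx d o (mxtens_index (a, b)) (mxtens_index (a', b')) =
  ((a == a') && (b == b'))%:R * d a' b' +
  ((a' != b') && (a == b') && (b == a'))%:R * o a' b'.
Proof. by rewrite !mxE !mxtens_indexK. Qed.

Lemma tens_mxP (A B : 'M[K]_(m * m)) :
  (forall a b a' b', A (mxtens_index (a, b)) (mxtens_index (a', b')) =
                     B (mxtens_index (a, b)) (mxtens_index (a', b'))) -> A = B.
Proof.
move=> h; apply/matrixP => i j; rewrite -(mxtens_unindexK i) -(mxtens_unindexK j).
by case: (mxtens_unindex i) => a b; case: (mxtens_unindex j) => a' b'; exact: h.
Qed.

Lemma EE_index (a b c d : 'I_m) (k l k' l' : 'I_m) :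
  EE a b c d (mxtens_index (k, l)) (mxtens_index (k', l')) =
  ((k == a) && (k' == b) && (l == c) && (l' == d))%:R :> K.
Proof. by rewrite !mxE !mxtens_indexK /= -natrM mulnb !andbA. Qed.

Lemma wt0_mx_sum d o : wt0_mx d o =
  \sum_(a < m) \sum_(b < m) d a b *: EE a a b b +
  \sum_(a < m) \sum_(b < m | b != a) o a b *: EE b a a b.
Proof.
apply: tens_mxP => k l k' l'; rewrite wt0_mxE mxE !summxE; congr (_ + _).
  rewrite (bigD1 k') //= summxE (bigD1 l') //= !big1 ?addr0.
  - by rewrite mxE EE_index !eqxx !andbT mulrC.
  - move=> a ak; rewrite summxE big1 // => b _; rewrite mxE EE_index.
    by rewrite [k' == a]eq_sym (negbTE ak) !andbF mulr0.
  - move=> b bl; rewrite mxE EE_index.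
    by rewrite [l' == b]eq_sym (negbTE bl) !andbF mulr0.
rewrite (bigD1 k') //= summxE [X in _ + X]big1 ?addr0; last first.
  move=> a ak; rewrite summxE big1 // => b _; rewrite mxE EE_index.
  by rewrite [k' == a]eq_sym (negbTE ak) !andbF mulr0.
have [kl|kl] := eqVneq k' l'.
  rewrite mul0r big1 // => b bk; rewrite mxE EE_index.
  by rewrite -kl [k' == b]eq_sym (negbTE bk) !andbF mulr0.
rewrite (bigD1 l') /=; last by rewrite eq_sym.
rewrite big1 ?addr0; first by rewrite mxE EE_index !eqxx !andbT mulrC.
move=> b /andP [_ bl]; rewrite mxE EE_index.
by rewrite [l' == b]eq_sym (negbTE bl) !andbF mulr0.
Qed.

Lemma eq_wt0_mx d o d' o' : (forall a b, d a b = d' a b) ->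
  (forall a b, a != b -> o a b = o' a b) -> wt0_mx d o = wt0_mx d' o'.
Proof.
move=> hd ho; apply: tens_mxP => k l k' l'; rewrite !wt0_mxE hd.
by have [//|kl] := eqVneq k' l'; rewrite ?mul0r ?ho.
Qed.

Lemma wt0_mx1 : wt0_mx (fun _ _ => 1) (fun _ _ => 0) = 1%:M :> 'M[K]_(m * m).
Proof.
apply: tens_mxP => k l k' l'.
by rewrite wt0_mxE mulr0 addr0 mulr1 !mxE (can_eq (@mxtens_indexK m m)) -pair_eqE.
Qed.

Lemma sum_index (F : 'I_(m * m) -> K) :
  \sum_i F i = \sum_a \sum_b F (mxtens_index (a, b)).
Proof.
rewrite pair_bigA /= (reindex (@mxtens_index m m)) /=.
  by apply: eq_bigr => -[].
by exists (@mxtens_unindex m m) => x _; [exact: mxtens_indexK|exact: mxtens_unindexK].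
Qed.

Lemma wt0_mx_col (A : 'M[K]_(m * m)) d o i a' b' :
  (A *m wt0_mx d o) i (mxtens_index (a', b')) =
  A i (mxtens_index (a', b')) * d a' b' +
  (a' != b')%:R * (A i (mxtens_index (b', a')) * o a' b').
Proof.
rewrite mxE sum_index.
under eq_bigr => a _ do under eq_bigr => b _ do rewrite wt0_mxE mulrDr.
under eq_bigr => a _ do rewrite big_split.
rewrite big_split /=; congr (_ + _).
  rewrite (bigD1 a') //= (bigD1 b') //= !big1 ?addr0.
  - by rewrite !eqxx mul1r.
  - by move=> a aa; rewrite big1 // => b _; rewrite (negbTE aa) mul0r mulr0.
  - by move=> b bb; rewrite (negbTE bb) andbF mul0r mulr0.
rewrite (bigD1 b') //= (bigD1 a') //= !big1 ?addr0.
- by rewrite !eqxx !andbT mulrCA.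
- by move=> a aa; rewrite big1 // => b _; rewrite (negbTE aa) andbF mul0r mulr0.
- by move=> b bb; rewrite (negbTE bb) andbF mul0r mulr0.
Qed.

(** Multiplication of blocks on the planes spanned by v_a (x) v_b and v_b (x) v_a; the factor a != b
    guards the lines v_a (x) v_a, where [o] is ignored. *)
Lemma wt0_mxM d o d' o' : wt0_mx d o *m wt0_mx d' o' =
  wt0_mx (fun a b => d a b * d' a b + (a != b)%:R * (o b a * o' a b))
         (fun a b => o a b * d' a b + d b a * o' a b).
Proof.
apply: tens_mxP => k l a b; rewrite wt0_mx_col !wt0_mxE.
have [<-|ab] := eqVneq a b; first by rewrite !mul0r !addr0 mulrA.
by rewrite /= !mul1r; ring.
Qed.

Lemma mx21_wt0 d o : mx21 (wt0_mx d o) = wt0_mx (fun a b => d b a) (fun a b => o b a).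
Proof.
have flipE : flip_mx K m = wt0_mx (fun a b => (a == b)%:R) (fun _ _ => 1).
  apply: tens_mxP => k l a b; rewrite wt0_mxE !mxE !mxtens_indexK /=.
  by have [<-|ab] := eqVneq a b; rewrite mulr1 /=; ring.
rewrite /mx21 flipE !wt0_mxM; apply: eq_wt0_mx => a b.
  by have [<-|ab] := eqVneq a b; rewrite /= ?mulr0n ?mulr1n; ring.
by move=> /negbTE ab; rewrite [b == a]eq_sym ab /= ?mulr0n; ring.
Qed.

End WeightZero.

Section Exchange.
Variables (K : fieldType) (n : nat) (U : hopf_pres K n) (V : rep U n.+1).
Variables (lam : 'I_n.+1 -> K) (q h : K) (c : 'I_n.+1 -> 'I_n.+1 -> K).
Hypothesis J_wt0 : fusion_matrix V V lam =
  wt0_mx (fun _ _ => 1) (fun a b => (a < b)%N%:R * c a b).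

(** On each such plane J is unipotent triangular, so its inverse is obtained by changing the sign of
    [c]; conjugation by the flip makes the other factors triangular in the opposite sense, and the
    product is read off. *)
Lemma exchange_matrix_wt0 :
  exchange_matrix V (wt0_mx (fun a b => if a == b then q else 1)
                            (fun a b => (b < a)%N%:R * h)) lam =
  wt0_mx (fun a b => if a == b then q else if (a < b)%N then 1
                     else 1 + h * c b a - c b a ^+ 2)
         (fun a b => if (a < b)%N then h - c a b else c b a).
Proof.
rewrite /exchange_matrix J_wt0 !mx21_wt0.
set J := wt0_mx _ (fun a b => (a < b)%N%:R * c a b).
pose J' := wt0_mx (fun _ _ => 1) (fun a b => - ((a < b)%N%:R * c a b)).
have lt_split (a b : 'I_n.+1) : a != b ->
    (a < b)%N /\ (b < a)%N = false \/ (b < a)%N /\ (a < b)%N = false.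
  by rewrite -val_eqE /= => ab; case: ltngtP ab; auto.
have J'J : J' *m J = 1%:M.
  rewrite wt0_mxM -wt0_mx1; apply: eq_wt0_mx => a b.
    have [_|/lt_split [[-> ->]|[-> ->]]] := eqVneq a b; rewrite /= ?mulr0n ?mulr1n; ring.
  by move=> _; ring.
have -> : invmx J = J'.
  by have [_ JU] := mulmx1_unit J'J; rewrite -[invmx J]mul1mx -J'J mulmxK.
rewrite !wt0_mxM; apply: eq_wt0_mx => a b.
  have [->|ab] := eqVneq a b; first by rewrite ?eqxx /= ?mulr0n; ring.
  by have [[-> ->]|[-> ->]] := lt_split _ _ ab; rewrite /= ?mulr0n ?mulr1n; ring.
move=> ab; rewrite [b == a]eq_sym (negbTE ab) /=.
by have [[-> ->]|[-> ->]] := lt_split _ _ ab; rewrite /= ?mulr0n ?mulr1n; ring.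
Qed.

End Exchange.

Section Sums.
Variables (K : fieldType) (n : nat).
Implicit Types d o : 'I_n.+1 -> 'I_n.+1 -> K.

Lemma sum_lt (X : lmodType K) (F : 'I_n.+1 -> 'I_n.+1 -> X) o :
  \sum_(a < n.+1) \sum_(b < n.+1 | b != a) ((a < b)%N%:R * o a b) *: F a b =
  \sum_(a < n.+1) \sum_(b < n.+1 | (a < b)%N) o a b *: F a b.
Proof.
apply: eq_bigr => a _; rewrite big_mkcond [RHS]big_mkcond; apply: eq_bigr => b _.
rewrite -val_eqE /=; case: ltngtP => // _; rewrite ?mul1r ?mul0r ?scale0r //.
Qed.

Lemma sum_trichotomy (X : lmodType K) (F : 'I_n.+1 -> 'I_n.+1 -> X) d :
  \sum_(a < n.+1) \sum_(b < n.+1) d a b *: F a b =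
  \sum_(a < n.+1) d a a *: F a a +
  \sum_(a < n.+1) \sum_(b < n.+1 | (a < b)%N) d a b *: F a b +
  \sum_(a < n.+1) \sum_(b < n.+1 | (b < a)%N) d a b *: F a b.
Proof.
rewrite -!big_split /=; apply: eq_bigr => a _.
rewrite (bigD1 a) //= -addrA; congr (_ + _).
rewrite (bigID (fun b : 'I_n.+1 => (a < b)%N)) /=; congr (_ + _);
  by apply: eq_bigl => b; rewrite -val_eqE /=; case: ltngtP.
Qed.

Lemma wt0_lt_sum o :
  wt0_mx (fun _ _ => 1) (fun a b => (a < b)%N%:R * o a b) =
  \sum_(a < n.+1) \sum_(b < n.+1) EE a a b b +
  \sum_(a < n.+1) \sum_(b < n.+1 | (a < b)%N) o a b *: EE b a a b.
Proof.
rewrite wt0_mx_sum sum_lt; congr (_ + _); apply: eq_bigr => a _.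
by apply: eq_bigr => b _; rewrite scale1r.
Qed.

Lemma wt0_exchange_sum q d o :
  wt0_mx (fun a b => if a == b then q else if (a < b)%N then 1 else d a b) o =
  q *: (\sum_(a < n.+1) EE a a a a) +
  \sum_(a < n.+1) \sum_(b < n.+1 | b != a) o a b *: EE b a a b +
  \sum_(a < n.+1) \sum_(b < n.+1 | (a < b)%N) EE a a b b +
  \sum_(a < n.+1) \sum_(b < n.+1 | (b < a)%N) d a b *: EE a a b b.
Proof.
rewrite wt0_mx_sum sum_trichotomy -!addrA scaler_sumr; congr (_ + _).
  by apply: eq_bigr => a _; rewrite eqxx.
rewrite addrA addrC; congr (_ + (_ + _)); apply: eq_bigr => a _; apply: eq_bigr => b.
  by move=> ab; rewrite -val_eqE /= ltn_eqF // ab scale1r.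
by move=> ba; rewrite -val_eqE /= gtn_eqF // ltnNge ltnW.
Qed.

Lemma Uq_Rmatrix_wt0 (q : K) : Uq_Rmatrix n q =
  wt0_mx (fun a b => if a == b then q else 1) (fun a b => (b < a)%N%:R * (q - q^-1)).
Proof.
rewrite wt0_mx_sum /Uq_Rmatrix scaler_sumr -big_split /=; congr (_ + _).
  apply: eq_bigr => a _; rewrite [RHS](bigD1 a) //= eqxx; congr (_ + _).
  by apply: eq_bigr => b /negbTE; rewrite eq_sym => ->; rewrite scale1r.
rewrite (exchange_big_dep xpredT) //=; apply: eq_bigr => a _.
rewrite big_mkcond [RHS]big_mkcond; apply: eq_bigr => b _.
rewrite -val_eqE /=; case: ltngtP => // _; rewrite ?mul1r ?mul0r ?scale0r //.
Qed.

End Sums.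

(** * The formulas for J and R in the quantum case *)

Section QuantumFusion.
Variables (K : fieldType) (n : nat) (q : K) (ch : K -> K).
Hypothesis ch0 : ch 0 = 1.
Hypothesis ch1 : ch 1 = q.
Hypothesis chD : forall a b, ch (a + b) = ch a * ch b.
Hypothesis q_root : forall m, (0 < m)%N -> q ^+ m != 1.
Variable lam : 'I_n.+1 -> K.
Let T := uq_typeA n ch0 ch1 chD q_root.
Let q0 : q != 0 := q_neq0 ch0 ch1 chD.
Let c0 := ch_neq0 ch0 chD.

(** Depends on nu only through the values of [ch], which are all that [weight_step] controls, and
    allows every integer shift m, which absorbs the change caused by a step. *)
Definition uq_regular (nu : 'I_n.+1 -> K) : Prop :=
  forall a b, a != b -> forall m : int, (q ^ m * (ch (nu a) / ch (nu b))) ^+ 2 != 1.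

Hypothesis lam_regular : uq_regular lam.

Definition uq_jc (a b : 'I_n.+1) : K :=
  (q^-1 - q) / (ch (lam a - lam b + b%:R - a%:R) ^+ 2 - 1).

Lemma uq_step (nu nu' : 'I_n.+1 -> K) (j : 'I_n.+1) : weight_step T nu nu' j ->
  forall i, ch (nu' i) = ch (nu i) / q ^+ (i == j).
Proof.
move=> h i; have <- : ch (nu i - nu' i) = q ^+ (i == j) := h i.
by rewrite (chB ch0 chD) invf_div mulrC divfK.
Qed.

(** The bracket is (x - x^-1) / (q - q^-1) and vanishes only for x^2 = 1. *)
Lemma uq_regular_br nu (a b : 'I_n.+1) m : uq_regular nu -> (a < b)%N ->
  br T nu a b m != 0.
Proof.
move=> hnu ab; have ab' : a != b by rewrite -val_eqE /= ltn_eqF.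
have := hnu a b ab' m; rewrite -exprnP; set x := q ^+ m * _ => hx.
have x0 : x != 0 by rewrite !mulf_neq0 ?invr_neq0 ?expf_neq0.
have -> : br T nu a b m = (q - q^-1)^-1 * (x - x^-1).
  by rewrite /x !invfM invrK [(ch (nu a))^-1 * _]mulrC.
rewrite mulf_neq0 ?invr_neq0 ?(qq_neq0 ch0 ch1 chD q_root) // subr_eq0.
apply: contra hx => /eqP hx; by rewrite expr2 {1}hx mulVf.
Qed.

Lemma uq_regular_step nu nu' j : uq_regular nu -> weight_step T nu nu' j ->
  uq_regular nu'.
Proof.
move=> hnu /uq_step h a b ab m; rewrite !h.
rewrite (_ : _ * _ = q ^ (m + (b == j)%:Z - (a == j)%:Z) * (ch (nu a) / ch (nu b))).
  exact: hnu.
rewrite !expfzDr // -invr_expz -!exprnP.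
by field; rewrite ?c0 ?expf_neq0.
Qed.

(** Put x = q^(lam_k - lam_j + j - k). The product of [tau] and the power of 1 / [kap] is x^-1 and
    the bracket is (x - x^-1) / (q - q^-1), so the quotient is (q - q^-1) / (x^2 - 1). *)
Lemma uq_jcE nu1 nu2 (j k : 'I_n.+1) : weight_step T lam nu1 j ->
  weight_step T nu1 nu2 k -> (k < j)%N ->
  - (tau T nu2 k j * (kap T)^-1 ^+ (j - k) / br T nu1 k j (j - k).-1) = uq_jc k j.
Proof.
move=> /uq_step h1 /uq_step h2 kj.
have tauE nu a b : tau T nu a b = ch (nu b) / ch (nu a) by [].
have brE nu a b m : br T nu a b m = (q - q^-1)^-1 *
  (q ^+ m * (ch (nu a) / ch (nu b)) - q ^- m * (ch (nu b) / ch (nu a))) by [].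
have nkj : (k == j) = false by rewrite -val_eqE /= ltn_eqF.
(* From lam to nu2 both coordinates j and k drop by one, so their difference is that of lam. *)
have -> : tau T nu2 k j = ch (lam j) / ch (lam k).
  rewrite tauE !h2 !h1 !eqxx nkj [j == k]eq_sym nkj expr0 !divr1 expr1.
  by field; rewrite ?c0 ?q0.
have := lam_regular (negbT nkj) (j - k)%N%:Z; rewrite -exprnP.
(* At nu1 only coordinate j has dropped by one, which turns the shift j - k - 1 into j - k. *)
have -> : br T nu1 k j (j - k).-1 = (q - q^-1)^-1 *
   (q ^+ (j - k) * (ch (lam k) / ch (lam j)) - (q ^+ (j - k) * (ch (lam k) / ch (lam j)))^-1).
  rewrite brE !h1 !eqxx nkj expr0 expr1 divr1.
  have -> : (j - k)%N = (j - k).-1.+1 by rewrite prednK // subn_gt0.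
  rewrite exprSr /=; congr (_ * (_ - _)); field; by rewrite ?c0 ?q0 ?expf_neq0.
rewrite /uq_jc.
have -> : ch (lam k - lam j + j%:R - k%:R) = q ^+ (j - k) * (ch (lam k) / ch (lam j)).
  rewrite -addrA -natrB ?(ltnW kj) // chD (chB ch0 chD) (ch_nat ch0 ch1 chD).
  exact: mulrC.
have -> : kap T = q by [].
rewrite exprVn => hx.
set s := q ^+ (j - k) in hx *; set A := ch (lam k) in hx *; set B := ch (lam j) in hx *.
have s0 : s != 0 by rewrite expf_neq0.
have A0 : A != 0 := c0 _; have B0 : B != 0 := c0 _.
have x0 : s * (A / B) != 0 by rewrite !mulf_neq0 ?invr_neq0.
have <- : (s * (A / B))^-1 = B / A * s^-1 by rewrite invfM invf_div mulrC.
set x := s * (A / B) in hx x0 *.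
have qq := qq_neq0 ch0 ch1 chD q_root.
move: hx x0; rewrite -[x ^+ 2 == 1]subr_eq0; move: x => x hx x0.
have -> : x - x^-1 = x^-1 * (x ^+ 2 - 1) by rewrite mulrBr mulr1 expr2 mulKf.
rewrite -[q^-1 - q]opprB; move: (x ^+ 2 - 1) (q - q^-1) hx qq => y h y0 h0.
by field; rewrite ?x0 ?y0 ?h0.
Qed.

Lemma uq_fusion : fusion_matrix (U := Uqc n q ch) (Uq_vector q) (Uq_vector q) lam =
  wt0_mx (fun _ _ => 1) (fun a b => (a < b)%N%:R * uq_jc a b).
Proof.
exact: (fusion_matrix_wt0 uq_regular_br uq_regular_step lam_regular uq_jcE).
Qed.

Let ch2 x : ch (2%:R * x) = ch x ^+ 2.
Proof. by rewrite mulr_natl mulr2n chD. Qed.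

Let jc_neq0 (a b : 'I_n.+1) : a != b ->
  ch (lam a - lam b + b%:R - a%:R) ^+ 2 - 1 != 0.
Proof.
move=> ab; rewrite subr_eq0; have := lam_regular ab (b%:Z - a%:Z).
rewrite expfzDr // -invr_expz -!exprnP -!(ch_nat ch0 ch1 chD).
by rewrite !(chB ch0 chD) chD (chB ch0 chD) mulrC mulrA.
Qed.

Lemma uq_fusion_sum :
  fusion_matrix (U := Uqc n q ch) (Uq_vector q) (Uq_vector q) lam =
  \sum_(a < n.+1) \sum_(b < n.+1) EE a a b b
  + \sum_(a < n.+1) \sum_(b < n.+1 | (a < b)%N)
      ((q^-1 - q) / (ch (2%:R * (lam a - lam b + b%:R - a%:R)) - 1)) *: EE b a a b.
Proof.
apply: etrans uq_fusion (etrans (wt0_lt_sum _) _); congr (_ + _).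
by apply: eq_bigr => a _; apply: eq_bigr => b _; rewrite ch2.
Qed.

Lemma uq_exchange_sum :
  exchange_matrix (U := Uqc n q ch) (Uq_vector q) (Uq_Rmatrix n q) lam =
  q *: (\sum_(a < n.+1) EE a a a a)
  + \sum_(a < n.+1) \sum_(b < n.+1 | b != a)
      ((q^-1 - q) / (ch (2%:R * (lam b - lam a + a%:R - b%:R)) - 1)) *: EE b a a b
  + \sum_(a < n.+1) \sum_(b < n.+1 | (a < b)%N) EE a a b b
  + \sum_(a < n.+1) \sum_(b < n.+1 | (b < a)%N)
      ((ch (2%:R * (lam b - lam a + a%:R - b%:R)) - q ^- 2)
       * (ch (2%:R * (lam b - lam a + a%:R - b%:R)) - q ^+ 2)
       / (ch (2%:R * (lam b - lam a + a%:R - b%:R)) - 1) ^+ 2) *: EE a a b b.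
Proof.
rewrite Uq_Rmatrix_wt0 -wt0_exchange_sum.
apply: etrans (exchange_matrix_wt0 _ _ uq_fusion) _; apply: eq_wt0_mx => a b.
  have [//|ab] := eqVneq a b; case: ifP => // _.
  (* With h = q - q^-1 and c = - h / (y - 1), the entry 1 + h c - c^2 equals 1 - h^2 y / (y - 1)^2 =
     (y - q^-2)(y - q^2) / (y - 1)^2. *)
  rewrite ch2 /uq_jc; have := jc_neq0 (b := a) (a := b).
  rewrite eq_sym => /(_ ab); move: (ch _ ^+ 2) => y y0.
  by field; rewrite ?q0 ?y0.
(* For a < b the entry is h minus the coefficient of J. Exchanging a and b inverts y, so it is given
   by the same expression as the entry for a > b. *)
move=> ab; rewrite ch2 /uq_jc; case: ifP => // _.
have := jc_neq0 ab.
have -> : lam b - lam a + a%:R - b%:R = - (lam a - lam b + b%:R - a%:R) by ring.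
move: (_ - a%:R) => z; rewrite (chN ch0 chD) exprVn.
have : ch z ^+ 2 != 0 by rewrite expf_neq0.
move: (ch z ^+ 2) => y y0 y1; have y2 : 1 - y != 0 by rewrite -opprB oppr_eq0.
by field; rewrite y0 mulN1r y2 q0.
Qed.

End QuantumFusion.

(** * The formulas for J and R in the classical case *)

Section ClassicalFusion.
Variables (K : fieldType) (n : nat).
Hypothesis char0 : forall k, (0 < k)%N -> k%:R != 0 :> K.
Variable lam : 'I_n.+1 -> K.
Let T := gl_typeA n char0.

Definition gl_regular (nu : 'I_n.+1 -> K) : Prop :=
  forall a b, a != b -> forall m : int, nu a - nu b != m%:~R.

Hypothesis lam_regular : gl_regular lam.

Definition gl_jc (a b : 'I_n.+1) : K := 1 / (lam b - lam a + a%:R - b%:R).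

Lemma gl_step (nu nu' : 'I_n.+1 -> K) (j : 'I_n.+1) : weight_step T nu nu' j ->
  forall i, nu' i = nu i - (i == j)%:R.
Proof.
move=> h i; have <- : nu i - nu' i = (i == j)%:R := h i.
by rewrite subKr.
Qed.

Lemma gl_regular_br nu (a b : 'I_n.+1) m : gl_regular nu -> (a < b)%N ->
  br T nu a b m != 0.
Proof.
move=> hnu ab; have ab' : a != b by rewrite -val_eqE /= ltn_eqF.
have := hnu a b ab' (- m%:Z); rewrite rmorphN /= -pmulrn.
by rewrite -subr_eq0 opprK.
Qed.

Lemma gl_regular_step nu nu' j : gl_regular nu -> weight_step T nu nu' j ->
  gl_regular nu'.
Proof.
move=> hnu /gl_step h a b ab m; rewrite !h.
have := hnu a b ab (m + (a == j)%:Z - (b == j)%:Z); apply: contra => /eqP e.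
by rewrite !(rmorphD, rmorphN) /= -!pmulrn -e; apply/eqP; ring.
Qed.

(** Here [tau] and [kap] are 1, and the drop of coordinate j by one in nu1 turns the shift j - k - 1
    into j - k. *)
Lemma gl_jcE nu1 nu2 (j k : 'I_n.+1) : weight_step T lam nu1 j ->
  weight_step T nu1 nu2 k -> (k < j)%N ->
  - (tau T nu2 k j * (kap T)^-1 ^+ (j - k) / br T nu1 k j (j - k).-1) = gl_jc k j.
Proof.
move=> /gl_step h1 _ kj.
have nkj : (k == j) = false by rewrite -val_eqE /= ltn_eqF.
have -> : tau T nu2 k j = 1 by [].
have -> : kap T = 1 by [].
have -> : br T nu1 k j (j - k).-1 = nu1 k - nu1 j + (j - k).-1%:R by [].
rewrite !h1 eqxx nkj invr1 expr1n mulr1 /gl_jc !mul1r -invrN; congr (_^-1).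
have -> : (j - k).-1%:R = j%:R - k%:R - 1 :> K.
  by rewrite -(natrB _ (ltnW kj)) -{2}[(j - k)%N]prednK ?subn_gt0 // -natr1 addrK.
by move: (j%:R : K) (k%:R : K) => u v; rewrite mulr0n mulr1n; ring.
Qed.

Lemma gl_fusion :
  fusion_matrix (U := Ugl K n) (@Ugl_vector K n) (@Ugl_vector K n) lam =
  wt0_mx (fun _ _ => 1) (fun a b => (a < b)%N%:R * gl_jc a b).
Proof.
exact: (fusion_matrix_wt0 gl_regular_br gl_regular_step lam_regular gl_jcE).
Qed.

Let jc_neq0 (a b : 'I_n.+1) : a != b -> lam b - lam a + a%:R - b%:R != 0.
Proof.
rewrite eq_sym => ba; have := lam_regular ba (b%:Z - a%:Z); rewrite -subr_eq0.
by rewrite rmorphB /= -!pmulrn opprB addrA.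
Qed.

Lemma gl_exchange_sum :
  exchange_matrix (U := Ugl K n) (@Ugl_vector K n) 1%:M lam =
  \sum_(a < n.+1) EE a a a a
  + \sum_(a < n.+1) \sum_(b < n.+1 | b != a)
      (1 / (lam a - lam b + b%:R - a%:R)) *: EE b a a b
  + \sum_(a < n.+1) \sum_(b < n.+1 | (a < b)%N) EE a a b b
  + \sum_(a < n.+1) \sum_(b < n.+1 | (b < a)%N)
      ((lam b - lam a + a%:R - b%:R - 1) * (lam b - lam a + a%:R - b%:R + 1)
       / (lam b - lam a + a%:R - b%:R) ^+ 2) *: EE a a b b.
Proof.
rewrite -[\sum_a EE a a a a]scale1r -wt0_exchange_sum.
(* The trivial R-matrix is the case of diagonal entry 1 and h = 0, so the diagonal entries of R for
   a > b are 1 - c^2. *)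
have -> : 1%:M = wt0_mx (fun a b : 'I_n.+1 => if a == b then 1 else 1)
    (fun a b => (b < a)%N%:R * 0) :> 'M[K]_(n.+1 * n.+1).
  by rewrite -wt0_mx1; apply: eq_wt0_mx => a b; rewrite ?if_same ?mulr0.
apply: etrans (exchange_matrix_wt0 _ _ gl_fusion) _; apply: eq_wt0_mx => a b.
  have [//|ab] := eqVneq a b; case: ifP => // _.
  rewrite /gl_jc; have := jc_neq0 ab.
  have -> : lam a - lam b + b%:R - a%:R = - (lam b - lam a + a%:R - b%:R) by ring.
  move: (_ - b%:R) => y y0; field; by rewrite ?oppr_eq0 ?y0.
move=> ab; rewrite /gl_jc; case: ifP => // _.
have -> : lam a - lam b + b%:R - a%:R = - (lam b - lam a + a%:R - b%:R) by ring.
by rewrite !div1r invrN sub0r.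
Qed.

End ClassicalFusion.

Section ComplexExponential.
Variable R : realType.
Local Open Scope complex_scope.

Lemma cexp0 : cexp 0 = 1 :> R[i].
Proof. by rewrite /cexp /= expR0 cos0 sin0 mulr1 mulr0. Qed.

Lemma cexpD (a b : R[i]) : cexp (a + b) = cexp a * cexp b.
Proof.
case: a b => [x y] [x' y']; apply/eqP; rewrite eq_complex /= expRD cosD sinD.
by apply/andP; split; apply/eqP; ring.
Qed.

End ComplexExponential.

Theorem theorem40 (R : realType) (n : nat) :
  (* I: U_q(gl(n.+1)) *)
  (forall (eps : R[i]) (lam : 'I_n.+1 -> R[i]),
     (forall m : nat, (0 < m)%N -> cexp eps ^+ m != 1) ->
     generic_q eps lam ->
     let q := cexp eps in
     let qpow (z : R[i]) := cexp (eps * z) in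
     let V := Uq_vector q in
     fusion_matrix (U := Uq n eps) V V lam =
       \sum_(a < n.+1) \sum_(b < n.+1) EE a a b b
       + \sum_(a < n.+1) \sum_(b < n.+1 | (a < b)%N)
           ((q^-1 - q)
            / (qpow (2%:R * (lam a - lam b + b%:R - a%:R)) - 1)) *: EE b a a b
     /\
     exchange_matrix (U := Uq n eps) V (Uq_Rmatrix n q) lam =
       q *: (\sum_(a < n.+1) EE a a a a)
       + \sum_(a < n.+1) \sum_(b < n.+1 | b != a)
           ((q^-1 - q)
            / (qpow (2%:R * (lam b - lam a + a%:R - b%:R)) - 1)) *: EE b a a b
       + \sum_(a < n.+1) \sum_(b < n.+1 | (a < b)%N) EE a a b b
       + \sum_(a < n.+1) \sum_(b < n.+1 | (b < a)%N)
           ((qpow (2%:R * (lam b - lam a + a%:R - b%:R)) - q ^- 2)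
            * (qpow (2%:R * (lam b - lam a + a%:R - b%:R)) - q ^+ 2)
            / (qpow (2%:R * (lam b - lam a + a%:R - b%:R)) - 1) ^+ 2)
           *: EE a a b b)
  /\
  (* II: U(gl(n.+1)) *)
  (forall lam : 'I_n.+1 -> R[i],
     generic lam ->
     let V := @Ugl_vector R[i] n in
     fusion_matrix (U := Ugl R[i] n) V V lam =
       \sum_(a < n.+1) \sum_(b < n.+1) EE a a b b
       + \sum_(a < n.+1) \sum_(b < n.+1 | (a < b)%N)
           (1 / (lam b - lam a + a%:R - b%:R)) *: EE b a a b
     /\
     exchange_matrix (U := Ugl R[i] n) V 1%:M lam =
       \sum_(a < n.+1) EE a a a a
       + \sum_(a < n.+1) \sum_(b < n.+1 | b != a)
           (1 / (lam a - lam b + b%:R - a%:R)) *: EE b a a b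
       + \sum_(a < n.+1) \sum_(b < n.+1 | (a < b)%N) EE a a b b
       + \sum_(a < n.+1) \sum_(b < n.+1 | (b < a)%N)
           ((lam b - lam a + a%:R - b%:R - 1) * (lam b - lam a + a%:R - b%:R + 1)
            / (lam b - lam a + a%:R - b%:R) ^+ 2) *: EE a a b b).
Proof.
split=> [eps lam q_root gen q qpow V|lam gen V]; last first.
  have char0 k : (0 < k)%N -> k%:R != 0 :> R[i] by rewrite pnatr_eq0 -lt0n.
  split; last exact: gl_exchange_sum char0 lam gen.
  exact: etrans (gl_fusion char0 gen) (wt0_lt_sum _).
have h0 : qpow 0 = 1 by rewrite /qpow mulr0 cexp0.
have h1 : qpow 1 = q by rewrite /qpow mulr1.
have hD a b : qpow (a + b) = qpow a * qpow b by rewrite /qpow mulrDr cexpD.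
(* The genericity condition in multiplicative form: the factor 2 becomes a square and the shift m a
   power of q. *)
have reg : uq_regular q qpow lam.
  move=> a b ab m; have := gen a b ab m.
  suff -> : (q ^ m * (qpow (lam a) / qpow (lam b))) ^+ 2 =
    qpow (2%:R * (lam a - lam b + m%:~R)) by [].
  rewrite mulr_natl mulr2n !hD (chN h0 hD) -expr2; congr (_ ^+ 2).
  rewrite mulrC; congr (_ * _).
  case: m => m; first by rewrite -exprnP -pmulrn (ch_nat h0 h1 hD).
  by rewrite NegzE -invr_expz -exprnP rmorphN /= -pmulrn (chN h0 hD) (ch_nat h0 h1 hD).
split; [exact: uq_fusion_sum h0 h1 hD q_root lam reg|].
exact: uq_exchange_sum h0 h1 hD q_root lam reg.
Qed.
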